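(* The set $\mathbf Y^2(\Omega;E)$ of two-scale* Young measures is sequentially weak-* closed in $\mathbf E^2(\Omega;E)^*$. Moreover, each subset $\mathcal Y\subset\mathbf Y^2(\Omega;E)$ satisfying $$\sup\Big\{\int_{\overline\Omega}\int_Z\int_E(1+|z|)\,d\nu_{x,\xi}(z)\,d\xi\,dx+\lambda(\overline\Omega)\ :\ \boldsymbol\nu=(\nu,\lambda,\rho,\nu^\infty)\in\mathcal Y\Big\}<\infty$$ is pre-compact with respect to the relative weak-* topology on $\mathbf Y^2(\Omega;E)\subset\mathbf E^2(\Omega;E)^*$.
   Context: $\Omega\subset\mathbb R^d$ is open and bounded with $\mathscr L^d(\partial\Omega)=0$; $Z=\mathbb T^d=\mathbb R^d/\mathbb Z^d$ with Lebesgue measure $d\xi$; $E$ is a finite-dimensional Euclidean space with open unit ball $\mathbb B_E$ and unit sphere $\partial\mathbb B_E$. A two-scale* Young measure is a four-tuple $\boldsymbol\nu=(\nu,\lambda,\rho,\nu^\infty)$ where: (i) $(x,\xi)\mapsto\nu_{x,\xi}$ is a weak-* measurable (w.r.t. Lebesgue measure) map from $\overline\Omega\times Z$ to $\mathrm{Prob}(E)$ with $(x,\xi)\mapsto\int_E|z|\,d\nu_{x,\xi}(z)$ in $L^1(\overline\Omega\times Z)$; (ii) $\lambda$ is a bounded positive measure on $\overline\Omega$; (iii) $x\mapsto\rho_x$ is a weak-* $\lambda$-measurable map from $\overline\Omega$ to $\mathrm{Prob}(Z)$; (iv) $(x,\xi)\mapsto\nu^\infty_{x,\xi}$ is a weak-*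 $(\lambda\otimes\rho_x)$-measurable map from $\overline\Omega\times Z$ to $\mathrm{Prob}(\partial\mathbb B_E)$. The set of these is $\mathbf Y^2(\Omega;E)$. For $f\in C(\Omega\times Z\times E)$ put $(Tf)(x,\xi,\hat z)=(1-|\hat z|)f(x,\xi,\hat z/(1-|\hat z|))$, $\hat z\in\mathbb B_E$. $\mathbf E^2(\Omega;E)$ is the Banach space of those $f$ for which $Tf$ extends continuously to $\overline{\Omega\times Z\times\mathbb B_E}$, with norm $\|Tf\|_\infty$; for such $f$, $f^\infty(x,\xi,z)=\lim_{x'\to x,\xi'\to\xi,t\to\infty}f(x',\xi',tz)/t$ exists on $\overline\Omega\times Z\times E$. $\mathbf Y^2(\Omega;E)$ is identified with a subset of $\mathbf E^2(\Omega;E)^*$ via $$\langle\!\langle f,\boldsymbol\nu\rangle\!\rangle=\int_\Omega\int_Z\langle f(x,\xi,\cdot),\nu_{x,\xi}\rangle\,d\xi\,dx+\int_{\overline\Omega}\int_Z\langle f^\infty(x,\xi,\cdot),\nu^\infty_{x,\xi}\rangle\,d\rho_x(\xi)\,d\lambda(x),$$ where $\langle h,\sigma\rangle=\int h\,d\sigma$. *)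

(* Defs.v *)
From HB Require Import structures.
From mathcomp Require Import all_boot all_order all_algebra generic_quotient.
From mathcomp Require Import all_classical all_reals all_analysis.
From mathcomp Require Import measurable_realfun.

Set Implicit Arguments.
Unset Strict Implicit.
Unset Printing Implicit Defensive.

Import Order.TTheory GRing.Theory Num.Theory.
Import numFieldNormedType.Exports.

Local Open Scope classical_set_scope.
Local Open Scope ring_scope.

Notation borel T := (g_sigma_algebraType (@open T)).

Lemma borel_open (T : ptopologicalType) (U : set T) :
  open U -> measurable (U : set (borel T)).
Proof. by move=> oU; exact: sub_sigma_algebra. Qed.

Lemma continuous_borel (T U : ptopologicalType) (f : T -> U) :
  continuous f -> measurable_fun [set: borel T] (f : borel T -> borel U).
Proof.
move=> /continuousP cf; apply: (@measurability _ _ (borel T) (borel U) setT f (@open U)) => //.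
by move=> _ [V oV <-]; rewrite setTI; apply: borel_open; exact: cf.
Qed.

Section sigma_finite_pushforward.
Context {d1 d2} {T1 : measurableType d1} {T2 : measurableType d2}
  {R : realType}.
Variables (f : T1 -> T2) (g : T2 -> T1).
Hypotheses (mf : measurable_fun [set: T1] f) (mg : measurable_fun [set: T2] g).
Hypothesis fK : cancel f g.
Variable m : {sigma_finite_measure set T1 -> \bar R}.

Let push := pushforward m f.

Let push0 : push set0 = 0%E.
Proof. by rewrite /push /pushforward preimage_set0 measure0. Qed.

Let push_ge0 A : (0 <= push A)%E. Proof. exact: measure_ge0. Qed.

Let push_sigma_additive : semi_sigma_additive push.
Proof. exact: (@measure_semi_sigma_additive _ _ _ (pushforward m f)). Qed.

HB.instance Definition _ := isMeasure.Build _ _ _ push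
  push0 push_ge0 push_sigma_additive.

Let push_sigma_finite : sigma_finite [set: T2] push.
Proof.
have [F TF Foo] := sigma_finiteT m.
exists (fun i => g @^-1` F i); first by rewrite -preimage_bigcup -TF.
move=> i; have [mF Fi] := Foo i; split.
  by rewrite -[X in measurable X]setTI; exact: mg.
rewrite /push /pushforward -comp_preimage (_ : g \o f = idfun)//.
exact/funext.
Qed.

HB.instance Definition _ := Measure_isSigmaFinite.Build _ _ _ push
  push_sigma_finite.

Definition sigma_finite_pushforward :
  {sigma_finite_measure set T2 -> \bar R} := push.

End sigma_finite_pushforward.

(* Restated because the instance inferred for [m1 \x m2] requires
   sub-probabilities. *)
Section sigma_finite_product.
Context d1 d2 (T1 : measurableType d1) (T2 : measurableType d2) (R : realType).
Variables (m1 : {sigma_finite_measure set T1 -> \bar R})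
  (m2 : {sigma_finite_measure set T2 -> \bar R}).

Definition sigma_finite_product : set (T1 * T2) -> \bar R := (m1 \x m2)%E.

HB.instance Definition _ := Measure.on sigma_finite_product.

Let sigma_finite_product_subproof :
  sigma_finite [set: T1 * T2] sigma_finite_product.
Proof.
have /sigma_finiteP[F [TF ndF Foo]] := sigma_finiteT m1.
have /sigma_finiteP[G [TG ndG Goo]] := sigma_finiteT m2.
exists (fun n => F n `*` G n).
  rewrite -setXTT TF TG predeqE => -[x y]; split.
    move=> [/= [n _ Fnx] [k _ Gky]]; exists (maxn n k) => //; split.
    - by move: x Fnx; exact/subsetPset/ndF/leq_maxl.
    - by move: y Gky; exact/subsetPset/ndG/leq_maxr.
  by move=> [n _ []/= ? ?]; split; exists n.
move=> k; have [? ?] := Foo k; have [? ?] := Goo k.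
split; first exact: measurableX.
by rewrite /sigma_finite_product product_measure1E// lte_mul_pinfty// ge0_fin_numE.
Qed.

HB.instance Definition _ := Measure_isSigmaFinite.Build _ _ _
  sigma_finite_product sigma_finite_product_subproof.

End sigma_finite_product.

(* The n-fold product of the Lebesgue measure on the line. *)
Section lebesgue_tuple.
Variable R : realType.
Local Notation mR := (measurableTypeR R).

Let consf n (p : mR * n.-tuple mR) : n.+1.-tuple mR := [tuple of p.1 :: p.2].
Let splitf n (t : n.+1.-tuple mR) : mR * n.-tuple mR :=
  (tnth t ord0, [tuple of behead t]).

Let measurable_consf n : measurable_fun setT (@consf n).
Proof. exact: measurable_cons. Qed.

Let measurable_splitf n : measurable_fun setT (@splitf n).
Proof.
by apply/measurable_fun_pairP; split; [exact: measurable_tnth|exact: measurable_behead].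
Qed.

Let consfK n : cancel (@consf n) (@splitf n).
Proof. by move=> [x t]; congr pair => //; exact: val_inj. Qed.


Let step n (m : {sigma_finite_measure set n.-tuple mR -> \bar R}) :
  {sigma_finite_measure set n.+1.-tuple mR -> \bar R} :=
  sigma_finite_pushforward (@measurable_consf n) (@measurable_splitf n)
      (@consfK n) (sigma_finite_product (@lebesgue_measure R) m).

Fixpoint lebesgue_tuple n : {sigma_finite_measure set n.-tuple mR -> \bar R} :=
  if n is k.+1 then step (lebesgue_tuple k) else \d_([tuple] : 0.-tuple mR).
End lebesgue_tuple.

Lemma measurable_coord (R : realType) (d : nat) (i : 'I_d) :
  measurable_fun [set: borel 'rV[R]_d]
    ((fun v : 'rV[R]_d => v ord0 i) : borel 'rV[R]_d -> measurableTypeR R).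
Proof.
apply: (@measurability _ _ (borel 'rV[R]_d) (measurableTypeR R) setT _ _
  (@RGenOpens.measurableE R)).
move=> _ [_ [x [y ->]] <-]; rewrite setTI; apply: borel_open.
apply: open_comp; last exact: interval_open.
by move=> v _; exact: coord_continuous.
Qed.

Section lebesgue_rV.
Variables (R : realType) (d : nat).
Local Notation mR := (measurableTypeR R).

Let row_of (t : d.-tuple mR) : borel 'rV[R]_d := \row_i tnth t i.
Let tuple_of_row (v : borel 'rV[R]_d) : d.-tuple mR := [tuple (v : 'rV[R]_d) ord0 i | i < d].

Lemma open_rV_bigcup (U : set 'rV[R]_d) : open U ->
  U = \bigcup_(p in [set p : 'rV[rat]_d * nat |
        ball (map_mx ratr p.1 : 'rV[R]_d) p.2.+1%:R^-1 `<=` U])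
      ball (map_mx ratr p.1 : 'rV[R]_d) p.2.+1%:R^-1.
Proof.
move=> oU; apply/seteqP; split => [x Ux|x [p /= pU] /pU//].
have /nbhs_ballP[e/= e0 eU] : nbhs x U by exact: open_nbhs_nbhs.
have [k ke] : exists k : nat, k.+1%:R^-1 < e / 2 :> R.
  exists (Num.truncn (e / 2)^-1); rewrite invf_plt ?posrE ?divr_gt0//.
  exact: truncnS_gt.
have h i : exists q : rat, `|x ord0 i - ratr q| < k.+1%:R^-1.
  have [|q] := @rat_in_itvoo R (x ord0 i - k.+1%:R^-1) (x ord0 i).
    by rewrite ltrBlDr ltrDl invr_gt0.
  rewrite in_itv/= => /andP[qx xq]; exists q.
  by rewrite ger0_norm ?subr_ge0 ?ltW// ltrBlDl -ltrBlDr.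
have [q hq] := choice h.
have qx : ball (map_mx ratr (\row_i q i) : 'rV[R]_d) k.+1%:R^-1 x.
  split; first by rewrite invr_gt0.
  move=> i j; rewrite !mxE -ball_normE/= distrC (_ : i = ord0) ?hq//.
  by rewrite ord1.
exists (\row_i q i, k) => //= y qy; apply: eU.
apply: (@le_ball _ _ _ (k.+1%:R^-1 + k.+1%:R^-1)).
  by rewrite [leRHS]splitr lerD// ltW.
by apply: ball_triangle qy; exact: ball_sym.
Qed.

Let measurable_row_of : measurable_fun setT row_of.
Proof.
apply: (@measurability _ _ _ (borel 'rV[R]_d) setT row_of (@open _)) => //.
move=> _ [U oU <-]; rewrite setTI (open_rV_bigcup oU) preimage_bigcup.
rewrite bigcup_mkcond; apply: countable_bigcupT_measurable.
  exact: countableP.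
move=> p; case: ifPn => // _.
rewrite (_ : _ @^-1` _ = \bigcap_(i in [set: 'I_d]) (@tnth d mR ^~ i @^-1`
    ball (ratr (p.1 ord0 i) : R) p.2.+1%:R^-1)).
  apply: fin_bigcap_measurable => // i _.
  rewrite -[X in measurable X]setTI; apply: measurable_tnth => //.
  exact: measurable_ball.
apply/seteqP; split => t /=.
  by move=> [_ h] i _ /=; have := h ord0 i; rewrite !mxE.
move=> h; split; first by rewrite invr_gt0.
by move=> i j; rewrite !mxE ord1; exact: h.
Qed.

Let measurable_tuple_of_row : measurable_fun setT tuple_of_row.
Proof.
apply/measurable_fun_tnthP => i.
rewrite (_ : _ \o _ = fun v : 'rV[R]_d => v ord0 i).
  exact: measurable_coord.
by apply/funext => v /=; rewrite tnth_mktuple.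
Qed.

Let row_ofK : cancel row_of tuple_of_row.
Proof. by move=> t; apply: eq_from_tnth => i; rewrite tnth_mktuple mxE. Qed.

Definition lebesgue_rV : {sigma_finite_measure set (borel 'rV[R]_d) -> \bar R} :=
  sigma_finite_pushforward measurable_row_of measurable_tuple_of_row row_ofK
    (lebesgue_tuple R d).
End lebesgue_rV.

Section lebesgue_box.
Variable R : realType.
Local Notation mR := (measurableTypeR R).

Let measurable_tuple_box n (A : 'I_n -> set mR) :
  (forall i, measurable (A i)) ->
  measurable [set t : n.-tuple mR | forall i, A i (tnth t i)].
Proof.
move=> mA; rewrite (_ : [set _ | _] =
    \bigcap_(i in [set: 'I_n]) (@tnth n mR ^~ i @^-1` A i)).
  apply: fin_bigcap_measurable => // i _.
  by rewrite -[X in measurable X]setTI; exact: measurable_tnth.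
by apply/seteqP; split => t /= h i; [move=> _|]; exact: h.
Qed.

Let lebesgue_tuple_box n (A : 'I_n -> set mR) : (forall i, measurable (A i)) ->
  lebesgue_tuple R n [set t | forall i, A i (tnth t i)] =
  (\prod_(i < n) lebesgue_measure (A i))%E.
Proof.
elim: n A => [A _|n ih A mA].
  rewrite big_ord0 /= (_ : [set _ | _] = setT) ?diracT//.
  by apply/seteqP; split => // t _ [].
rewrite big_ord_recl -ih// /= /sigma_finite_pushforward /pushforward/=.
have mA' := @measurable_tuple_box _ (fun i => A (lift ord0 i)) (fun i => mA _).
rewrite /sigma_finite_product -product_measure1E; [|exact: mA|exact: mA'].
congr (_ _); apply/seteqP; split => [[x t]/= h|[x t]/= [h0 h] i].
  split; first by have := h ord0.
  by move=> i; have := h (lift ord0 i); rewrite tnthS.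
by case: (unliftP ord0 i) => [j ->|->//]; rewrite tnthS; exact: h.
Qed.

Lemma lebesgue_rV_box d (A : 'I_d -> set R) :
  (forall i, measurable (A i : set mR)) ->
  lebesgue_rV R d [set v | forall i, A i (v ord0 i)] =
  (\prod_(i < d) lebesgue_measure (A i))%E.
Proof.
move=> mA; rewrite -lebesgue_tuple_box//; congr (lebesgue_tuple R d _).
by apply/seteqP; split => t /= h i; have := h i; rewrite mxE.
Qed.

End lebesgue_box.

Section torus.
Variables (R : realType) (d : nat).

Definition torus_rel (x y : 'rV[R]_d) : bool :=
  [forall i, x ord0 i - y ord0 i \is a Num.int].

Let torus_rel_refl : reflexive torus_rel.
Proof. by move=> x; apply/forallP => i; rewrite subrr rpred0. Qed.

Let torus_rel_sym : symmetric torus_rel.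
Proof. by move=> x y; apply: eq_forallb => i; rewrite -rpredN opprB. Qed.

Let torus_rel_trans : transitive torus_rel.
Proof.
move=> y x z /forallP xy /forallP yz; apply/forallP => i.
by rewrite -(subrKA (y ord0 i)) rpredD.
Qed.

Definition torus_equiv :=
  EquivRel torus_rel torus_rel_refl torus_rel_sym torus_rel_trans.

Definition torus := quotient_topology {eq_quot torus_equiv}%qT.
HB.instance Definition _ := PointedTopological.on torus.

Definition torus_proj (x : 'rV[R]_d) : torus := \pi_torus%qT x.

Lemma measurable_torus_proj :
  measurable_fun [set: borel 'rV[R]_d] (torus_proj : _ -> borel torus).
Proof. by apply: continuous_borel; exact: pi_continuous. Qed.

Definition unit_cube : set (borel 'rV[R]_d) :=
  [set v : 'rV[R]_d | forall i, 0 <= v ord0 i < 1].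

Lemma measurable_unit_cube : measurable unit_cube.
Proof.
rewrite (_ : unit_cube = \bigcap_(i in [set: 'I_d])
    ((fun v : 'rV[R]_d => v ord0 i) @^-1` `[0, 1[)).
  apply: fin_bigcap_measurable => // i _.
  rewrite -[X in measurable X]setTI.
  by apply: measurable_coord => //; exact: measurable_itv.
apply/seteqP; split => v /= h i; first by rewrite /= in_itv/= => _; exact: h.
by have := h i I; rewrite /= in_itv.
Qed.

Definition torus_measure : set (borel torus) -> \bar R :=
  pushforward (mrestr (lebesgue_rV R d) measurable_unit_cube)
    (torus_proj : borel 'rV[R]_d -> borel torus).

Let torus_measure0 : torus_measure set0 = 0%E.
Proof. by rewrite /torus_measure /pushforward preimage_set0 measure0. Qed.

Let torus_measure_ge0 A : (0 <= torus_measure A)%E.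
Proof. by rewrite /torus_measure /pushforward; exact: measure_ge0. Qed.

Let torus_measure_sigma_additive : semi_sigma_additive torus_measure.
Proof.
apply: (@measure_semi_sigma_additive _ _ _ (pushforward _ _)).
exact: measurable_torus_proj.
Qed.

HB.instance Definition _ := isMeasure.Build _ _ _ torus_measure
  torus_measure0 torus_measure_ge0 torus_measure_sigma_additive.

Let torus_measure_setT : torus_measure setT = 1%E.
Proof.
rewrite /torus_measure /pushforward preimage_setT /mrestr setTI.
rewrite (_ : unit_cube = [set v : 'rV[R]_d | forall i, `[0, 1[%classic (v ord0 i)]).
  rewrite (@lebesgue_rV_box R d (fun=> `[0, 1[%classic)) => [|i].
    rewrite big1// => i _.
    by rewrite lebesgue_measure_itv/= lte_fin ltr01 sube0.
  exact: measurable_itv.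
by apply/seteqP; split => v /= h i; have := h i; rewrite in_itv.
Qed.

HB.instance Definition _ := Measure_isProbability.Build _ _ _ torus_measure
  torus_measure_setT.

End torus.
Arguments torus_measure : clear implicits.

Section E2.
Variables (R : realType) (d : nat) (Omega : set 'rV[R]_d) (E : normedModType R).
Local Notation X := ('rV[R]_d * torus R d * E)%type.

Definition unit_ball : set E := [set z | `|z| < 1].
Definition unit_sphere : set E := [set z | `|z| = 1].

Definition over_domain (S : set E) : set X := Omega `*` setT `*` S.

Definition E2_T (f : X -> R) (p : X) : R :=
  (1 - `|p.2|) * f (p.1, (1 - `|p.2|)^-1 *: p.2).

(* Functions on Omega * Z * E are encoded as functions on the whole space that
   vanish off Omega, so that equality of codes is equality on Omega. *)
Definition E2_set : set (X -> R^o) := [set f : X -> R^o |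
  [/\ {within over_domain setT, continuous f},
      forall p, ~ Omega p.1.1 -> f p = 0 &
      exists2 g : X -> R, {within closure (over_domain unit_ball), continuous g}
        & forall p, over_domain unit_ball p -> g p = E2_T f p]].

Definition E2_pred : {pred X -> R^o} := mem E2_set.

Lemma E2_submod_closed : submod_closed E2_pred.
Proof.
split=> [|a f g].
  rewrite inE; split => //; first by move=> x; exact: cvg_cst.
  exists (fun=> 0) => [x|p _]; first exact: cvg_cst.
  by rewrite /E2_T mulr0.
rewrite !inE => -[cf f0 [tf ctf Tf]] [cg g0 [tg ctg Tg]]; split.
- by move=> x; apply: cvgD; [apply: cvgZr; exact: cf|exact: cg].
- by move=> p pO; rewrite /= !fctE f0// g0// scaler0 addr0.
- exists (fun p => a * tf p + tg p) => [x|p op].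
    by apply: cvgD; [apply: cvgMr; exact: ctf|exact: ctg].
  by rewrite Tf// Tg// /E2_T /= mulrDr mulrCA.
Qed.

HB.instance Definition _ := GRing.isSubmodClosed.Build R (X -> R^o) E2_pred
  E2_submod_closed.

Record E2 := MkE2 { E2_fun :> X -> R^o; _ : E2_fun \in E2_pred }.

HB.instance Definition _ := [isSub of E2 for E2_fun].
HB.instance Definition _ := [Choice of E2 by <:].
HB.instance Definition _ := [SubChoice_isSubLmodule of E2 by <:].

Definition E2_norm (f : E2) : R :=
  sup [set `|E2_T f p| | p in over_domain unit_ball].

Definition recession (f : E2) (x : 'rV[R]_d) (xi : torus R d) (z : E) : R :=
  lim (f (q.1.1, q.1.2, q.2 *: z) / q.2
    @[q --> filter_prod (filter_prod (within Omega (nbhs x)) (nbhs xi))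
              (pinfty_nbhs R)]).

(* As a type, [E2_dual] carries the topology induced by pointwise convergence on
   [E2], which is the weak-* topology. *)
Definition E2_dual : set {ptws E2 -> R^o} := [set l : {ptws E2 -> R^o} |
  linear (l : E2 -> R^o) /\
  exists C : R, forall f, `|l f| <= C * E2_norm f].

End E2.
Arguments unit_sphere {R} E.
Arguments E2_dual {R d} Omega E.

Definition euclidean (R : realType) (E : normedModType R) : Prop :=
  (exists dot : E -> E -> R,
    [/\ forall y z, dot y z = dot z y,
        forall a x y z, dot (a *: x + y) z = a * dot x z + dot y z &
        forall z, dot z z = `|z| ^+ 2]) /\
  exists (n : nat) (e : 'I_n -> E),
    forall z, exists c : 'I_n -> R, z = \sum_i c i *: e i.

Section weak_star_measurability.
Context d (T : measurableType d) (R : realType).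

(* Measurability with respect to the mu-completion of the sigma-algebra. [mu] is
   only a set function because it is also used with [semidirect_product],
   for which no measure structure is built. *)
Definition ae_measurable {d'} {U : measurableType d'} (mu : set T -> \bar R)
    (D : set T) (f : T -> U) : Prop :=
  exists2 g : T -> U, measurable_fun D g
    & {ae mu, forall t, D t -> f t = g t}.

Definition L1 (mu : {measure set T -> \bar R}) (D : set T) (f : T -> \bar R) :
    Prop :=
  exists2 g : T -> \bar R, mu.-integrable D g
    & {ae mu, forall t, D t -> f t = g t}.

(* C_0(S) for S in K: the continuous functions on S vanishing at infinity, that
   is, all continuous functions on S when S is compact. *)
Definition C0 (K : ptopologicalType) (S : set K) : set (K -> R) :=
  [set h | {within S, continuous h} /\
    forall e : R, 0 < e -> compact (S `&` [set z | e <= `|h z|])].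

Definition weak_star_measurable (K : ptopologicalType) (S : set K)
    (mu : set T -> \bar R) (D : set T) (k : T -> probability (borel K) R) :
    Prop :=
  forall h, C0 S h -> ae_measurable mu D (fun t => \int[k t]_(z in S) h z).

End weak_star_measurability.

(* The measure mu (x) k_x on T1 * T2. *)
Definition semidirect_product d1 d2 (T1 : measurableType d1)
    (T2 : measurableType d2) (R : realType) (mu : {measure set T1 -> \bar R})
    (k : T1 -> probability T2 R) (A : set (T1 * T2)) : \bar R :=
  (\int[mu]_x k x (xsection A x))%E.

Section young_measure.
Variables (R : realType) (d : nat) (Omega : set 'rV[R]_d) (E : normedModType R).
Local Notation Rd := (borel 'rV[R]_d).
Local Notation Z := (borel (torus R d)).

(* Measures on the closure of Omega (resp. on the unit sphere) are encoded as
   measures on the whole space concentrated there; the families are total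
   functions whose values off the closure of Omega are irrelevant. *)
Record young_measure := YoungMeasure {
  ym_nu : Rd * Z -> probability (borel E) R;
  ym_lambda : {finite_measure set Rd -> \bar R};
  ym_rho : Rd -> probability Z R;
  ym_nuoo : Rd * Z -> probability (borel E) R;
  ym_nu_measurable : weak_star_measurable setT
    (lebesgue_rV R d \x torus_measure R d)%E (closure Omega `*` setT) ym_nu;
  ym_nu_L1 : L1 (lebesgue_rV R d \x torus_measure R d)%E
    (closure Omega `*` setT) (fun p => \int[ym_nu p]_z `|z|%:E)%E;
  ym_lambda_supp : ym_lambda (~` closure Omega) = 0%E;
  ym_rho_measurable :
    weak_star_measurable setT ym_lambda (closure Omega) ym_rho;
  ym_nuoo_sphere :
    forall p, closure Omega p.1 -> ym_nuoo p (unit_sphere E) = 1%E;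
  ym_nuoo_measurable : weak_star_measurable (unit_sphere E)
    (semidirect_product ym_lambda ym_rho) (closure Omega `*` setT) ym_nuoo
}.

Definition pairing (f : E2 Omega E) (nu : young_measure) : R :=
  (\int[lebesgue_rV R d]_(x in Omega) \int[torus_measure R d]_xi
      \int[ym_nu nu (x, xi)]_z f (x, xi, z)) +
  (\int[ym_lambda nu]_(x in closure Omega) \int[ym_rho nu x]_xi
      \int[ym_nuoo nu (x, xi)]_(z in unit_sphere E) recession f x xi z).

Definition mass (nu : young_measure) : \bar R :=
  ((\int[lebesgue_rV R d]_(x in closure Omega) \int[torus_measure R d]_xi
      \int[ym_nu nu (x, xi)]_z (1 + `|z|)%:E) +
   ym_lambda nu (closure Omega))%E.

(* [nu] is identified with the functional [l]. *)
Definition represents (nu : young_measure) (l : E2_dual Omega E) : Prop :=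
  forall f, set_val l f = pairing f nu.

Definition Y2 : set (E2_dual Omega E) :=
  [set l | exists nu, represents nu l].

End young_measure.
Arguments Y2 {R d} Omega E.

Definition boundary (T : topologicalType) (A : set T) : set T :=
  closure A `\` interior A.

Definition seq_closed (T : topologicalType) (A : set T) : Prop :=
  forall (u : nat -> T) (l : T), (forall n, A (u n)) -> u @ \oo --> l -> A l.

(* Main.v *)
Require Import Defs.
From HB Require Import structures.
From mathcomp Require Import all_boot all_order all_algebra.
From mathcomp Require Import all_classical all_reals all_analysis.
From mathcomp Require Import measurable_realfun.
From mathcomp Require Import ring lra.

(** A functional in the weak-* closure of the Young measures is positive and
    satisfies [l f = \int_Omega \int_Z f(x, xi)] for the integrands [f] that do not
    depend on [z], as both properties pass to pointwise limits.  Conversely they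
    characterize Young measures, as soon as one exists (the unit sphere is empty
    if [E = 0]).  Indeed [T] identifies the integrands with the continuous functions
    on the compact set [K], product of the closure of [Omega], the torus and the
    closed unit ball, so [l] is the integral against a finite measure [mu] on [K].
    The restriction of [(1 - |z|) mu] to the open ball, transported by
    [z |-> z / (1 - |z|)], has the Lebesgue measure of [Omega x Z] as its marginal,
    by the second property, and disintegrates into [nu]; the restriction of [mu] to
    the sphere disintegrates into [lambda], [rho] and [nuoo].  Since
    [|l f| <= |f| l (1 + |z|)] and [l (1 + |z|)] is the mass, compactness is then
    Tychonoff's theorem. *)

Import Order.TTheory GRing.Theory Num.Theory.
Import numFieldNormedType.Exports.
Local Open Scope classical_set_scope.
Local Open Scope ring_scope.
Set Implicit Arguments.
Unset Strict Implicit.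
Unset Printing Implicit Defensive.

(** * Positive functionals are integrals *)

(** The measure [mu] lives over the closure of [Omega], while the first integral of the pairing sees
    only [Omega]. The second property bridges the gap: tested on [phi(x) psi(xi)], whose transform
    is [(1 - |z|) phi psi], it identifies the marginal of [(1 - |z|) mu] with the Lebesgue measure
    of [Omega x Z], so that [mu] charges no point of the open ball over the boundary of [Omega].
    That the boundary is Lebesgue null then gives the first moment of [nu] over the whole closure.
    Kernels are obtained as laws of [G(x, u)] with [G] jointly measurable and [u] an independent
    random variable: they are probabilities at every point, and integrals against them are
    measurable by Fubini. On the line [G] is the conditional quantile function; products and
    measurable retracts carry it to [E] and to the torus. Pairings are iterated real integrals whose
    integrability is unknown, so the two properties are chosen to hold for them regardless;
    linearity is read off from membership in the dual. *)

Section daniell.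
Context d (T : measurableType d) (R : realType).
Variables (K : set T) (V : set (T -> R)) (L : (T -> R) -> R).
Hypothesis Vcst : forall c, V (fun=> c).
Hypothesis VD : forall f g, V f -> V g -> V (fun x => f x + g x).
Hypothesis VM : forall f g, V f -> V g -> V (fun x => f x * g x).
Hypothesis Vmax : forall f g, V f -> V g -> V (fun x => Num.max (f x) (g x)).
Hypothesis LD : forall f g, V f -> V g -> L (fun x => f x + g x) = L f + L g.
Hypothesis LZ : forall c f, V f -> L (fun x => c * f x) = c * L f.
Hypothesis L_ge0 : forall f, V f -> (forall x, K x -> 0 <= f x) -> 0 <= L f.
(** Stands for the compactness of [K]: [T] is only a measurable space here, and Dini's theorem is
    the one topological fact that the construction uses. *)
Hypothesis Vdini : forall (f : nat -> T -> R) g, (forall n, V (f n)) -> V g ->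
  (forall x m n, K x -> (m <= n)%N -> f m x <= f n x) ->
  (forall x, K x -> exists n, g x <= f n x) ->
  forall e : R, 0 < e -> exists n, forall x, K x -> g x <= f n x + e.

Let VZ c f : V f -> V (fun x => c * f x).
Proof. by move=> Vf; exact: VM. Qed.

Let VN f : V f -> V (fun x => - f x).
Proof.
by move=> Vf; rewrite (_ : (fun _ => _) = fun x => -1 * f x);
  [exact: VZ|apply/funext => x; rewrite mulN1r].
Qed.

Let VB f g : V f -> V g -> V (fun x => f x - g x).
Proof. by move=> Vf Vg; exact/VD/VN. Qed.

Let LN f : V f -> L (fun x => - f x) = - L f.
Proof. by move=> Vf; under eq_fun do rewrite -mulN1r; rewrite LZ// mulN1r. Qed.

Let LB f g : V f -> V g -> L (fun x => f x - g x) = L f - L g.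
Proof. by move=> Vf Vg; rewrite LD ?LN//; exact: VN. Qed.

Let L_le f g : V f -> V g -> (forall x, K x -> f x <= g x) -> L f <= L g.
Proof.
move=> Vf Vg fg; rewrite -subr_ge0 -LB//; apply: L_ge0; first exact: VB.
by move=> x Kx; rewrite subr_ge0 fg.
Qed.

Let L0 : L (fun=> 0) = 0.
Proof.
by rewrite -[RHS](mul0r (L (fun=> 0))) -LZ//; congr L; apply/funext => x;
  rewrite mul0r.
Qed.

Let Vsum (n : nat) (f : nat -> T -> R) : (forall i, V (f i)) ->
  V (fun x => \sum_(i < n) f i x).
Proof.
move=> Vf; elim: n => [|n ih].
  by under eq_fun do rewrite big_ord0; exact: Vcst.
by under eq_fun do rewrite big_ord_recr/=; exact: VD.
Qed.

Let Lsum (n : nat) (f : nat -> T -> R) : (forall i, V (f i)) ->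
  L (fun x => \sum_(i < n) f i x) = \sum_(i < n) L (f i).
Proof.
move=> Vf; elim: n => [|n ih].
  by under eq_fun do rewrite big_ord0; rewrite big_ord0.
under eq_fun do rewrite big_ord_recr/=.
by rewrite LD ?ih ?big_ord_recr//; exact: Vsum.
Qed.

(** An increasing sequence plays the part of its supremum, a lower semicontinuous function above the
    indicator of [A], and [c] bounds the extension of [L] to it. Conditions are imposed on [K] only,
    which makes the complement of [K] null. *)
Definition daniell_cover (A : set T) : set R := [set c |
  exists f : nat -> T -> R, [/\ forall n, V (f n),
    forall n x, K x -> 0 <= f n x,
    forall x m n, K x -> (m <= n)%N -> f m x <= f n x,
    forall x, K x -> A x -> exists n, 1 <= f n x &
    forall n, L (f n) <= c]].

Definition daniell_outer (A : set T) : \bar R :=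
  ereal_inf [set c%:E | c in daniell_cover A].

Lemma daniell_outer_le (A : set T) (f : T -> R) : V f ->
  (forall x, K x -> 0 <= f x) -> (forall x, K x -> A x -> 1 <= f x) ->
  (daniell_outer A <= (L f)%:E)%E.
Proof.
move=> Vf f0 f1; apply: ereal_inf_lbound; exists (L f) => //.
exists (fun=> f); split => //.
by move=> x Kx Ax; exists 0%N; exact: f1.
Qed.

(** If [g] covers [A], then [f] lies pointwise below the supremum of the [g n]; Dini makes this
    [f <= g n + e] on [K], at the cost of [e * L 1]. *)
Lemma daniell_outer_ge (A : set T) (f : T -> R) : V f ->
  (forall x, K x -> A x -> f x <= 1) -> (forall x, K x -> ~ A x -> f x <= 0) ->
  ((L f)%:E <= daniell_outer A)%E.
Proof.
move=> Vf f1 f0; apply: le_ereal_inf_tmp => _ [c [g [Vg g0 gnd g1 Lg]] <-].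
rewrite lee_fin; apply/ler_addgt0Pr => e e0.
(* The error will be [e / L 1], so [L 1 = 0] is set apart; there an error of 1 costs nothing. *)
have [l1|l1] := leP (L (fun=> 1)) 0.
  have L10 : L (fun=> 1) = 0 by apply/eqP; rewrite eq_le l1 L_ge0.
  have [|n fn] := @Vdini g f Vg Vf gnd _ 1 ltr01.
    move=> x Kx; have [Ax|Ax] := pselect (A x).
      by have [n gn] := g1 x Kx Ax; exists n; exact: le_trans (f1 _ Kx Ax) _.
    by exists 0%N; exact: le_trans (f0 _ Kx Ax) (g0 _ _ Kx).
  have := L_le Vf (VD (Vg n) (Vcst 1)) fn; rewrite LD// L10 addr0 => h.
  by rewrite (le_trans h)// (le_trans (Lg n))// lerDl ltW.
have e1 : 0 < e / L (fun=> 1) by rewrite divr_gt0.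
have [|n fn] := @Vdini g f Vg Vf gnd _ _ e1.
  move=> x Kx; have [Ax|Ax] := pselect (A x).
    by have [n gn] := g1 x Kx Ax; exists n; exact: le_trans (f1 _ Kx Ax) _.
  by exists 0%N; exact: le_trans (f0 _ Kx Ax) (g0 _ _ Kx).
have := L_le Vf (VD (Vg n) (VZ (e / L (fun=> 1)) (Vcst 1))).
rewrite LD ?LZ// ?divfK ?gt_eqF//.
by move=> h; apply: (le_trans (h _)) => [x Kx|];
  [rewrite mulr1 fn|rewrite lerD2r].
Qed.

Let outer0 : daniell_outer set0 = 0%E.
Proof.
apply/eqP; rewrite eq_le; apply/andP; split.
  by rewrite -[X in (_ <= X%:E)%E]L0; exact: daniell_outer_le.
by rewrite -[X in (X%:E <= _)%E]L0; exact: daniell_outer_ge.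
Qed.

Let outer_ge0 A : (0 <= daniell_outer A)%E.
Proof. by rewrite -[X in (X%:E <= _)%E]L0; exact: daniell_outer_ge. Qed.

Let outer_le : {homo daniell_outer : A B / A `<=` B >-> (A <= B)%E}.
Proof.
move=> A B AB; apply/ereal_inf_le_tmp => _ [c [f [? ? ? f1 ?]] <-]; exists c => //.
by exists f; split => // x Kx /AB; exact: f1.
Qed.

Let outer_fin A : daniell_outer A \is a fin_num.
Proof.
rewrite ge0_fin_numE// (@le_lt_trans _ _ (L (fun=> 1))%:E) ?ltry//.
by apply: daniell_outer_le.
Qed.

Let cover_adherent A (e : R) : 0 < e ->
  exists2 c, daniell_cover A c & (c%:E <= daniell_outer A + e%:E)%E.
Proof.
move=> e0; have [_ [c Ac <-] ce] := lb_ereal_inf_adherent e0 (outer_fin A).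
by exists c => //; exact: ltW.
Qed.

(** If [f i] almost realizes the outer measure of [A i], the diagonal sequence of the
    [f 0 n + ... + f (n-1) n] is increasing and covers the union. *)
Let outer_sigma_subadditive : sigma_subadditive daniell_outer.
Proof.
move=> A; apply/lee_addgt0Pr => e e0.
rewrite (le_trans _ (epsilon_trick _ _ (ltW e0)))//.
have en n : 0 < e / (2 ^ n.+1)%:R by rewrite divr_gt0// ltr0n expn_gt0.
have /choice[c hc] n : exists c, daniell_cover (A n) c /\
    (c%:E <= daniell_outer (A n) + (e / (2 ^ n.+1)%:R)%:E)%E.
  by have [c ? ?] := cover_adherent (A n) (en n); exists c.
have /choice[f hf] n := (hc n).1.
have Vf i n : V (f i n) by have [] := hf i.
have f0 i n x : K x -> 0 <= f i n x by have [_ + _ _ _] := hf i; apply.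
have fnd i x m n : K x -> (m <= n)%N -> f i m x <= f i n x.
  by have [_ _ + _ _] := hf i; apply.
set S := (X in (_ <= X)%E).
have cS n : ((\sum_(i < n) c i)%:E <= S)%E.
  rewrite -sumEFin (@le_trans _ _ (\sum_(0 <= i < n)
    (daniell_outer (A i) + (e / (2 ^ i.+1)%:R)%:E)))%E//.
    by rewrite big_mkord; apply: lee_sum => i _; exact: (hc i).2.
  apply: nneseries_lim_ge => i _ _.
  by rewrite adde_ge0// lee_fin ltW.
have Lc n : (L (fun x => \sum_(i < n) f i n x) <= \sum_(i < n) c i).
  rewrite (@Lsum n (fun i => f i n))//; apply: ler_sum => i _.
  by have [_ _ _ _] := hf i; exact.
have [->|Sfin] := eqVneq S +oo%E; first by rewrite leey.
have S0 : (0 <= S)%E.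
  by apply: nneseries_ge0 => i _ _; rewrite adde_ge0// lee_fin ltW.
have SE : S = (fine S)%:E by rewrite fineK// ge0_fin_numE// ltey.
rewrite SE; apply: ereal_inf_lbound; exists (fine S) => //.
exists (fun n x => \sum_(i < n) f i n x); split.
- by move=> n; apply: (@Vsum n (fun i => f i n)).
- by move=> n x Kx; apply: sumr_ge0 => i _; exact: f0.
- move=> x m n Kx mn.
  rewrite -(big_mkord xpredT (fun i => f i m x)) -(big_mkord xpredT (fun i => f i n x)).
  rewrite (big_cat_nat (leq0n m) mn)//= -[leLHS]addr0 lerD//.
    by apply: ler_sum => i _; exact: fnd.
  by apply: sumr_ge0 => i _; exact: f0.
- move=> x Kx [i _ Aix]; have [_ _ _ /(_ x Kx Aix)[n fn] _] := hf i.
  exists (maxn n i.+1); have ii : (i < maxn n i.+1)%N by rewrite leq_max leqnn orbT.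
  rewrite (bigD1 (Ordinal ii))//= -[leLHS]addr0 lerD//.
    by rewrite (le_trans fn)// fnd// leq_maxl.
  by apply: sumr_ge0 => j _; exact: f0.
- by move=> n; rewrite (le_trans (Lc n))// -lee_fin -SE.
Qed.

HB.instance Definition _ := isOuterMeasure.Build R T daniell_outer
  outer0 outer_ge0 outer_le outer_sigma_subadditive.

(** The functions [p n = min(1, n h)] increase to the indicator of [A] on [K]. A cover [f] of [X]
    splits into [f n * p n], which covers the part in [A], and [f * (1 - p n)], which covers the
    rest because [p n] vanishes there. *)
Lemma daniell_caratheodory (A : set T) (h : T -> R) : V h ->
  (forall x, K x -> 0 <= h x) -> (forall x, K x -> A x <-> 0 < h x) ->
  daniell_outer.-caratheodory A.
Proof.
move=> Vh h0 Ah; apply: le_caratheodory_measurable => X.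
pose p n x := Num.min 1 (n%:R * h x).
have Vp n : V (p n).
  rewrite (_ : p n = fun x => - Num.max (-1) (- (n%:R * h x))).
    by apply: VN; apply: Vmax => //; exact/VN/VZ.
  by apply/funext => x; rewrite /p oppr_max !opprK.
have p0 n x : K x -> 0 <= p n x.
  by move=> Kx; rewrite /p le_min ler01 mulr_ge0 ?ler0n ?h0.
have p1 n x : p n x <= 1 by rewrite /p ge_min lexx.
have pnd x m n : K x -> (m <= n)%N -> p m x <= p n x.
  move=> Kx mn; rewrite /p le_min ge_min lexx/= ge_min; apply/orP; right.
  by rewrite ler_wpM2r ?h0// ler_nat.
apply: le_ereal_inf_tmp => _ [c [f [Vf f0 fnd f1 Lf]] <-].
have V1p n : V (fun x => 1 - p n x) by exact: VB.
have step n : ((L (fun x => f n x * p n x))%:E + daniell_outer (X `&` ~` A) <= c%:E)%E.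
  rewrite -leeBrDl// -EFinB; apply: ereal_inf_lbound; eexists; last by [].
  (* The shift by [n] gives [f n <= f (m + n)], hence [f n * p n + f (m + n) * (1 - p n) <= f (m +
     n)], whose [L] is at most [c]. *)
  exists (fun m x => f (m + n)%N x * (1 - p n x)); split.
  - by move=> m; exact: VM.
  - by move=> m x Kx; rewrite mulr_ge0 ?f0 ?subr_ge0.
  - move=> x i j Kx ij; rewrite ler_wpM2r ?subr_ge0//.
    by rewrite fnd// leq_add2r.
  - move=> x Kx [Xx nAx]; have [m fm] := f1 _ Kx Xx; exists m.
    have h00 : h x = 0.
      apply/eqP; rewrite eq_le h0// andbT leNgt; apply/negP.
      by move/(Ah x Kx).
    by rewrite /p h00 mulr0 (min_idPr _)// subr0 mulr1 (le_trans fm)// fnd// leq_addr.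
  - move=> m; rewrite lerBrDl -LD//; [|exact: VM|exact: VM].
    apply: le_trans (Lf (m + n)%N); apply: L_le => //.
      by apply: VD; exact: VM.
    move=> x Kx; rewrite mulrBr mulr1 addrCA gerDl subr_le0.
    by rewrite ler_wpM2r ?p0// fnd// leq_addl.
rewrite -leeBrDr//.
have -> : (c%:E - daniell_outer (X `&` ~` A) =
    (c - fine (daniell_outer (X `&` ~` A)))%:E)%E by rewrite EFinB fineK.
apply: ereal_inf_lbound; eexists; last by [].
exists (fun n x => f n x * p n x); split.
- by move=> n; exact: VM.
- by move=> n x Kx; rewrite mulr_ge0 ?f0 ?p0.
- by move=> x m n Kx mn; rewrite ler_pM ?f0 ?p0 ?fnd ?pnd.
- move=> x Kx [Xx Ax]; have [m fm] := f1 _ Kx Xx.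
  have hx : 0 < h x by exact/(Ah x Kx).
  pose k := Num.truncn (h x)^-1.
  exists (maxn m k.+1); rewrite -[leLHS]mulr1 ler_pM//.
    by rewrite (le_trans fm)// fnd// leq_maxl.
  apply: (@le_trans _ _ (p k.+1 x)); last by rewrite pnd// leq_maxr.
  rewrite /p le_min lexx/= -ler_pdivrMr// mul1r ltW//.
  exact: truncnS_gt.
- move=> n; rewrite lerBrDr -lee_fin EFinD fineK//; exact: step.
Qed.

Variable G : set (set T).
Hypothesis G_bump : forall A, G A -> exists2 h, V h &
  forall x, K x -> 0 <= h x /\ (A x <-> 0 < h x).
Hypothesis G_gen : forall A : set T, measurable A -> <<s G >> A.

Let measurable_caratheodory (A : set T) : measurable A ->
  daniell_outer.-caratheodory A.
Proof.
move=> /G_gen; apply: smallest_sub A => [|A GA].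
  split.
  - exact: caratheodory_measurable_set0.
  - by move=> A mA; rewrite setTD; exact: caratheodory_measurable_setC.
  - exact: caratheodory_measurable_bigcup.
have [h Vh hA] := G_bump GA.
by apply: (daniell_caratheodory Vh) => x Kx; have [] := hA x Kx.
Qed.

Hypothesis mK : measurable K.

Definition daniell_measure : set T -> \bar R := daniell_outer.

Let measure_sigma_additive : semi_sigma_additive daniell_measure.
Proof.
move=> A mA tA mbigcupA.
apply: (@caratheodory_measure_sigma_additive _ _ daniell_outer) => //.
- by move=> i; apply: measurable_caratheodory; exact: mA.
- exact: measurable_caratheodory.
Qed.

HB.instance Definition _ := isMeasure.Build _ _ _ daniell_measure
  outer0 outer_ge0 measure_sigma_additive.

Let measure_fin : fin_num_fun daniell_measure.
Proof. by move=> A _; exact: outer_fin. Qed.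

HB.instance Definition _ := Measure_isFinite.Build _ _ _ daniell_measure
  measure_fin.

Let mu : {finite_measure set T -> \bar R} := daniell_measure.

Let muKC : mu (~` K) = 0%E.
Proof.
apply/eqP; rewrite eq_le measure_ge0 andbT.
by rewrite -[X in (_ <= X%:E)%E]L0; exact: daniell_outer_le.
Qed.

Let muK : mu K = (L (fun=> 1))%:E.
Proof.
apply/eqP; rewrite eq_le; apply/andP; split.
  exact: daniell_outer_le.
exact: daniell_outer_ge.
Qed.

(** Cut [g] into [n] layers of height [h]. The bottom layer [v = min(g, h)] satisfies
    [L v <= h mu(g > 0)], whereas its integral is at least [h mu(g > h)], which pays for the error
    of the remaining layers. The errors telescope, and only that of the bottom layer is left. *)
Let le_integral_daniell (h : R) n (g : T -> R) : 0 < h -> V g ->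
  measurable_fun K g -> (forall x, K x -> 0 <= g x <= n%:R * h) ->
  ((L g)%:E <= \int[mu]_(x in K) (g x)%:E +
     h%:E * mu (K `&` [set x | 0 < g x]%R))%E.
Proof.
move=> h0; elim: n g => [|n ih] g Vg mg g0.
  have -> : L g = 0.
    rewrite -L0; apply/eqP; rewrite eq_le !L_le// => x Kx;
      by have := g0 x Kx; rewrite mul0r => /andP[].
  rewrite adde_ge0//; last by rewrite mule_ge0// lee_fin ltW.
  by apply: integral_ge0 => x Kx; rewrite lee_fin; have /andP[] := g0 x Kx.
pose u x := Num.max (g x - h) 0.
pose v x := g x - u x.
have Vu : V u by apply: Vmax => //; exact: VB.
have Vv : V v by exact: VB.
have mu_ : measurable_fun K u.
  by apply: measurable_maxr => //; exact: measurable_funB.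
have mv : measurable_fun K v by exact: measurable_funB.
have u0 x : 0 <= u x by rewrite /u le_max lexx orbT.
have v0 x : K x -> 0 <= v x.
  move=> Kx; have /andP[gx _] := g0 x Kx.
  by rewrite /v /u subr_ge0 ge_max gx gerBl ltW.
have vh x : v x <= h by rewrite /v /u lerBlDr addrC -lerBlDr le_max lexx.
have gvu x : g x = v x + u x by rewrite /v subrK.
have mpos (w : T -> R) : measurable_fun K w ->
    measurable (K `&` [set x | 0 < w x]).
  move=> mw; rewrite (_ : [set _ | _] = w @^-1` `]0, +oo[); first exact: mw.
  by apply/seteqP; split => x /=; rewrite in_itv/= andbT.
have Lv : ((L v)%:E <= h%:E * mu (K `&` [set x | 0 < g x]%R))%E.
  rewrite -lee_pdivrMl// -EFinM -LZ//; apply: daniell_outer_ge => //.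
  - exact: VZ.
  - by move=> x Kx _; rewrite ler_pdivrMl// mulr1.
  - move=> x Kx nA; have /andP[gx _] := g0 x Kx.
    have g00 : g x = 0.
      by apply/eqP; rewrite eq_le gx andbT leNgt; apply/negP => ?; apply: nA.
    by rewrite /v g00 sub0r mulrN oppr_le0 mulr_ge0// invr_ge0 ltW.
have Lu : ((L u)%:E <= \int[mu]_(x in K) (u x)%:E +
     h%:E * mu (K `&` [set x | 0 < u x]%R))%E.
  apply: ih => // x Kx; rewrite u0/= /u ge_max; apply/andP.
  split; last by rewrite mulr_ge0// ltW.
  by have /andP[_] := g0 x Kx; rewrite mulrSr mulrDl mul1r lerBlDr.
have vu : (h%:E * mu (K `&` [set x | 0 < u x]%R) <= \int[mu]_(x in K) (v x)%:E)%E.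
  rewrite -integral_cst; last exact: mpos.
  apply: (@le_trans _ _ (\int[mu]_(x in K `&` [set x | 0 < u x]%R) (v x)%:E)%E).
    apply: ge0_le_integral => //.
    - exact: mpos.
    - by move=> x _; rewrite lee_fin ltW.
    - apply/measurable_EFinP; apply: measurable_funS mv => //.
    - move=> x [_ ux]; rewrite /cst lee_fin /v; move: ux.
      rewrite /= /u lt_max ltxx orbF => ux.
      by rewrite (max_idPl (ltW ux)) subKr lexx.
  by apply: ge0_subset_integral => //; [exact: mpos|exact/measurable_EFinP].
have -> : L g = L v + L u by rewrite -LD//; congr L; apply/funext.
have -> : (\int[mu]_(x in K) (g x)%:E =
    \int[mu]_(x in K) (v x)%:E + \int[mu]_(x in K) (u x)%:E)%E.
  rewrite -ge0_integralD//; first by apply: eq_integral => x _; rewrite gvu EFinD.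
  - exact/measurable_EFinP.
  - by move=> x _; rewrite lee_fin u0.
  - exact/measurable_EFinP.
rewrite EFinD addeC.
apply: (le_trans (leeD Lu Lv)); apply: leeD => //.
by rewrite addeC leeD2r.
Qed.

Let daniell_le g (M : R) : V g -> measurable_fun K g ->
  (forall x, K x -> 0 <= g x <= M) -> ((L g)%:E <= \int[mu]_(x in K) (g x)%:E)%E.
Proof.
move=> Vg mg gM; apply/lee_addgt0Pr => e e0.
have m0 : 0 < fine (mu K) + 1 by rewrite ltr_wpDl// fine_ge0.
(* The error [h mu(K)] is then at most [e]; adding 1 avoids a division by zero. *)
pose h := e / (fine (mu K) + 1).
have h0 : 0 < h by rewrite divr_gt0.
pose n := (Num.truncn (M / h)).+1.
have := @le_integral_daniell h n g h0 Vg mg.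
move=> /(_ _)/le_trans; apply.
  move=> x Kx; have /andP[-> gx] := gM x Kx; rewrite (le_trans gx)//=.
  by rewrite -ler_pdivrMr// ltW// truncnS_gt.
rewrite leeD2l//; apply: (@le_trans _ _ (h%:E * mu K)%E).
  rewrite lee_pmul2l//; apply: le_measure; rewrite ?inE//.
  rewrite (_ : [set _ | _] = g @^-1` `]0, +oo[); first exact: mg.
  by apply/seteqP; split => x /=; rewrite in_itv/= andbT.
rewrite -[mu K]fineK ?fin_num_measure// -EFinM lee_fin /h mulrAC ler_pdivrMr//.
by rewrite ler_pM2l// lerDl.
Qed.

(** One inequality suffices: adding the constant [M], on which both sides agree since [mu K = L 1],
    removes the sign condition, and passing to [- g] reverses it. *)
Theorem daniell_integral : exists mu : {finite_measure set T -> \bar R},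
  mu (~` K) = 0%E /\
  forall (g : T -> R) (M : R), V g -> measurable_fun K g ->
    (forall x, K x -> `|g x| <= M) ->
  L g = \int[mu]_(x in K) g x.
Proof.
exists mu; split => //.
have main (g : T -> R) (M : R) : V g -> measurable_fun K g ->
    (forall x, K x -> `|g x| <= M) ->
    mu.-integrable K (EFin \o g) /\ L g <= \int[mu]_(x in K) g x.
  move=> Vg mg gM.
  have muKy : (mu K < +oo)%E by rewrite ltey_eq fin_num_measure.
  have intg : mu.-integrable K (EFin \o g).
    apply: measurable_bounded_integrable => //.
    by exists M; split; [exact: num_real|move=> r Mr x Kx /=;
      rewrite (le_trans (gM x Kx))// ltW].
  have intM : mu.-integrable K (EFin \o (fun=> M)).
    apply: measurable_bounded_integrable => //.
    by exists `|M|; split; [exact: num_real|move=> r Mr x Kx /=; rewrite ltW].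
  split => //.
  have mgM : measurable_fun K (fun x => g x + M) by exact: measurable_funD.
  have gM2 x : K x -> 0 <= g x + M <= M + M.
    move=> Kx; have := gM x Kx; rewrite ler_norml => /andP[h1 h2].
    by rewrite -lerBlDr sub0r h1 lerD2r.
  have := @daniell_le (fun x => g x + M) (M + M) (VD Vg (Vcst M)) mgM gM2.
  rewrite -[X in (_ <= X)%E]fineK; last first.
    exact: (integrable_fin_num mK (integrableD mK intg intM)).
  rewrite lee_fin LD// -/(Rintegral _ _ _) RintegralD// Rintegral_cst//.
  have -> : L (fun=> M) = M * fine (mu K).
    rewrite muK/= -LZ//; congr L; apply/funext => x; rewrite mulr1//.
  by rewrite lerD2r.
move=> g M Vg mg gM; apply/eqP; rewrite eq_le (main g M Vg mg gM).2/=.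
have [||_] := @main (fun x => - g x) M (VN Vg).
- exact: measurableT_comp.
- by move=> x Kx; rewrite normrN gM.
rewrite LN// (_ : \int[mu]_(x in K) - g x = - \int[mu]_(x in K) g x) ?lerN2//.
have := @RintegralZl _ _ _ mu K g (-1) mK (main g M Vg mg gM).1.
by rewrite mulN1r => <-; apply: eq_Rintegral => x _; rewrite mulN1r.
Qed.

End daniell.

(** * Disintegration of measures *)

Section measure_push.
Context d1 d2 (T1 : measurableType d1) (T2 : measurableType d2) (R : realType).
Variables (f : T1 -> T2) (mf : measurable_fun [set: T1] f).
Variable m : {measure set T1 -> \bar R}.

Definition measure_push0 : set T2 -> \bar R := pushforward m f.

Let push0 : measure_push0 set0 = 0%E.
Proof. by rewrite /measure_push0 /pushforward preimage_set0 measure0. Qed.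

Let push_ge0 A : (0 <= measure_push0 A)%E. Proof. exact: measure_ge0. Qed.

Let push_sigma_additive : semi_sigma_additive measure_push0.
Proof.
have mpre A : measurable A -> measurable (f @^-1` A).
  by move=> mA; rewrite -[X in measurable X]setTI; exact: mf.
move=> F mF tF mUF; rewrite /measure_push0 /pushforward preimage_bigcup.
apply: measure_semi_sigma_additive.
- by move=> n; exact: mpre.
- apply/trivIsetP => i j _ _ ij; rewrite -preimage_setI.
  by move/trivIsetP : tF => /(_ _ _ _ _ ij) ->//; rewrite preimage_set0.
- by rewrite -preimage_bigcup; exact: mpre.
Qed.

HB.instance Definition _ := isMeasure.Build _ _ _ measure_push0
  push0 push_ge0 push_sigma_additive.

Definition measure_push : {measure set T2 -> \bar R} := measure_push0.

End measure_push.

Section finite_push.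
Context d1 d2 (T1 : measurableType d1) (T2 : measurableType d2) (R : realType).
Variables (f : T1 -> T2) (mf : measurable_fun [set: T1] f).
Variable m : {finite_measure set T1 -> \bar R}.

Definition finite_push0 : set T2 -> \bar R := measure_push mf m.

HB.instance Definition _ := Measure.on finite_push0.

Let push_fin : fin_num_fun finite_push0.
Proof.
move=> A mA; apply: fin_num_measure.
by rewrite -[X in measurable X]setTI; exact: mf.
Qed.

HB.instance Definition _ := Measure_isFinite.Build _ _ _ finite_push0
  push_fin.

Definition finite_push : {finite_measure set T2 -> \bar R} := finite_push0.

End finite_push.

Section law.
Context d1 d2 (T1 : measurableType d1) (T2 : measurableType d2) (R : realType).
Variables (f : T1 -> T2) (mf : measurable_fun [set: T1] f).
Variable P : probability T1 R.

Definition law0 : set T2 -> \bar R := finite_push mf P.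

HB.instance Definition _ := Measure.on law0.

Let law0_setT : law0 setT = 1%E.
Proof.
by rewrite /law0 /= /finite_push0 /= /measure_push0 /pushforward preimage_setT probability_setT.
Qed.

HB.instance Definition _ := Measure_isProbability.Build _ _ _ law0 law0_setT.

Definition law : probability T2 R := law0.

End law.

Section randomizes.
Context dX dY dU (X : measurableType dX) (Y : measurableType dY)
  (U : measurableType dU) (R : realType).

Definition randomizes (mu : set (X * Y)%type -> \bar R) (m : set X -> \bar R)
    (P : probability U R) (G : X * U -> Y) : Prop :=
  measurable_fun setT G /\
  forall C, measurable C ->
    mu C = (\int[m]_x P [set u | C (x, G (x, u))])%E.

Lemma randomizes_integral (mu : {measure set (X * Y)%type -> \bar R})
    (m : {sigma_finite_measure set X -> \bar R}) (P : probability U R)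
    (G : X * U -> Y) (f : X * Y -> \bar R) :
  randomizes mu m P G -> measurable_fun setT f -> (forall p, 0 <= f p)%E ->
  (\int[mu]_p f p = \int[m]_x \int[P]_u f (x, G (x, u)))%E.
Proof.
move=> [mG muE] mf f0.
pose h (p : X * U) := (p.1, G p).
have mh : measurable_fun setT h by exact: measurable_fun_pair.
rewrite (@eq_measure_integral _ _ _ _ (measure_push mh (m \x P)%E)); last first.
  move=> C mC _; rewrite muE// /= /measure_push0 /pushforward; apply: eq_integral => x _ /=.
  by congr (P _); apply/seteqP; split => u; rewrite /xsection/= inE.
rewrite (ge0_integral_pushforward mh)//.
rewrite preimage_setT fubini_tonelli1; [by []|exact: measurableT_comp|].
by move=> p; exact: f0.
Qed.

End randomizes.

(* Disintegration in functional form: a kernel from [X] to [Y] is given as the law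
   of [G (x, u)] for a random [u] independent of [x]. *)
Definition randomizable dY (Y : measurableType dY) (R : realType) : Prop :=
  forall dX (X : measurableType dX) (mu : {finite_measure set (X * Y)%type -> \bar R}),
  exists dU (U : measurableType dU) (P : probability U R) (G : X * U -> Y),
  randomizes mu (finite_push measurable_fst mu) P G.

(** Randomize the image of [mu] under [i] and compose with [k]; the values of the kernel outside the
    range of [i] do no harm, since [k] sends them back to [Y']. *)
Lemma randomizable_retract dY dY' (Y : measurableType dY) (Y' : measurableType dY')
    (R : realType) (i : Y' -> Y) (k : Y -> Y') :
  measurable_fun setT i -> measurable_fun setT k -> cancel i k ->
  randomizable Y R -> randomizable Y' R.
Proof.
move=> mi mk iK rY dX X mu.
pose h (p : X * Y') := (p.1, i p.2).
have mh : measurable_fun setT h.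
  by apply: measurable_fun_pair => //; exact: measurableT_comp.
have [dU [U [P [G [mG muE]]]]] := rY dX X (finite_push mh mu).
exists dU, U, P, (k \o G); split; first exact: measurableT_comp.
move=> C mC.
pose h' (p : X * Y) := (p.1, k p.2).
have mh' : measurable_fun setT h'.
  by apply: measurable_fun_pair => //; exact: measurableT_comp.
have mC' : measurable (h' @^-1` C).
  by rewrite -[X in measurable X]setTI; exact: mh'.
have := muE _ mC'; rewrite [LHS](_ : _ = mu C) //.
by congr (mu _); apply/seteqP; split => -[x y]; rewrite /preimage /h /h' /= iK.
Qed.

(** Chain rule: draw the first component given [x] with one noise, then the second given [x] and the
    first with another, independent noise. *)
Lemma randomizable_prod d1 d2 (Y1 : measurableType d1) (Y2 : measurableType d2)
    (R : realType) :
  randomizable Y1 R -> randomizable Y2 R -> randomizable (Y1 * Y2)%type R.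
Proof.
move=> r1 r2 dX X mu.
pose a (p : X * (Y1 * Y2)) := (p.1, p.2.1).
pose b (p : X * (Y1 * Y2)) := (p.1, p.2.1, p.2.2).
have ma : measurable_fun setT a.
  by apply: measurable_fun_pair => //; exact: measurableT_comp.
have mb : measurable_fun setT b.
  by apply: measurable_fun_pair => //; exact: measurableT_comp.
have [dU1 [U1 [P1 [G1 h1]]]] := r1 dX X (finite_push ma mu).
have [dU2 [U2 [P2 [G2 h2]]]] := r2 _ _ (finite_push mb mu).
pose G (p : X * (U1 * U2)) :=
  (G1 (p.1, p.2.1), G2 (p.1, G1 (p.1, p.2.1), p.2.2)).
have m1 : measurable_fun setT (fun p : X * (U1 * U2) => G1 (p.1, p.2.1)).
  apply: (measurableT_comp h1.1); apply: measurable_fun_pair => //.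
  exact: measurableT_comp.
have mG : measurable_fun setT G.
  apply: measurable_fun_pair => //; apply: (measurableT_comp h2.1).
  apply: measurable_fun_pair; last exact: measurableT_comp.
  exact: measurable_fun_pair.
exists _, _, (P1 \x P2)%E, G; split => // C mC.
pose c (p : X * Y1 * Y2) := (p.1.1, (p.1.2, p.2)).
have mc : measurable_fun setT c.
  apply: measurable_fun_pair; first exact: measurableT_comp.
  by apply: measurable_fun_pair => //; exact: measurableT_comp.
have mC' : measurable (c @^-1` C).
  by rewrite -[X in measurable X]setTI; exact: mc.
have := h2.2 _ mC'; rewrite [LHS](_ : _ = mu C); last first.
  by congr (mu _); apply/seteqP; split => -[x [y1 y2]].
move=> ->.
pose F (p : X * Y1) := P2 [set u | (c @^-1` C) (p, G2 (p, u))].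
have mD : measurable [set p : X * Y1 * U2 | (c @^-1` C) (p.1, G2 p)].
  rewrite -[X in measurable X]setTI.
  apply: (measurable_fun_pair _ h2.1) => //.
have mF : measurable_fun setT F.
  have := measurable_fun_xsection P2 mD.
  by congr (measurable_fun _ _); apply/funext => p; congr (P2 _);
    apply/seteqP; split => u; rewrite /xsection/= inE.
transitivity (\int[finite_push ma mu]_p F p)%E; first exact: eq_measure_integral.
rewrite (randomizes_integral h1 mF)//; apply: eq_integral => x _.
apply: eq_integral => u _.
by rewrite /F; congr (P2 _); apply/seteqP; split => v; rewrite /xsection/= inE.
Qed.

(** On the set where [g < f] both integrals agree over every measurable subset, so [f = g] almost
    everywhere there, and the set is null. *)
Lemma le_integral_ae d (T : measurableType d) (R : realType)
    (m : {measure set T -> \bar R}) (f g : T -> \bar R) :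
  m.-integrable setT f -> m.-integrable setT g ->
  (forall A, measurable A -> (\int[m]_(x in A) f x <= \int[m]_(x in A) g x)%E) ->
  {ae m, forall x, (f x <= g x)%E}.
Proof.
move=> intf intg fg.
have mf : measurable_fun setT f by exact: measurable_int intf.
have mg : measurable_fun setT g by exact: measurable_int intg.
pose A := [set x | (g x < f x)%E].
have mA : measurable A.
  by rewrite -[A]setTI; exact: emeasurable_fun_lt.
have fgA : ae_eq m A f g.
  apply: integral_ae_eq => //.
  - exact: integrableS intf.
  - exact: measurable_funS mg.
  move=> B BA mB; apply/eqP; rewrite eq_le fg//=; apply: le_integral => //.
  - exact: integrableS intg.
  - exact: integrableS intf.
  - by move=> x; rewrite inE => /BA/ltW.
apply: filterS fgA => x h; rewrite leNgt; apply/negP => gfx; have := h gfx.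
by move: gfx => /[swap] ->; rewrite ltxx.
Qed.

(** The whole space is adjoined to [C] so that the generators include the sets [A x T2], which [C]
    alone (for instance open rays) need not provide. *)
Lemma measurable_prod_generated d1 d2 (T1 : measurableType d1)
    (T2 : measurableType d2) (C : set (set T2)) :
  @measurable d2 T2 = <<s C >> ->
  @measurable _ (T1 * T2)%type =
    <<s [set A `*` B | A in @measurable d1 T1 & B in C `|` [set setT]] >>.
Proof.
move=> CE; apply/seteqP; split.
  rewrite measurable_prod_measurableType.
  apply: smallest_sub; first exact: smallest_sigma_algebra.
  set S := <<s _ >>.
  have hS : sigma_algebra setT S by exact: smallest_sigma_algebra.
  have [S0 SC SU] := hS.
  have ST B : measurable B -> S (setT `*` B).
    rewrite CE => CB; suff : <<s C >> `<=` [set B | S (setT `*` B)] by exact.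
    apply: smallest_sub => [|D CD].
      split => /=; first by rewrite setX0.
        move=> D SD; have := SC _ SD; congr S.
        by apply/seteqP; split => -[x y]/=; tauto.
      move=> F SF; have := SU _ SF; congr S.
      apply/seteqP; split => -[x y]/=.
        by move=> [n _ []]//= _ Fy; split => //; exists n.
      by move=> [_ [n _ Fy]]; exists n.
    by apply: sub_sigma_algebra; exists setT => //; exists D => //; left.
  move=> _ [A mA [B mB <-]].
  have -> : A `*` B = (A `*` setT) `&` (setT `*` B).
    by apply/seteqP; split => -[x y]/=; tauto.
  have SI := @measurableI _ (g_sigma_algebraType
    [set A `*` B | A in @measurable d1 T1 & B in C `|` [set setT]]).
  apply: SI; last exact: ST.
  by apply: sub_sigma_algebra; exists A => //; exists setT => //; right.
apply: smallest_sub; first exact: sigma_algebra_measurable.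
move=> _ [A mA [B [CB|->] <-]]; last exact: measurableX.
by apply: measurableX => //; rewrite CE; exact: sub_sigma_algebra.
Qed.

(** * Conditional quantiles *)

Section unit_interval.
Variable R : realType.

Let m01 : measurable (`[0, 1[%classic : set (measurableTypeR R)).
Proof. exact: measurable_itv. Qed.

Definition unif0 : set (measurableTypeR R) -> \bar R :=
  mrestr (@lebesgue_measure R) m01.

HB.instance Definition _ := Measure.on unif0.

Let unif0T : unif0 setT = 1%E.
Proof. by rewrite /unif0 /mrestr setTI lebesgue_measure_itv/= lte_fin ltr01 sube0. Qed.

HB.instance Definition _ := Measure_isProbability.Build _ _ _ unif0 unif0T.

Definition unif : probability (measurableTypeR R) R := unif0.

Lemma unif_lt (c : \bar R) : (0 <= c)%E ->
  unif [set u | u%:E < c]%E = mine c 1%E.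
Proof.
move=> c0; rewrite /= /unif0 /mrestr.
have [c1|c1] := leP c 1%E.
  have cE : c = (fine c)%:E.
    by rewrite fineK// ge0_fin_numE// (le_lt_trans c1)// ltry.
  rewrite (_ : _ `&` _ = `[0, (fine c)[%classic).
    by rewrite lebesgue_measure_itv/= lte_fin; case: ltP => [_|]; rewrite ?sube0 -?cE// -lee_fin -cE => c0'; apply/eqP; rewrite eq_le c0 c0'.
  apply/seteqP; split => u /=; rewrite !in_itv/= cE lte_fin.
    by move=> [-> /andP[->]].
  move=> /andP[u0 uc]; split => //; rewrite u0 (lt_le_trans uc)//.
  by rewrite -lee_fin -cE.
rewrite (_ : _ `&` _ = `[0, 1[%classic).
  by rewrite lebesgue_measure_itv/= lte_fin ltr01 sube0.
apply/seteqP; split => u /=; rewrite !in_itv/=; first by case.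
move=> /andP[u0 u1]; rewrite u0 u1; split => //.
by rewrite (lt_trans _ c1)// lte_fin.
Qed.

End unit_interval.

(** [f] is the conditional probability of [B] given [x]: the density, by Radon-Nikodym, of
    [A |-> mu (A x B)] with respect to the marginal. *)
Lemma slice_density dX dY (X : measurableType dX) (Y : measurableType dY)
    (R : realType) (mu : {finite_measure set (X * Y)%type -> \bar R})
    (B : set Y) : measurable B ->
  exists f : X -> \bar R, [/\ (forall x, 0 <= f x)%E,
    (finite_push measurable_fst mu).-integrable setT f &
    forall A, measurable A ->
      (\int[finite_push measurable_fst mu]_(x in A) f x = mu (A `*` B))%E].
Proof.
move=> mB; set m := finite_push measurable_fst mu.
pose D := [set: X] `*` B.
have mD : measurable D by exact: measurableX.
have muD : (mu D < +oo)%E by rewrite ltey_eq fin_num_measure.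
pose nu : {finite_measure set X -> \bar R} :=
  finite_push measurable_fst (mfrestr mD muD).
have nuE A : nu A = mu (A `*` B).
  rewrite /= /finite_push0 /= /measure_push0 /pushforward /mfrestr /mrestr.
  by congr (mu _); apply/seteqP; split => -[x y]/=; rewrite /D /=; tauto.
have num : nu `<< m.
  move=> N hN A mA AN; rewrite nuE; apply/eqP.
  have mA0 : m A = 0%E by exact: hN.
  rewrite eq_le measure_ge0 andbT -mA0; apply: le_measure; rewrite ?inE.
  - exact: measurableX.
  - by rewrite -[X in measurable X]setTI; exact: measurable_fst.
  - by move=> -[x y] [].
exists (Radon_Nikodym_SigmaFinite.f nu m); split.
- exact: Radon_Nikodym_SigmaFinite.f_ge0.
- exact: Radon_Nikodym_SigmaFinite.f_integrable.
- by move=> A mA; rewrite -nuE (Radon_Nikodym_SigmaFinite.f_integral num).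
Qed.

(** Inverse transform sampling. Here [f r x] is a version of the probability of [y > r] given [x],
    and [G (x, u)] is the supremum of the rationals [q] with [u < f q x], for [u] uniform. Over the
    extended reals this supremum always exists, so [G] is defined even at the points where [f] fails
    to be monotone in [r]. *)
Lemma randomizable_ereal (R : realType) : randomizable (\bar R) R.
Proof.
move=> dX X mu; set m := finite_push measurable_fst mu.
pose ray (r : R) : set (\bar R) := `]r%:E, +oo[%classic.
have mray r : measurable (ray r) by exact: emeasurable_itv.
have rayP r y : ray r y <-> (r%:E < y)%E by rewrite /ray/= in_itv/= andbT.
have /choice[f hf] r := slice_density mu (mray r).
have f0 r x : (0 <= f r x)%E by have [] := hf r.
have intf r : m.-integrable setT (f r) by have [] := hf r.
have fE r A : measurable A -> (\int[m]_(x in A) f r x = mu (A `*` ray r))%E.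
  by have [_ _] := hf r; exact.
have mf r : measurable_fun setT (f r) by exact: measurable_int (intf r).
have mAE A : m A = mu (A `*` setT).
  rewrite /m /= /finite_push0 /= /measure_push0 /pushforward.
  by congr (mu _); apply/seteqP; split => -[x y]/= => [|[]].
have rayS (r s : R) : r <= s -> ray s `<=` ray r.
  by move=> rs y; rewrite !rayP; apply: le_lt_trans; rewrite lee_fin.
have f_le (r s : R) : r <= s -> {ae m, forall x, (f s x <= f r x)%E}.
  move=> rs; apply: le_integral_ae => // A mA; rewrite !fE//.
  apply: le_measure; rewrite ?inE; [exact: measurableX..|].
  by move=> -[x y] [Ax /= sy]; split => //=; exact: rayS sy.
have f_le1 (r : R) : {ae m, forall x, (f r x <= 1)%E}.
  apply: le_integral_ae => //.
    by apply: finite_measure_integrable_cst.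
  move=> A mA; have -> : (\int[m]_(_ in A) 1 = m A)%E by rewrite integral_cst// mul1e.
  rewrite fE// mAE.
  apply: le_measure; rewrite ?inE; [exact: measurableX..|].
  by move=> -[x y] [Ax /= sy]; split.
pose q_ (q : rat) : R := ratr q.
pose G (p : X * measurableTypeR R) : \bar R :=
  ereal_sup [set (q_ q)%:E | q in [set q | (p.2%:E < f (q_ q) p.1)%E]].
have Gray a p : ray a (G p) <->
    (exists2 q, a < q_ q & (p.2%:E < f (q_ q) p.1)%E).
  rewrite rayP; split => [/ereal_sup_gt[_ [q qp <-]]|[q aq qp]].
    by rewrite lte_fin => aq; exists q.
  apply: (@lt_le_trans _ _ (q_ q)%:E); first by rewrite lte_fin.
  by apply: ereal_sup_ubound; exists q.
have mG : measurable_fun setT G.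
  apply: (measurability _ (ErealGenOInfty.measurableE R)).
  move=> _ [_ [a ->] <-]; rewrite setTI.
  rewrite (_ : _ @^-1` _ = \bigcup_(q in [set q | a < q_ q])
      [set p : X * measurableTypeR R | (p.2%:E < f (q_ q) p.1)%E]); last first.
    apply/seteqP; split => p.
      by move=> /Gray[q aq qp]; exists q.
    by move=> [q aq qp]; apply/Gray; exists q.
  rewrite bigcup_mkcond; apply: countable_bigcupT_measurable.
    exact: countableP.
  move=> q; case: ifPn => // _; rewrite -[X in measurable X]setTI.
  apply: emeasurable_fun_lt => //.
    by apply/measurable_EFinP; exact: measurable_snd.
  exact: measurableT_comp (mf _) measurable_fst.
exists _, (measurableTypeR R), (unif R), G; split => //.
pose h (p : X * measurableTypeR R) := (p.1, G p).
have mh : measurable_fun setT h by exact: measurable_fun_pair.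
pose mu' := measure_push mh (m \x unif R)%E.
have mu'E C : mu' C = (\int[m]_x unif R [set u | C (x, G (x, u))])%E.
  apply: eq_integral => x _ /=.
  by congr (unif0 _); apply/seteqP; split => u; rewrite /xsection/= inE.
suff H C : measurable C -> mu C = mu' C by move=> C mC; rewrite -mu'E H.
have mu'T A : measurable A -> mu (A `*` setT) = mu' (A `*` setT).
  move=> mA; rewrite -mAE mu'E -[LHS]mul1e -integral_cst// integral_mkcond.
  apply: eq_integral => x _; rewrite /patch; case: ifPn => xA.
    rewrite (_ : [set _ | _] = setT) ?probability_setT//.
    by apply/seteqP; split => // u _; split => //; exact/set_mem.
  rewrite (_ : [set _ | _] = set0) ?measure0//.
  by apply/seteqP; split => // u [/mem_set]; rewrite (negbTE xA).
have mu'ray A a : measurable A -> mu (A `*` ray a) = mu' (A `*` ray a).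
  move=> mA.
  pose s x := ereal_sup [set f (q_ q) x | q in [set q | a < q_ q]].
  (* The probability that [G (x, u) > a]. As versions of conditional probabilities are at most 1
     only almost everywhere, a truncation is needed. *)
  pose w x := mine (s x) 1%E.
  have s_ge q x : a < q_ q -> (f (q_ q) x <= s x)%E.
    by move=> aq; apply: ereal_sup_ubound; exists q.
  have s0 x : (0 <= s x)%E.
    have [|q] := @rat_in_itvoo R a (a + 1); first by rewrite ltrDl.
    by rewrite in_itv/= => /andP[aq _]; exact: le_trans (f0 _ _) (s_ge q x aq).
  have w0 x : (0 <= w x)%E by rewrite /w le_min s0 lee01.
  have ms : measurable_fun setT s.
    apply: (measurability _ (ErealGenOInfty.measurableE R)).
    move=> _ [_ [b ->] <-]; rewrite setTI.
    rewrite (_ : _ @^-1` _ = \bigcup_(q in [set q | a < q_ q])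
        [set x | (b%:E < f (q_ q) x)%E]); last first.
      apply/seteqP; split => x /=; rewrite in_itv/= andbT.
        by move=> /ereal_sup_gt[_ [q aq <-]] bq; exists q.
      by move=> [q aq /=] bq; rewrite (lt_le_trans bq)// s_ge.
    rewrite bigcup_mkcond; apply: countable_bigcupT_measurable.
      exact: countableP.
    move=> q; case: ifPn => // _; rewrite -[X in measurable X]setTI.
    exact: emeasurable_fun_lt.
  have mw : measurable_fun setT w by exact: measurable_mine.
  have -> : mu' (A `*` ray a) = (\int[m]_(x in A) w x)%E.
    rewrite mu'E [RHS]integral_mkcond; apply: eq_integral => x _.
    rewrite /patch; case: ifPn => xA.
      rewrite /w -unif_lt//; congr (unif0 _); apply/seteqP; split => u.
        move=> [_ /Gray[q aq uq]]; exact: lt_le_trans uq (s_ge _ _ aq).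
      move=> /ereal_sup_gt[_ [q aq <-] uq]; split; first exact/set_mem.
      by apply/Gray; exists q.
    rewrite (_ : [set _ | _] = set0) ?measure0//.
    by apply/seteqP; split => // u [/mem_set]; rewrite (negbTE xA).
  have mwA := measurable_funS measurableT (@subsetT _ A) mw.
  have mfA r := measurable_funS measurableT (@subsetT _ A) (mf r).
  apply/eqP; rewrite eq_le; apply/andP; split; last first.
    rewrite -fE//; apply: ae_ge0_le_integral => //.
    (* Only the countably many inequalities between [a] and the rationals above it matter, so they
       hold simultaneously off one null set. *)
    have : {ae m, forall x, forall n, if unpickle n is Some q then
        (a < q_ q -> (f (q_ q) x <= f a x)%E) else True}.
      apply: ae_foralln => n; case: (unpickle n) => [q|]; last exact: aeW.
      have [aq|aq] := ltP a (q_ q); last exact: aeW.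
      by apply: filterS (f_le _ _ (ltW aq)) => x hx _.
    apply: filterS => x hx _; rewrite /w ge_min; apply/orP; left.
    apply: ge_ereal_sup => _ [q aq <-].
    by have := hx (pickle q); rewrite pickleK; exact.
  (* Conversely, the ray above [a] is the increasing union of those above [r n], and a rational
     between [a] and [r n] gives a tail bounded by [w]. *)
  pose r n : R := a + n.+1%:R^-1.
  have -> : A `*` ray a = \bigcup_n (A `*` ray (r n)).
    apply/seteqP; split => -[x y] /=; last first.
      move=> [n _ [Ax /rayP ry]]; split => //; apply/rayP.
      by apply: lt_trans ry; rewrite lte_fin ltrDl invr_gt0.
    move=> [Ax /rayP ay].
    have [n rn] : exists n, ((r n)%:E < y)%E.
      case: y ay => [y| |]//; last by exists 0%N; rewrite ltry.
      rewrite lte_fin -subr_gt0 => ay; exists (Num.truncn (y - a)^-1).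
      rewrite lte_fin /r -ltrBrDl invf_plt ?posrE//.
      exact: truncnS_gt.
    by exists n => //; split => //; exact/rayP.
  have cv := @nondecreasing_cvg_mu _ _ _ mu (fun n => A `*` ray (r n)).
  rewrite -(cvg_lim _ (cv _ _ _))//; last 3 first.
  - by move=> n; exact: measurableX.
  - by apply: bigcupT_measurable => n; exact: measurableX.
  - move=> n k nk; apply/subsetPset => -[x y] [Ax /= ry]; split => //=.
    apply: rayS ry; rewrite lerD2l lef_pV2 ?posrE// ler_nat.
    exact: nk.
  apply: lime_le.
    apply: (cvgP _ (cv _ _ _)).
    - by move=> n; exact: measurableX.
    - by apply: bigcupT_measurable => n; exact: measurableX.
    - move=> n k nk; apply/subsetPset => -[x y] [Ax /= ry]; split => //=.
      by apply: rayS ry; rewrite lerD2l lef_pV2 ?posrE// ler_nat.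
  apply: nearW => n /=.
  have [|q] := @rat_in_itvoo R a (r n); first by rewrite ltrDl invr_gt0.
  rewrite in_itv/= => /andP[aq qr].
  apply: (@le_trans _ _ (\int[m]_(x in A) f (q_ q) x)%E).
    rewrite fE//; apply: le_measure; rewrite ?inE; [exact: measurableX..|].
    by move=> -[x y] [Ax /= ry]; split => //=; apply: rayS ry; exact: ltW.
  apply: ae_ge0_le_integral => //.
  by apply: filterS (f_le1 (q_ q)) => x hx _; rewrite /w le_min s_ge.
pose GG : set (set (X * \bar R)%type) :=
  [set A `*` B | A in @measurable _ X & B in @ErealGenOInfty.G R `|` [set setT]].
apply: (@measure_unique _ R (X * \bar R)%type GG (fun=> setT) _ _ _ _ mu mu').
- exact: measurable_prod_generated (ErealGenOInfty.measurableE R).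
- move=> _ _ [A1 mA1 [B1 hB1 <-]] [A2 mA2 [B2 hB2 <-]].
  exists (A1 `&` A2); first exact: measurableI.
  exists (B1 `&` B2); last by rewrite setXI.
  case: hB1 => [[a1 ->]|->]; last by rewrite setTI.
  case: hB2 => [[a2 ->]|->]; last by rewrite setIT; left; exists a1.
  left; exists (Num.max a1 a2); apply/seteqP; split => y /=;
    by rewrite !in_itv/= !andbT EFin_max gt_max => /andP.
- by move=> _; exists setT => //; exists setT; [right|rewrite setXTT].
- by apply/seteqP; split => // x _; exists 0%N.
- move=> _ [A mA [B [[a ->]|->] <-]]; last exact: mu'T.
  exact: mu'ray.
- by move=> _; rewrite ltey_eq fin_num_measure.
Qed.

Lemma randomizable_real (R : realType) : randomizable (measurableTypeR R) R.
Proof.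
apply: (@randomizable_retract _ _ (\bar R) (measurableTypeR R) R EFin fine).
- exact/measurable_EFinP.
- exact: fine_measurable.
- by [].
- exact: randomizable_ereal.
Qed.

Lemma measurable_fun_rV (R : realType) n d (T : measurableType d)
    (f : T -> 'rV[R]_n) :
  (forall i, measurable_fun setT (fun t => f t ord0 i : measurableTypeR R)) ->
  measurable_fun setT (f : T -> borel 'rV[R]_n).
Proof.
move=> mf.
apply: (@measurability _ _ _ (borel 'rV[R]_n) setT f (@open _)) => //.
move=> _ [U oU <-]; rewrite setTI (open_rV_bigcup oU) preimage_bigcup.
rewrite bigcup_mkcond; apply: countable_bigcupT_measurable.
  exact: countableP.
move=> p; case: ifPn => // _.
rewrite (_ : _ @^-1` _ = \bigcap_(i in [set: 'I_n]) ((fun t => f t ord0 i) @^-1`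
    ball (ratr (p.1 ord0 i) : R) p.2.+1%:R^-1)).
  apply: fin_bigcap_measurable => // i _.
  rewrite -[X in measurable X]setTI; apply: mf => //.
  exact: measurable_ball.
apply/seteqP; split => t /=.
  by move=> [_ h] i _ /=; have := h ord0 i; rewrite !mxE.
move=> h; split; first by rewrite invr_gt0.
by move=> i j; rewrite !mxE ord1; exact: h.
Qed.

Lemma randomizable_rV (R : realType) n : randomizable (borel 'rV[R]_n) R.
Proof.
elim: n => [|n ih].
  apply: (@randomizable_retract _ _ (\bar R) (borel 'rV[R]_0) R
    (fun=> 0%E) (fun=> (0 : 'rV[R]_0))).
  - exact: measurable_cst.
  - exact: measurable_cst.
  - by move=> v; rewrite [v]thinmx0.
  - exact: randomizable_ereal.
pose i (v : borel 'rV[R]_n.+1) : measurableTypeR R * borel 'rV[R]_n :=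
  ((v : 'rV_n.+1) ord0 ord0, \row_j (v : 'rV_n.+1) ord0 (lift ord0 j)).
pose k (p : measurableTypeR R * borel 'rV[R]_n) : borel 'rV[R]_n.+1 :=
  \row_j (if unlift ord0 j is Some j' then (p.2 : 'rV_n) ord0 j' else p.1).
apply: (@randomizable_retract _ _ _ _ R i k).
- apply: measurable_fun_pair; first exact: measurable_coord.
  apply: measurable_fun_rV => j; under eq_fun do rewrite mxE.
  exact: measurable_coord.
- apply: measurable_fun_rV => j; under eq_fun do rewrite mxE.
  case: (unlift ord0 j) => [j'|]; last exact: measurable_fst.
  exact: measurableT_comp (@measurable_coord R n j') measurable_snd.
- move=> v; apply/rowP => j; rewrite mxE.
  by case: unliftP => [j' ->|->]; rewrite ?mxE.
- by apply: randomizable_prod => //; exact: randomizable_real.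
Qed.

(** * Topology of Euclidean spaces and of the torus *)

Lemma continuous_rV (T : topologicalType) (R : realType) n (f : T -> 'rV[R]_n) :
  (forall i, continuous (fun x => f x ord0 i)) -> continuous f.
Proof.
move=> cf x; apply/cvg_ballP => e e0.
have : \forall y \near x, forall i, ball (f x ord0 i) e (f y ord0 i).
  by apply: filter_forall => i; have /cvg_ballP := cf i x; exact.
apply: filterS => y h; split => // i j; rewrite ord1; exact: h.
Qed.

Lemma continuous_sum_scale (T : topologicalType) (R : realType)
    (E : normedModType R) (I : Type) (r : seq I) (c : I -> T -> R) (u : I -> E) :
  (forall i, continuous (c i)) -> continuous (fun x => \sum_(i <- r) c i x *: u i).
Proof.
move=> cc; elim: r => [|i r ih].
  under eq_fun do rewrite big_nil; exact: cst_continuous.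
under eq_fun do rewrite big_cons.
move=> x; apply: cvgD; last exact: ih.
by apply: cvgZr_tmp; exact: cc.
Qed.

Lemma continuous_translate (R : realType) (E : normedModType R) (k : E) :
  continuous (fun y => y - k).
Proof. by move=> y; apply: cvgB => //; exact: cvg_cst. Qed.

Section euclidean_coordinates.
Context (R : realType) (E : normedModType R).

Let expands (dot : E -> E -> R) (s : seq E) (z : E) : Prop :=
  z = \sum_(o <- s) dot z o *: o.

(** Gram-Schmidt on a spanning family, dropping the vectors whose remainder is zero. The invariant
    is that the list expands each of its own elements, which replaces orthonormality. Polarization
    expresses [dot] through the norm, hence its continuity. *)
Lemma euclidean_coordinates : euclidean E ->
  exists n (J : E -> 'rV[R]_n) (J' : 'rV[R]_n -> E) (C : R),
    [/\ continuous J, continuous J', cancel J J' &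
        forall z, `|z| <= 1 -> forall i, `|J z ord0 i| <= C].
Proof.
move=> [[dot [dotC dotL dotE]] [n [e he]]].
have dot0 z : dot 0 z = 0.
  by have := dotL 1 0 0 z; rewrite scaler0 addr0 mul1r => /eqP; rewrite -subr_eq0 opprD addNKr oppr_eq0 => /eqP.
have dotD x y z : dot (x + y) z = dot x z + dot y z.
  by rewrite -[x in LHS]scale1r dotL mul1r.
have dotZ a x z : dot (a *: x) z = a * dot x z.
  by rewrite -[a *: x]addr0 dotL dot0 addr0.
have dot_sum (s : seq E) (c : E -> R) z :
    dot (\sum_(o <- s) c o *: o) z = \sum_(o <- s) c o * dot o z.
  elim: s => [|o s ih]; first by rewrite !big_nil dot0.
  by rewrite !big_cons dotL ih.
have expL s a x y : expands dot s x -> expands dot s y -> expands dot s (a *: x + y).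
  move=> hx hy; rewrite /expands {1}hx {1}hy scaler_sumr -big_split/=.
  by apply: eq_bigr => o _; rewrite dotL scalerDl scalerA.
have exp0 s : expands dot s 0.
  by rewrite /expands big1// => o _; rewrite dot0 scale0r.
have [s hs] : exists s : seq E, forall z, expands dot s z.
  suff [s [_ hs]] : exists s : seq E, (forall o, o \in s -> expands dot s o) /\
      forall i, (i < n)%N -> forall hi : (i < n)%N, expands dot s (e (Ordinal hi)).
    exists s => z; have [c ->] := he z.
    elim/big_ind: _ => [|x y hx hy|i _]; first exact: exp0.
      by rewrite -[x]scale1r; exact: expL.
    by rewrite -[_ *: _]addr0; apply: expL => //; case: i => i hi; exact: hs.
  suff H m : (m <= n)%N -> exists s : seq E,
      (forall o, o \in s -> expands dot s o) /\
      forall i, (i < m)%N -> forall hi : (i < n)%N, expands dot s (e (Ordinal hi)).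
    by exact: H.
  elim: m => [_|m ih mn]; first by exists [::].
  have [s [so hs]] := ih (ltnW mn).
  pose v := e (Ordinal mn).
  pose w := v - \sum_(o <- s) dot v o *: o.
  have hsum : expands dot s (\sum_(o <- s) dot v o *: o).
    rewrite big_seq; elim/big_ind: _ => [|x y hx hy|o os]; first exact: exp0.
      by rewrite -[x]scale1r; exact: expL.
    by rewrite -[_ *: _]addr0; apply: expL => //; exact: so.
  have [w0|w0] := eqVneq w 0.
    exists s; split => // i; rewrite ltnS leq_eqVlt => /predU1P[-> hi|].
      rewrite (bool_irrelevance hi mn) -/v.
      by move/eqP: w0; rewrite subr_eq0 => /eqP ->.
    exact: hs.
  (* Expand [o] itself along [s]: the two sums coincide by the symmetry of [dot]. *)
  have wo o : o \in s -> dot w o = 0.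
    move=> os; rewrite /w -[- _]scaleN1r addrC dotL mulN1r dot_sum.
    rewrite [X in _ + X = 0]dotC [X in dot X v](so _ os) dot_sum.
    by rewrite addrC; apply/eqP; rewrite subr_eq0; apply/eqP/eq_bigr => o' _;
      rewrite dotC [dot v _]dotC mulrC (dotC o').
  pose u := `|w|^-1 *: w.
  have nw : `|w| != 0 by rewrite normr_eq0.
  have uo o : o \in s -> dot u o = 0.
    by move=> os; rewrite dotZ wo// mulr0.
  have uu : dot u u = 1.
    by rewrite dotE normrZ normfV normr_id mulVf// expr1n.
  have ext z : expands dot s z -> expands dot (u :: s) z.
    move=> hz; rewrite /expands big_cons -hz.
    suff -> : dot z u = 0 by rewrite scale0r add0r.
    rewrite hz dot_sum big_seq big1// => o os.
    by rewrite [dot o u]dotC uo// mulr0.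
  have expu : expands dot (u :: s) u.
    rewrite /expands big_cons uu scale1r big_seq big1 ?addr0// => o os.
    by rewrite uo// scale0r.
  exists (u :: s); split.
    by move=> o; rewrite inE => /predU1P[->//|/so]; exact: ext.
  move=> i; rewrite ltnS leq_eqVlt => /predU1P[-> hi|im hi]; last exact/ext/hs.
  rewrite (bool_irrelevance hi mn) -/v.
  have -> : v = `|w| *: u + \sum_(o <- s) dot v o *: o.
    by rewrite /u scalerA divff// scale1r /w subrK.
  by apply: expL => //; exact: ext.
pose J z : 'rV[R]_(size s) := \row_i dot z (tnth (in_tuple s) i).
pose J' (v : 'rV[R]_(size s)) : E := \sum_i v ord0 i *: tnth (in_tuple s) i.
have dotP z o : dot z o = (`|z + o| ^+ 2 - `|z| ^+ 2 - `|o| ^+ 2) / 2.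
  rewrite -!dotE dotD [dot z (z + o)]dotC [dot o (z + o)]dotC !dotD [dot o z]dotC.
  by field.
(* A substitute for Cauchy-Schwarz, enough for a bound on the unit ball; the constant [C] below
   dominates each squared norm of a list element by their sum. *)
have dotPN z o : `|dot z o| <= (`|z| ^+ 2 + `|o| ^+ 2) / 2.
  rewrite ler_norml; apply/andP; split.
    by have := dotP z o; have := sqr_ge0 `|z + o|; lra.
  have := dotP z (- o); rewrite dotC -scaleN1r dotZ dotC scaleN1r normrN.
  by have := sqr_ge0 `|z - o|; lra.
exists (size s), J, J', ((1 + \sum_(o <- s) `|o| ^+ 2) / 2); split.
- apply: continuous_rV => i.
  have -> : (fun z => J z ord0 i) = (fun z => (`|z + tnth (in_tuple s) i| ^+ 2
      - `|z| ^+ 2 - `|tnth (in_tuple s) i| ^+ 2) / 2).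
    by apply/funext => z; rewrite mxE dotP.
  move=> z; apply: cvgM; last exact: cvg_cst.
  apply: cvgB; last exact: cvg_cst.
  apply: cvgB.
    apply: cvgM; apply: cvg_norm; apply: cvgD => //; exact: cvg_cst.
  by apply: cvgM; apply: cvg_norm.
- apply: (@continuous_sum_scale _ _ _ _ _ (fun i (v : 'rV[R]_(size s)) => v ord0 i)).
  by move=> i; exact: coord_continuous.
- move=> z; have hz : z = \sum_(o <- s) dot z o *: o by exact: hs.
  by rewrite [RHS]hz [RHS]big_tnth /J'; apply: eq_bigr => i _; rewrite mxE.
- move=> z z1 i; rewrite mxE (le_trans (dotPN _ _))// ler_pM2r ?invr_gt0//.
  rewrite lerD//; first by rewrite expr_le1.
  by rewrite big_tnth (bigD1 i)//= lerDl sumr_ge0.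
Qed.

End euclidean_coordinates.

Lemma euclidean_closed_ball_compact (R : realType) (E : normedModType R) :
  euclidean E -> compact [set z : E | `|z| <= 1].
Proof.
move=> /euclidean_coordinates[n [J [J' [C [cJ cJ' JK JC]]]]].
have cN : continuous (fun v => `|J' v|) 
  by move=> v; apply: (continuous_comp (cJ' v)); exact: norm_continuous.
have -> : [set z : E | `|z| <= 1] =
  J' @` ([set v : 'rV[R]_n | forall i, `[- C, C]%classic (v ord0 i)] `&`
    (fun v => `|J' v|) @^-1` [set r | r <= 1]).
  apply/seteqP; split => z /=; last by move=> [v [_ ?] <-].
  move=> z1; exists (J z); last exact: JK.
  split => /=; last by rewrite JK.
  by move=> i; rewrite /= in_itv/= -ler_norml JC.
apply: continuous_compact; first exact: continuous_subspaceT.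
apply: compact_closedI.
  by apply: (@rV_compact _ _ (fun=> `[- C, C]%classic)) => i; exact: segment_compact.
by apply: preimage_closed => //; exact: closed_le.
Qed.

Section bump.
Context (R : realType) (V : normedModType R) (U : set V).

(** The distance to the complement of [U], truncated at 1; the value 1 also keeps the infimum over a
    non-empty set when [U] is the whole space. *)
Definition bump (x : V) : R :=
  inf [set r | r = 1 \/ exists2 a, ~ U a & r = `|x - a|].

Let has_inf_bump x :
  has_inf [set r | r = 1 \/ exists2 a, ~ U a & r = `|x - a|].
Proof.
split; first by exists 1; left.
by exists 0 => r [->|[a _ ->]].
Qed.

Lemma bump_ge0 x : 0 <= bump x.
Proof.
apply: lb_le_inf; first by exists 1; left.
by move=> r [->|[a _ ->]].
Qed.

Lemma bump_gt0 x : open U -> U x <-> 0 < bump x.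
Proof.
move=> oU; split => [Ux|b0].
  have /nbhs_ballP[e/= e0 eU] : nbhs x U by exact: open_nbhs_nbhs.
  apply: (@lt_le_trans _ _ (Num.min 1 e)); first by rewrite lt_min ltr01.
  apply: lb_le_inf; first by exists 1; left.
  move=> r [->|[a nUa ->]]; first by rewrite ge_min lexx.
  rewrite ge_min; apply/orP; right; rewrite leNgt; apply/negP => xa.
  by apply/nUa/eU; rewrite -ball_normE.
apply: contrapT => nUx; move: b0; rewrite ltNge => /negP; apply.
apply: ge_inf; first exact: (has_inf_bump x).2.
by right; exists x => //; rewrite subrr normr0.
Qed.

Lemma bump_continuous : continuous bump.
Proof.
have lip x y : bump x <= bump y + `|x - y|.
  rewrite -lerBlDr; apply: lb_le_inf; first by exists 1; left.
  move=> r [->|[a nUa ->]]; rewrite lerBlDr.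
    rewrite (@le_trans _ _ 1) ?lerDl//.
    by apply: ge_inf; [exact: (has_inf_bump x).2|left].
  apply: (@le_trans _ _ `|x - a|); last by rewrite [leRHS]addrC ler_distD.
  by apply: ge_inf; [exact: (has_inf_bump x).2|right; exists a].
move=> x; apply/cvgrPdist_lt => e e0.
have /cvgrPdist_lt/(_ e e0) : y @[y --> x] --> x by exact: cvg_id.
apply: filterS => y xy; rewrite (le_lt_trans _ xy)// ler_norml.
have h1 := lip x y; have h2 := lip y x; rewrite distrC in h2.
by apply/andP; split; lra.
Qed.

Lemma bump_translate (k : V) x : (forall a, U (a + k) <-> U a) ->
  bump (x + k) = bump x.
Proof.
move=> Uk; congr inf; apply/seteqP; split => r [->|[a nUa ->]]; try by left.
  right; exists (a - k); last by rewrite opprB addrA.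
  by move=> /Uk; rewrite subrK.
right; exists (a + k); first by move/Uk.
by rewrite opprD addrACA subrr addr0.
Qed.

End bump.

(** Second countability, thanks to which the open subsets of a product belong to the product of the
    Borel sigma-algebras. *)
Definition countably_based (T : topologicalType) : Prop :=
  exists B : nat -> set T, (forall n, open (B n)) /\
    forall (U : set T) x, open U -> U x -> exists n, B n x /\ B n `<=` U.

Lemma countably_based_rV (R : realType) n : countably_based 'rV[R]_n.
Proof.
exists (fun i => if @unpickle ('rV[rat]_n * nat)%type i is Some p
  then ball (map_mx ratr p.1 : 'rV[R]_n) p.2.+1%:R^-1 else set0).
split => [i|U x oU].
  case: (unpickle i) => [p|]; last exact: open0.
  by apply: ball_open; rewrite invr_gt0.
rewrite {1}(open_rV_bigcup oU) => -[p /= pU px].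
by exists (pickle p); rewrite pickleK.
Qed.

Lemma countably_based_retract (T T' : topologicalType) (i : T' -> T) (k : T -> T') :
  continuous i -> continuous k -> cancel i k ->
  countably_based T -> countably_based T'.
Proof.
move=> /continuousP ci /continuousP ck iK [B [oB hB]].
exists (fun n => i @^-1` B n); split => [n|U x oU Ux]; first exact: ci.
have [|n [Bx BU]] := hB (k @^-1` U) (i x) (ck _ oU); first by rewrite /= iK.
by exists n; split => // y /BU /=; rewrite iK.
Qed.

Lemma euclidean_countably_based (R : realType) (E : normedModType R) :
  euclidean E -> countably_based E.
Proof.
move=> /euclidean_coordinates[n [J [J' [C [cJ cJ' JK _]]]]].
exact: countably_based_retract cJ cJ' JK (countably_based_rV R n).
Qed.

Lemma euclidean_randomizable (R : realType) (E : normedModType R) :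
  euclidean E -> randomizable (borel E) R.
Proof.
move=> /euclidean_coordinates[n [J [J' [C [cJ cJ' JK _]]]]].
apply: (@randomizable_retract _ _ (borel 'rV[R]_n) (borel E) R J J').
- exact: continuous_borel.
- exact: continuous_borel.
- exact: JK.
- exact: randomizable_rV.
Qed.

Section torus_topology.
Variables (R : realType) (d : nat).
Local Notation Z := (torus R d).
Local Notation pr := (@torus_proj R d).

Lemma torus_projP (x y : 'rV[R]_d) :
  torus_proj x = torus_proj y <-> forall i, x ord0 i - y ord0 i \is a Num.int.
Proof.
split => [/eqmodP /forallP//|h].
by apply/eqmodP; apply/forallP.
Qed.

Lemma torus_reprK (z : Z) : torus_proj (repr z) = z.
Proof. exact: reprK. Qed.

(** The saturation of [U] is the union of its integer translates. *)
Lemma torus_proj_open (U : set 'rV[R]_d) : open U -> open (pr @` U).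
Proof.
move=> oU; rewrite /open/= /quotient_open.
have -> : \pi_(torus R d)%qT @^-1` (pr @` U) =
  \bigcup_(k in [set k : 'rV[R]_d | forall i, k ord0 i \is a Num.int])
    ((fun x => x - k) @^-1` U).
  apply/seteqP; split => x /=.
    move=> [y Uy] /torus_projP yx; exists (x - y) => /=.
      by move=> i; rewrite !mxE -rpredN opprB.
    by rewrite opprB addrCA subrr addr0.
  move=> [k /= kint Uxk]; exists (x - k) => //; apply/torus_projP => i.
  by rewrite !mxE addrAC subrr sub0r rpredN.
apply: bigcup_open => k _; apply: open_comp => // x _.
exact: continuous_translate.
Qed.

Lemma countably_based_torus : countably_based Z.
Proof.
have [B [oB hB]] := countably_based_rV R d.
exists (fun n => pr @` B n); split => [n|U x oU Ux].
  exact: torus_proj_open.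
have oV : open (pr @^-1` U) by [].
have [|n [Bx BU]] := hB _ (repr x) oV; first by rewrite /= torus_reprK.
exists n; split; first by exists (repr x) => //; exact: torus_reprK.
by move=> _ [y /BU ? <-].
Qed.

(** [repr] is an arbitrary choice of representative, of unknown measurability; fractional parts do
    not depend on it and select the representative in the unit cube. *)
Definition torus_section (z : Z) : 'rV[R]_d :=
  \row_i (repr z ord0 i - (Num.floor (repr z ord0 i))%:~R).

Lemma torus_sectionK : cancel torus_section (@torus_proj R d).
Proof.
move=> z; rewrite -[RHS]torus_reprK; apply/torus_projP => i.
by rewrite mxE addrAC subrr sub0r rpredN intr_int.
Qed.

Lemma torus_section_itv z i : 0 <= torus_section z ord0 i < 1.
Proof.
rewrite mxE subr_ge0 Num.Theory.floor_le_tmp ltrBlDl.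
by have := Num.Theory.floorD1_gt (repr z ord0 i); rewrite intrD.
Qed.

Lemma torus_compact : compact [set: Z].
Proof.
have -> : [set: Z] = pr @`
    [set v : 'rV[R]_d | forall i, `[0, 1]%classic (v ord0 i)].
  apply/seteqP; split => // z _; exists (torus_section z); last exact: torus_sectionK.
  by move=> i; rewrite /= in_itv/=; have /andP[-> /ltW] := torus_section_itv z i.
apply: continuous_compact; first by apply: continuous_subspaceT; exact: pi_continuous.
by apply: (@rV_compact R _ (fun=> `[0, 1]%classic)) => i; exact: segment_compact.
Qed.

(** The preimage of [U] is periodic, so its bump function is periodic too and descends to the
    quotient. *)
Lemma torus_bump (U : set Z) : open U -> exists h : Z -> R,
  [/\ continuous h, forall z, 0 <= h z & forall z, U z <-> 0 < h z].
Proof.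
move=> oU; pose V := pr @^-1` U.
have oV : open V by [].
have inv (k : 'rV[R]_d) : (forall i, k ord0 i \is a Num.int) -> forall a, V (a + k) <-> V a.
  move=> kint a; rewrite /V/=; suff -> : torus_proj (a + k) = torus_proj a by [].
  by apply/torus_projP => i; rewrite !mxE addrAC subrr add0r.
exists (bump V \o repr); split.
- apply: repr_comp_continuous; first exact: bump_continuous.
  move=> a b /eqP/torus_projP ab; apply/eqP.
  rewrite -[a](subrK b) addrC; apply: bump_translate; apply: inv => i.
  by rewrite !mxE.
- by move=> z; exact: bump_ge0.
- by move=> z /=; rewrite -bump_gt0// /V /= torus_reprK.
Qed.

Lemma torus_section_proj (y : 'rV[R]_d) i :
  torus_section (pr y) ord0 i = y ord0 i - (Num.floor (y ord0 i))%:~R.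
Proof.
rewrite mxE; have /torus_projP/(_ i)/intrP[k hk] := torus_reprK (pr y).
have -> : repr (pr y) ord0 i = y ord0 i + k%:~R by rewrite -hk addrCA subrr addr0.
rewrite floorDrz ?intr_int// intrKfloor intrD; ring.
Qed.

(** The fractional part is lower semicontinuous: it is discontinuous at the integers only, where it
    drops to its minimum 0. *)
Lemma open_torus_section_gt i (a : R) : 0 <= a ->
  open [set z : Z | a < torus_section z ord0 i].
Proof.
move=> a0; rewrite /open/= /quotient_open.
have -> : \pi_(torus R d)%qT @^-1` [set z : Z | a < torus_section z ord0 i] =
  \bigcup_(k in [set: int]) ((fun y : 'rV[R]_d => y ord0 i) @^-1`
     `]k%:~R + a, k%:~R + 1[%classic).
  apply/seteqP; split => y.
    rewrite /= -/(pr y) torus_section_proj => ay.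
    exists (Num.floor (y ord0 i)) => //=; rewrite in_itv/=.
    have := Num.Theory.floorD1_gt (y ord0 i); rewrite intrD => ->.
    by rewrite andbT -ltrBrDl.
  move=> [k _ /=]; rewrite in_itv/= => /andP[h1 h2].
  rewrite -/(pr y) torus_section_proj (@floor_def _ _ k) ?ltrBrDl// intrD h2 andbT.
  by rewrite (le_trans _ (ltW h1))// lerDl.
apply: bigcup_open => k _; apply: open_comp; last exact: interval_open.
by move=> y _; exact: coord_continuous.
Qed.

Lemma measurable_torus_section :
  measurable_fun [set: borel Z] (torus_section : borel Z -> borel 'rV[R]_d).
Proof.
apply: measurable_fun_rV => i.
apply: (@measurability _ _ (borel Z) (measurableTypeR R) setT _ _
  (@RGenOInfty.measurableE R)).
move=> _ [_ [a ->] <-]; rewrite setTI.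
have [a0|a0] := leP 0 a.
  apply: borel_open; rewrite (_ : _ @^-1` _ = [set z : Z | a < torus_section z ord0 i]).
    exact: open_torus_section_gt.
  by apply/seteqP; split => z /=; rewrite in_itv/= andbT.
rewrite (_ : _ @^-1` _ = setT)//.
apply/seteqP; split => // z _ /=; rewrite in_itv/= andbT (lt_le_trans a0)//.
by have /andP[] := torus_section_itv z i.
Qed.

Lemma torus_randomizable : randomizable (borel Z) R.
Proof.
apply: (@randomizable_retract _ _ (borel 'rV[R]_d) (borel Z) R torus_section pr).
- exact: measurable_torus_section.
- exact: measurable_torus_proj.
- exact: torus_sectionK.
- exact: randomizable_rV.
Qed.

End torus_topology.

(** * Triple products and Dini's theorem *)

Lemma closure_setX (T1 T2 : topologicalType) (A : set T1) (B : set T2) :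
  closure A `*` closure B `<=` closure (A `*` B).
Proof.
move=> [x y] [/= cA cB] S [[P Q] /= [Px Qy] PQ].
have [a [Aa Pa]] := cA _ Px; have [b [Bb Qb]] := cB _ Qy.
by exists (a, b); split => //; exact: PQ.
Qed.

(** Cylinders over open sets of one factor are convenient generators: each is the positivity set of
    a continuous function of a single coordinate. *)
Lemma sigma_algebra_triple_generated (T1 T2 T3 : ptopologicalType)
    (A : set (borel T1 * borel T2 * borel T3)) : measurable A ->
  <<s [set A : set (borel T1 * borel T2 * borel T3) |
    [\/ exists2 U : set T1, open U & A = [set p | U p.1.1],
        exists2 U : set T2, open U & A = [set p | U p.1.2] |
        exists2 U : set T3, open U & A = [set p | U p.2]]] >> A.
Proof.
set G := [set A | _].
have mid : measurable_fun [set: g_sigma_algebraType G]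
    (idfun : g_sigma_algebraType G -> (borel T1 * borel T2 * borel T3)%type).
  apply/measurable_fun_pairP; split; first (apply/measurable_fun_pairP; split).
  - apply: (@measurability _ _ _ (borel T1) setT _ (@open T1)) => //.
    move=> _ [U oU <-]; rewrite setTI; apply: sub_sigma_algebra; apply: Or31.
    by exists U.
  - apply: (@measurability _ _ _ (borel T2) setT _ (@open T2)) => //.
    move=> _ [U oU <-]; rewrite setTI; apply: sub_sigma_algebra; apply: Or32.
    by exists U.
  - apply: (@measurability _ _ _ (borel T3) setT _ (@open T3)) => //.
    move=> _ [U oU <-]; rewrite setTI; apply: sub_sigma_algebra; apply: Or33.
    by exists U.
move=> mA; have := mid measurableT A mA; rewrite setTI; exact.
Qed.

Section triple.
Context (T1 T2 T3 : ptopologicalType).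
Hypotheses (b1 : countably_based T1) (b2 : countably_based T2)
  (b3 : countably_based T3).
Local Notation X := (T1 * T2 * T3)%type.
Local Notation BX := (borel T1 * borel T2 * borel T3)%type.

Lemma measurable_open_triple (U : set X) : open U -> measurable (U : set BX).
Proof.
move=> oU; have [B1 [oB1 h1]] := b1; have [B2 [oB2 h2]] := b2.
have [B3 [oB3 h3]] := b3.
pose box (n : nat * nat * nat) : set BX := B1 n.1.1 `*` B2 n.1.2 `*` B3 n.2.
have mbox n : measurable (box n).
  by apply: measurableX; [apply: measurableX|]; exact: borel_open.
have -> : (U : set BX) = \bigcup_(n in [set n | box n `<=` U]) box n.
  apply/seteqP; split => [[[x y] z] Up|p [n /= nU] /nU//].
  have /(_ Up) : U (x, y, z) -> nbhs (x, y, z) U by move=> ?; exact: open_nbhs_nbhs.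
  move=> [[P Q] /= [[[P1 P2] /= [P1x P2y] P12] Qz] PQ].
  have ex (T : topologicalType) (B : nat -> set T) (t : T) (S : set T) :
      (forall (U : set T) x, open U -> U x -> exists n, B n x /\ B n `<=` U) ->
      nbhs t S -> exists n, B n t /\ B n `<=` S.
    move=> hB; rewrite nbhsE => -[W [oW Wt] WS].
    have [n [Bt BW]] := hB _ _ oW Wt.
    by exists n; split => //; exact: subset_trans WS.
  have [n1 [? s1]] := ex _ _ _ _ h1 P1x.
  have [n2 [? s2]] := ex _ _ _ _ h2 P2y.
  have [n3 [? s3]] := ex _ _ _ _ h3 Qz.
  exists (n1, n2, n3) => //= -[[x' y'] z'] [[/= /s1 ? /s2 ?] /s3 ?].
  by apply: PQ; split => //; apply: P12.
rewrite bigcup_mkcond; apply: countable_bigcupT_measurable.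
  exact: countableP.
by move=> n; case: ifPn.
Qed.

Lemma within_continuous_measurable (R : realType) (K : set X) (f : X -> R) :
  measurable (K : set BX) -> {within K, continuous f} ->
  measurable_fun (K : set BX) (f : BX -> measurableTypeR R).
Proof.
move=> mK /continuousP cf.
apply: (@measurability _ _ BX (measurableTypeR R) K f _
  (@RGenOpens.measurableE R)).
move=> _ [_ [x [y ->]] <-].
have oxy : open (`]x, y[%classic : set R) by exact: interval_open.
have /open_subspaceP[V oV VK] := cf _ oxy.
rewrite setIC -VK; apply: measurableI => //.
exact: measurable_open_triple.
Qed.

End triple.

Lemma dini (T : topologicalType) (R : realType) (K : set T) (f : nat -> T -> R)
    (g : T -> R) : compact K ->
  (forall n, {within K, continuous f n}) -> {within K, continuous g} ->
  (forall x m n, K x -> (m <= n)%N -> f m x <= f n x) ->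
  (forall x, K x -> exists n, g x <= f n x) ->
  forall e : R, 0 < e -> exists n, forall x, K x -> g x <= f n x + e.
Proof.
move=> cK cf cg fnd gf e e0.
apply: contrapT => nex.
have far n : exists x, K x /\ f n x + e < g x.
  apply: contrapT => h; apply: nex; exists n => x Kx; rewrite leNgt; apply/negP => lt.
  by apply: h; exists x.
have [u hu] := choice far.
(* At a cluster point [p] of the counterexamples, some [f n] exceeds [g - e] near [p]; a later
   counterexample in that neighbourhood contradicts monotonicity. *)
have [|p [Kp clp]] := cK (u @ \oo).
  by exists 0%N => // n _ /=; exact: (hu n).1.
have [n gn] := gf p Kp.
have near_p : \forall x \near within K (nbhs p), g x < f n x + e.
  have /subspace_continuousP/(_ p Kp) cgp := cg.
  have /subspace_continuousP/(_ p Kp) cfp := cf n.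
  have /cvgrPdist_lt/(_ (e / 2)) := cgp.
  have /cvgrPdist_lt/(_ (e / 2)) := cfp.
  move=> /(_ (divr_gt0 e0 (ltr0n _ 2)))h1 /(_ (divr_gt0 e0 (ltr0n _ 2)))h2.
  apply: filterS2 h1 h2 => x; rewrite !ltr_norml /from_subspace => /andP[_ ?] /andP[? _].
  lra.
have [|_ [[k nk ->] /(_ (hu k).1)]] := clp [set x | exists2 k, (n <= k)%N & x = u k] _ _ near_p.
  by exists n => // k /= nk; exists k.
have := (hu k).2; have := fnd _ _ _ (hu k).1 nk; lra.
Qed.

(** * Integrands as continuous functions on a compact set *)

Lemma within_continuous_comp_within (T U S : topologicalType) (A : set T) (B : set U)
    (h : T -> U) (g : U -> S) :
  {within A, continuous h} -> (forall x, A x -> B (h x)) ->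
  {within B, continuous g} -> {within A, continuous (g \o h)}.
Proof.
move=> /subspace_continuousP ch AB /subspace_continuousP cg.
apply/subspace_continuousP => x Ax.
apply: (cvg_comp _ _ _ (cg _ (AB _ Ax))) => W BW.
by have := ch x Ax _ BW; apply: filterS2 (withinT _ _) => y Ay; apply; exact: AB.
Qed.

Lemma continuous_pair_fun (T U V : topologicalType) (f : T -> U) (g : T -> V) :
  continuous f -> continuous g -> continuous (fun x => (f x, g x)).
Proof. by move=> cf cg x; apply: cvg_pair; [exact: cf|exact: cg]. Qed.

Section E2_coding.
Variables (R : realType) (d : nat) (Omega : set 'rV[R]_d) (E : normedModType R).
Hypothesis Omega_open : open Omega.
Hypothesis Omega_bounded : bounded_set Omega.
Hypothesis E_euclidean : euclidean E.
Local Notation X := ('rV[R]_d * torus R d * E)%type.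
Local Notation BX := (borel 'rV[R]_d * borel (torus R d) * borel E)%type.

Definition cpt : set X := closure (over_domain Omega (unit_ball (E := E))).

Lemma closure_unit_ball : closure (unit_ball (E := E)) = [set z | `|z| <= 1].
Proof.
have -> : unit_ball (E := E) = ball (0 : E) 1.
  by apply/seteqP; split => z; rewrite -ball_normE /unit_ball/= sub0r normrN.
have := @closed_ballE R E 0 1 ltr01; rewrite /closed_ball => ->.
by apply/seteqP; split => z; rewrite /closed_ball_/= sub0r normrN.
Qed.

Lemma cptE : cpt = closure Omega `*` setT `*` [set z | `|z| <= 1].
Proof.
apply/seteqP; split.
  have clo : closed (closure Omega `*` setT `*` [set z : E | `|z| <= 1] : set X).
    have -> : (closure Omega `*` setT `*` [set z : E | `|z| <= 1] : set X) =
      (fun p : X => p.1.1) @^-1` closure Omega `&`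
      (fun p : X => `|p.2|) @^-1` [set r | r <= 1].
      by apply/seteqP; split => -[[x xi] z] /= [] // [].
    apply: closedI; apply: preimage_closed.
    - move=> p _; apply: (@cvg_comp _ _ _ fst fst); exact: cvg_fst.
    - exact: closed_closure.
    - move=> p _; apply: cvg_norm; exact: cvg_snd.
    - exact: closed_le.
  rewrite [X in _ `<=` X](closure_id _).1//; apply: closure_subset.
  move=> -[[x xi] z] [[/= Ox _] z1]; split; last exact: ltW.
  by split => //; exact: subset_closure.
rewrite -closure_unit_ball => -[[x xi] z] [[/= cx _] cz].
apply: closure_setX; split => //; apply: closure_setX; split => //.
by rewrite closureT.
Qed.

Lemma closed_cpt : closed cpt. Proof. exact: closed_closure. Qed.

Lemma compact_closure_Omega : compact (closure Omega).
Proof.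
have [M [Mr hM]] := Omega_bounded.
have cb : closed [set v : 'rV[R]_d | `|v| <= M + 1].
  rewrite (_ : [set _ | _] = (fun v : 'rV[R]_d => `|v|) @^-1` [set r | r <= M + 1])//.
  by apply: preimage_closed; [move=> v _; exact: norm_continuous|exact: closed_le].
apply: (@subclosed_compact _ _ [set v : 'rV[R]_d | `|v| <= M + 1]).
- exact: closed_closure.
- apply: bounded_closed_compact => //.
  exists (M + 1); split; first exact: num_real.
  by move=> r Mr' v /= /le_trans; apply; exact: ltW.
- rewrite [X in _ `<=` X](closure_id _).1//; apply: closure_subset => v Ov.
  by apply: hM => //; rewrite ltrDl.
Qed.

Lemma compact_cpt : compact cpt.
Proof.
rewrite cptE; apply: compact_setX; last exact: euclidean_closed_ball_compact.
by apply: compact_setX; [exact: compact_closure_Omega|exact: torus_compact].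
Qed.

Lemma measurable_open_BX (U : set X) : open U -> measurable (U : set BX).
Proof.
apply: measurable_open_triple; [exact: countably_based_rV|exact: countably_based_torus|].
exact: euclidean_countably_based.
Qed.

Lemma measurable_cpt : measurable (cpt : set BX).
Proof.
rewrite -(setCK cpt); apply: measurableC; apply: measurable_open_BX.
exact/closed_openC/closed_cpt.
Qed.

Lemma sub_cpt : over_domain Omega (unit_ball (E := E)) `<=` cpt.
Proof. exact: subset_closure. Qed.

Definition shrink (z : E) : E := (1 + `|z|)^-1 *: z.
Definition blow (z : E) : E := (1 - `|z|)^-1 *: z.

Lemma shrink_lt1 z : `|shrink z| < 1.
Proof.
rewrite normrZ ger0_norm ?invr_ge0 ?addr_ge0// mulrC ltr_pdivrMr ?mul1r ?ltrDr//.
Qed.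

Lemma norm1_shrink z : 1 - `|shrink z| = (1 + `|z|)^-1.
Proof.
have h : 1 + `|z| != 0 by rewrite gt_eqF// ltr_wpDr.
by rewrite normrZ ger0_norm ?invr_ge0 ?addr_ge0//; field.
Qed.

Lemma norm1_blow z : `|z| < 1 -> 1 + `|blow z| = (1 - `|z|)^-1.
Proof.
move=> z1; have h : 1 - `|z| != 0 by rewrite subr_eq0 gt_eqF.
by rewrite normrZ ger0_norm ?invr_ge0 ?subr_ge0 ?ltW//; field.
Qed.

Lemma shrinkK : cancel shrink blow.
Proof.
move=> z; rewrite /blow norm1_shrink invrK /shrink scalerA divff ?scale1r//.
Qed.

Lemma blowK z : `|z| < 1 -> shrink (blow z) = z.
Proof.
move=> z1; rewrite /shrink norm1_blow// invrK /blow scalerA divff ?scale1r//.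
by rewrite subr_eq0 gt_eqF.
Qed.

Lemma shrink_continuous : continuous shrink.
Proof.
move=> z; apply: cvgZ; last exact: cvg_id.
apply: cvgV; first by rewrite gt_eqF// ltr_wpDr.
by apply: cvgD; [exact: cvg_cst|exact: norm_continuous].
Qed.

Definition E2_Tinv (g : X -> R) (p : X) : R^o :=
  if `[< Omega p.1.1 >] then (1 + `|p.2|) * g (p.1, shrink p.2) else 0.

Definition Vcpt : set (X -> R) := [set g | {within cpt, continuous g}].

Lemma E2_TinvK g p : over_domain Omega (unit_ball (E := E)) p ->
  E2_T (E2_Tinv g) p = g p.
Proof.
case: p => -[x xi] z [[/= Ox _] z1].
rewrite /E2_T /E2_Tinv /= -/(blow z); case: asboolP => // _.
rewrite blowK// norm1_blow// mulrA divff ?mul1r//.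
by rewrite subr_eq0 gt_eqF.
Qed.

Lemma E2_Tinv_mem g : Vcpt g -> E2_Tinv g \in E2_pred Omega (E := E).
Proof.
move=> Vg; rewrite inE; split.
- pose f (p : X) := (1 + `|p.2|) * g (p.1, shrink p.2).
  apply: (@subspace_eq_continuous _ _ _ f).
    move=> p; rewrite inE => -[[/= Op _] _].
    by rewrite /from_subspace /E2_Tinv; case: asboolP.
  have ch : continuous (fun p : X => (p.1, shrink p.2)).
    apply: continuous_pair_fun => p; first exact: cvg_fst.
    by apply: (@cvg_comp _ _ _ snd shrink); [exact: cvg_snd|exact: shrink_continuous].
  have cgh : {within over_domain Omega setT, continuous (fun p : X => g (p.1, shrink p.2))}.
    apply: (@within_continuous_comp_within _ _ _ _ cpt (fun p : X => (p.1, shrink p.2)) g) => //.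
      exact: continuous_subspaceT.
    move=> p [[Op _] _]; apply: sub_cpt; split => //=.
    exact: shrink_lt1.
  have c1 : {within over_domain Omega setT, continuous (fun p : X => 1 + `|p.2| : R)}.
    apply: continuous_subspaceT => p; apply: cvgD; first exact: cvg_cst.
    by apply: cvg_norm; exact: cvg_snd.
  by move=> p; apply: cvgM; [exact: c1|exact: cgh].
- by move=> p nO; rewrite /E2_Tinv; case: asboolP.
- by exists g => // p pO; rewrite E2_TinvK.
Qed.

(** The inverse of [T] as a total function, with default value 0 when [g] is not continuous on the
    compact set. *)
Definition E2_inv (g : X -> R) : E2 Omega E := insubd (0 : E2 Omega E) (E2_Tinv g).

Lemma E2_invE g : Vcpt g -> E2_inv g = E2_Tinv g :> (X -> R^o).
Proof. by move=> Vg; rewrite /E2_inv insubdK//; exact: E2_Tinv_mem. Qed.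

(** A relation and not a function, because only the values of [g] on the compact set are determined
    by [f]. *)
Definition is_ext (f : X -> R) (g : X -> R) : Prop := Vcpt g /\
  forall p, over_domain Omega (unit_ball (E := E)) p -> g p = E2_T f p.

Lemma E2_ext (f : E2 Omega E) : exists g, is_ext f g.
Proof.
have := valP f; rewrite inE => -[_ _ [g cg gE]].
by exists g; split.
Qed.

Lemma E2_vanish (f : E2 Omega E) p : ~ Omega p.1.1 -> f p = 0.
Proof. by have := valP f; rewrite inE => -[_ + _]; exact. Qed.

Lemma is_extE (f g : X -> R) p : is_ext f g -> Omega p.1.1 ->
  f p = (1 + `|p.2|) * g (p.1, shrink p.2).
Proof.
move=> [_ gE] Op; rewrite gE; last by split => //=; exact: shrink_lt1.
rewrite /E2_T /= -/(blow (shrink p.2)) shrinkK norm1_shrink.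
by rewrite mulrA divff ?mul1r -?surjective_pairing// gt_eqF// ltr_wpDr.
Qed.

Lemma E2_inv_ext (f : E2 Omega E) g : is_ext f g -> E2_inv g = f.
Proof.
move=> fg; apply: val_inj => /=; rewrite E2_invE; last exact: fg.1.
apply/funext => p; rewrite /E2_Tinv; case: asboolP => [Op|nOp].
  by rewrite (is_extE fg Op).
by rewrite E2_vanish.
Qed.

Lemma E2_inv_is_ext g : Vcpt g -> is_ext (E2_inv g) g.
Proof. by move=> Vg; split => // p pO; rewrite E2_invE// E2_TinvK. Qed.

Lemma Vcpt_bounded g : Vcpt g -> exists M, forall p, cpt p -> `|g p| <= M.
Proof.
move=> Vg; have := continuous_compact Vg compact_cpt.
move=> /compact_bounded[M [Mr hM]]; exists (M + 1) => p Kp.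
by apply: (hM (M + 1)); [rewrite ltrDl|exists p].
Qed.

Lemma Vcpt_cst c : Vcpt (fun=> c).
Proof. by move=> x; exact: cvg_cst. Qed.

Lemma VcptD f g : Vcpt f -> Vcpt g -> Vcpt (fun x => f x + g x).
Proof. by move=> Vf Vg x; apply: cvgD; [exact: Vf|exact: Vg]. Qed.

Lemma VcptM f g : Vcpt f -> Vcpt g -> Vcpt (fun x => f x * g x).
Proof. by move=> Vf Vg x; apply: cvgM; [exact: Vf|exact: Vg]. Qed.

Lemma Vcpt_max f g : Vcpt f -> Vcpt g -> Vcpt (fun x => Num.max (f x) (g x)).
Proof.
move=> Vf Vg; rewrite (_ : (fun _ => _) = fun x => (f x + g x + `|f x - g x|) / 2).
  move=> x; apply: cvgM; last exact: cvg_cst.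
  apply: cvgD; first by apply: cvgD; [exact: Vf|exact: Vg].
  by apply: cvg_norm; apply: cvgB; [exact: Vf|exact: Vg].
by apply/funext => x; rewrite maxr_absE.
Qed.

Lemma Vcpt_continuous f : continuous f -> Vcpt f.
Proof. exact: continuous_subspaceT. Qed.

Lemma measurable_Vcpt g : Vcpt g ->
  measurable_fun (cpt : set BX) (g : BX -> measurableTypeR R).
Proof.
move=> Vg; apply: within_continuous_measurable => //.
- exact: countably_based_rV.
- exact: countably_based_torus.
- exact: euclidean_countably_based.
- exact: measurable_cpt.
Qed.

(** The Riesz representation theorem for [l] composed with the inverse of [T], which is linear and
    preserves positivity. *)
Lemma positive_functional_measure (l : E2 Omega E -> R^o) : linear l ->
  (forall f : E2 Omega E, (forall p, 0 <= f p) -> 0 <= l f) ->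
  exists mu : {finite_measure set BX -> \bar R}, mu (~` (cpt : set BX)) = 0%E /\
    forall (f : E2 Omega E) g, is_ext f g ->
      l f = \int[mu]_(p in (cpt : set BX)) g p.
Proof.
move=> llin lpos; pose L g := l (E2_inv g).
have invL a f g : Vcpt f -> Vcpt g ->
    E2_inv (fun x => a * f x + g x) = a *: E2_inv f + E2_inv g.
  move=> Vf Vg; apply: val_inj => /=; rewrite !E2_invE//; last first.
    by apply: VcptD => //; apply: VcptM => //; exact: Vcpt_cst.
  apply/funext => p; rewrite /E2_Tinv /= !fctE /= /E2_Tinv.
  by case: asboolP => _; rewrite ?scaler0 ?addr0// mulrDr mulrCA.
have LD f g : Vcpt f -> Vcpt g -> L (fun x => f x + g x) = L f + L g.
  move=> Vf Vg; have := llin 1 (E2_inv f) (E2_inv g).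
  rewrite -invL// [X in _ = X + _ -> _]scale1r => <-.
  by congr (l (E2_inv _)); apply/funext => x; rewrite mul1r.
have LZ c f : Vcpt f -> L (fun x => c * f x) = c * L f.
  move=> Vf; have l0 : l 0 = 0.
    have := llin (-1) 0 0; rewrite scaler0 addr0 scaleN1r => ->; exact: addNr.
  have inv0 : E2_inv (fun=> 0) = 0.
    apply: val_inj => /=; rewrite E2_invE; last exact: Vcpt_cst.
    by apply/funext => p; rewrite /E2_Tinv mulr0; case: ifP.
  have := llin c (E2_inv f) (E2_inv (fun=> 0)).
  rewrite -invL//; last exact: Vcpt_cst.
  have -> : l (E2_inv (fun=> 0)) = 0 by rewrite inv0.
  rewrite [X in _ = X -> _]addr0 => lE; rewrite /L -[RHS]lE.
  by congr (l (E2_inv _)); apply/funext => x; rewrite addr0.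
have L_ge0 f : Vcpt f -> (forall x, cpt x -> 0 <= f x) -> 0 <= L f.
  move=> Vf f0; apply: lpos => p; rewrite E2_invE// /E2_Tinv.
  case: asboolP => // Op; rewrite mulr_ge0 ?addr_ge0// f0//; apply: sub_cpt.
  by split => //=; exact: shrink_lt1.
have dini_V f g : (forall n, Vcpt (f n)) -> Vcpt g ->
    (forall x m n, cpt x -> (m <= n)%N -> f m x <= f n x) ->
    (forall x, cpt x -> exists n, g x <= f n x) ->
    forall e : R, 0 < e -> exists n, forall x, cpt x -> g x <= f n x + e.
  by move=> Vf Vg; apply: dini => //; exact: compact_cpt.
pose G := [set A : set BX |
    [\/ exists2 U : set 'rV[R]_d, open U & A = [set p | U p.1.1],
        exists2 U : set (torus R d), open U & A = [set p | U p.1.2] |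
        exists2 U : set E, open U & A = [set p | U p.2]]].
have Gbump A : G A -> exists2 h, Vcpt h &
    forall x, cpt x -> 0 <= h x /\ (A x <-> 0 < h x).
  case=> -[U oU ->].
  - exists (fun p => bump U p.1.1) => [|p _].
      apply: Vcpt_continuous => p.
      apply: (@cvg_comp _ _ _ (fun p : X => p.1.1) (bump U)).
        by apply: (@cvg_comp _ _ _ fst fst); exact: cvg_fst.
      exact: bump_continuous.
    by split; [exact: bump_ge0|exact: bump_gt0].
  - have [h [ch h0 hU]] := torus_bump oU.
    exists (fun p => h p.1.2) => [|p _]; last by split; [exact: h0|exact: hU].
    apply: Vcpt_continuous => p.
    apply: (@cvg_comp _ _ _ (fun p : X => p.1.2) h); last exact: ch.
    by apply: (@cvg_comp _ _ _ fst snd); [exact: cvg_fst|exact: cvg_snd].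
  - exists (fun p => bump U p.2) => [|p _].
      apply: Vcpt_continuous => p.
      by apply: (@cvg_comp _ _ _ snd (bump U)); [exact: cvg_snd|exact: bump_continuous].
    by split; [exact: bump_ge0|exact: bump_gt0].
have [mu [muK muE]] := @daniell_integral _ BX R cpt Vcpt L Vcpt_cst VcptD VcptM
  Vcpt_max LD LZ L_ge0 dini_V G Gbump (@sigma_algebra_triple_generated _ _ _)
  measurable_cpt.
exists mu; split => // f g fg.
have [M gM] := Vcpt_bounded fg.1.
rewrite -(muE g M fg.1 (measurable_Vcpt fg.1) gM) /L.
by rewrite (E2_inv_ext fg).
Qed.

End E2_coding.

(** * Closedness and compactness *)

Lemma cvg_inv_pinfty (R : realType) : t^-1 @[t --> +oo] --> (0 : R).
Proof.
apply/cvgrPdist_lt => e e0.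
have : \forall t \near +oo, e^-1 < t :> R by exact: nbhs_pinfty_gt (num_real _).
apply: filterS => t et; have t0 : 0 < t by rewrite (lt_trans _ et)// invr_gt0.
by rewrite sub0r normrN gtr0_norm ?invr_gt0// invf_plt.
Qed.

(** Measurability is avoided because the inner integrals of [mass] and [pairing] are not known to be
    measurable; the integral of a nonnegative function is a supremum over simple functions below it,
    hence monotone in any case. *)
Lemma ge0_le_integral_nomeas d (T : measurableType d) (R : realType)
    (mu : {measure set T -> \bar R}) (D D' : set T) (f g : T -> \bar R) :
  (forall x, D x -> 0 <= f x)%E -> (forall x, D' x -> 0 <= g x)%E ->
  D `<=` D' -> (forall x, D x -> f x <= g x)%E ->
  (\int[mu]_(x in D) f x <= \int[mu]_(x in D') g x)%E.
Proof.
move=> f0 g0 DD' fg; rewrite ge0_integralE// [leRHS]ge0_integralE//.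
apply: ge_ereal_sup => _ [h hf <-]; apply: ereal_sup_ubound; exists h => // x.
apply: (le_trans (hf x)); rewrite /patch; case: ifPn => xD.
  rewrite (_ : x \in D'); last exact/mem_set/DD'/set_mem.
  by apply: fg; exact: set_mem.
by case: ifPn => // xD'; apply: g0; exact: set_mem.
Qed.

Lemma ge0_fine_le (R : realType) (a : \bar R) : (0 <= a)%E -> ((fine a)%:E <= a)%E.
Proof. by case: a => [r| |]//= _; rewrite leey. Qed.

Lemma measurable_unit_sphere (R : realType) (E : normedModType R) :
  measurable (unit_sphere E : set (borel E)).
Proof.
rewrite -[unit_sphere E]setCK; apply: measurableC; apply: borel_open.
apply/closed_openC; rewrite (_ : unit_sphere E = Num.norm @^-1` [set r | r = 1])//.
by apply: preimage_closed; [move=> z _; exact: norm_continuous|exact: closed_eq].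
Qed.

Section young_functional.
Variables (R : realType) (d : nat) (Omega : set 'rV[R]_d) (E : normedModType R).
Hypothesis Omega_open : open Omega.
Hypothesis Omega_bounded : bounded_set Omega.
Hypothesis E_euclidean : euclidean E.
Local Notation X := ('rV[R]_d * torus R d * E)%type.

(** For a unit vector [z], [f(x', xi', t z) / t] equals [(1 + 1/t) g(x', xi', z / (1 + 1/t))], whose
    argument tends to [(x, xi, z)] inside the compact set, where [g] is continuous. *)
Lemma recession_ext (f : E2 Omega E) g x xi z : is_ext Omega f g ->
  closure Omega x -> `|z| = 1 -> recession f x xi z = g (x, xi, z).
Proof.
move=> fg cx z1; rewrite /recession.
set F := filter_prod _ _.
have pF : ProperFilter F.
  (* Properness, hence uniqueness of the limit, comes from [x] being in the closure of [Omega]. *)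
  have p1 : ProperFilter (within Omega (nbhs x)) by exact: within_nbhs_proper.
  exact: filter_prod_proper.
apply: cvg_lim => //.
pose phi (q : 'rV[R]_d * torus R d * R) : X := (q.1, (1 + q.2^-1)^-1 *: z).
pose G (q : 'rV[R]_d * torus R d * R) := (1 + q.2^-1) * g (phi q).
have inv0 : q.2^-1 @[q --> F] --> (0 : R).
  by apply: (@cvg_comp _ _ _ snd (fun t : R => t^-1)); [exact: cvg_snd|exact: cvg_inv_pinfty].
have inv1 : 1 + q.2^-1 @[q --> F] --> (1 : R).
  by rewrite -[X in _ --> X]addr0; apply: cvgD => //; exact: cvg_cst.
have FO : \forall q \near F, Omega q.1.1 /\ 0 < q.2.
  exists ([set p | Omega p.1], [set t | 0 < t]) => /=.
    split; last exact: nbhs_pinfty_gt.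
    exists (Omega, setT) => /=; last by move=> p [].
    by split; [exact: withinT|exact: filterT].
  by move=> [q t] [/= h1 h2].
have cptx : cpt Omega (x, xi, z).
  by rewrite cptE; split => //=; rewrite z1.
have phi_cvg : phi @ F --> within (@cpt R d Omega E) (nbhs (x, xi, z)).
  have phi1 : phi @ F --> nbhs (x, xi, z).
    have h1 : q.1 @[q --> F] --> nbhs (x, xi).
      apply: (@cvg_trans _ (filter_prod (within Omega (nbhs x)) (nbhs xi))).
        exact: cvg_fst.
      move=> A [[P Q] /= [nP nQ] PQ]; exists (P, Q) => //=; split => //.
      by apply: filterS nP => y Py _.
    have h2 : (1 + q.2^-1)^-1 *: z @[q --> F] --> z.
      rewrite -[X in _ --> X]scale1r -[X in X *: z]invr1.
      by apply: cvgZr_tmp; apply: cvgV => //; exact: oner_neq0.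
    exact: (cvg_pair h1 h2).
  move=> A /phi1; apply: filterS2 FO => -[[x' xi'] t] [/= Ox t0]; apply.
  rewrite cptE; split => /=; first by split => //; exact: subset_closure.
  have s0 : 0 <= t^-1 by rewrite invr_ge0 ltW.
  rewrite normrZ z1 mulr1 ger0_norm ?invr_ge0 ?addr_ge0//.
  by rewrite invf_le1 ?lerDl// ltr_wpDr.
have /subspace_continuousP/(_ _ cptx) cg := fg.1.
have Gcvg : G @ F --> g (x, xi, z).
  rewrite -[X in _ --> X]mul1r; apply: cvgM => //.
  exact: cvg_comp phi_cvg cg.
apply: cvg_trans Gcvg; apply: near_eq_cvg.
apply: filterS FO => -[[x' xi'] t] [/= Ox t0].
have tn : t != 0 by rewrite gt_eqF.
have t1 : 1 + t != 0 by rewrite gt_eqF// ltr_wpDl.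
rewrite (is_extE fg)// /G /phi /shrink /= normrZ z1 mulr1 gtr0_norm// scalerA.
have -> : 1 + t^-1 = (1 + t) / t by rewrite mulrDl divff// mul1r addrC.
by rewrite invf_div [t / (1 + t)]mulrC mulrAC.
Qed.

Lemma recession_ge0 (f : E2 Omega E) x xi z : (forall p, 0 <= f p) ->
  closure Omega x -> `|z| = 1 -> 0 <= recession f x xi z.
Proof.
move=> f0 cx z1; have [g fg] := E2_ext f.
(* The positive part of [g] is again an extension of [T f], and is visibly nonnegative on the
   sphere. *)
rewrite (@recession_ext _ (fun p => Num.max (g p) 0))//.
  by rewrite le_max lexx orbT.
split; first by apply: Vcpt_max; [exact: fg.1|exact: Vcpt_cst].
move=> p Op; rewrite fg.2// (max_idPl _)//.
rewrite /E2_T mulr_ge0// subr_ge0 ltW//.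
by case: Op.
Qed.

(** Here [T f] is [(1 - |z|) f(x, xi, 0)], which vanishes on the sphere; [g] at [z = 0] supplies its
    continuous extension over the closure of [Omega]. *)
Lemma recession_cst (f : E2 Omega E) x xi z :
  (forall x xi z, f (x, xi, z) = f (x, xi, 0)) ->
  closure Omega x -> `|z| = 1 -> recession f x xi z = 0.
Proof.
move=> fz cx z1; have [g fg] := E2_ext f.
rewrite (@recession_ext _ (fun p => (1 - `|p.2|) * g (p.1, 0)))//=.
  by rewrite z1 subrr mul0r.
split.
  apply: VcptM.
    apply: Vcpt_continuous => p; apply: cvgB; first exact: cvg_cst.
    by apply: cvg_norm; exact: cvg_snd.
  rewrite /Vcpt /=.
  apply: (@within_continuous_comp_within _ _ _ _ (@cpt R d Omega E)
    (fun p : X => (p.1, 0)) g).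
  - apply: continuous_subspaceT; apply: continuous_pair_fun.
      by move=> p; exact: cvg_fst.
    exact: cst_continuous.
  - by move=> p; rewrite !cptE => -[? _]; split => //=; rewrite normr0.
  - exact: fg.1.
move=> [[x' xi'] z'] [[/= Ox _] z'1].
rewrite fg.2; last by split => //=; rewrite /unit_ball/= normr0.
by rewrite /E2_T /= normr0 subr0 mul1r scaler0 [in RHS]fz.
Qed.

Definition young_functional (l : E2 Omega E -> R) : Prop :=
  (forall f : E2 Omega E, (forall p, 0 <= f p) -> 0 <= l f) /\
  (forall f : E2 Omega E, (forall x xi z, f (x, xi, z) = f (x, xi, 0)) ->
    l f = \int[lebesgue_rV R d]_(x in Omega) \int[torus_measure R d]_xi
      f (x, xi, 0)).

(** Iterated real integrals of nonnegative functions are nonnegative whatever their integrability,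
    and on an integrand without [z] the recession term vanishes while each [nu] averages a
    constant. *)
Lemma pairing_young_functional (nu : young_measure Omega E) :
  young_functional (fun f => pairing f nu).
Proof.
split => f hf.
  apply: addr_ge0.
    apply: Rintegral_ge0 => x _; apply: Rintegral_ge0 => xi _.
    by apply: Rintegral_ge0 => z _.
  apply: Rintegral_ge0 => x cx; apply: Rintegral_ge0 => xi _.
  by apply: Rintegral_ge0 => z z1; exact: recession_ge0.
rewrite /pairing [X in _ + X](_ : _ = 0) ?addr0; last first.
  rewrite (@eq_Rintegral _ _ _ _ _ (fun=> 0)) ?Rintegral_cst0//; last first.
    move=> x; rewrite inE => cx.
    rewrite (@eq_Rintegral _ _ _ _ _ (fun=> 0)) => [|xi _].
      by rewrite /Rintegral integral0.
    rewrite (@eq_Rintegral _ _ _ _ _ (fun=> 0)) => [|z].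
      by rewrite /Rintegral integral0.
    by rewrite inE => z1; exact: recession_cst.
  by rewrite /Rintegral integral0.
apply: eq_Rintegral => x _; apply: eq_Rintegral => xi _.
under eq_Rintegral do rewrite hf.
by rewrite Rintegral_cst//= probability_setT mulr1.
Qed.

(** The integrand [1 + |z|] on [Omega], as the one whose transform is the constant 1. *)
Definition unit_E2 : E2 Omega E := E2_inv Omega (fun=> 1).

(** Only an inequality: [mass] integrates over the closure of [Omega], and the real integrals of the
    pairing read an infinite value as 0. *)
Lemma pairing_unit_le (nu : young_measure Omega E) (M : R) :
  (mass nu <= M%:E)%E -> pairing unit_E2 nu <= M.
Proof.
move=> massM; rewrite -lee_fin; apply: le_trans massM.
have uE p : unit_E2 p = if `[< Omega p.1.1 >] then 1 + `|p.2| else 0.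
  rewrite /unit_E2 E2_invE; last exact: Vcpt_cst.
  by rewrite /E2_Tinv mulr1.
have ext1 : is_ext Omega unit_E2 (fun=> 1) by apply: E2_inv_is_ext; exact: Vcpt_cst.
rewrite /pairing EFinD; apply: leeD.
  apply: (le_trans (ge0_fine_le _)).
    by apply: integral_ge0 => x _; rewrite lee_fin; apply: Rintegral_ge0 => xi _;
      apply: Rintegral_ge0 => z _; rewrite uE; case: ifP => // _; rewrite addr_ge0.
  apply: ge0_le_integral_nomeas.
  - by move=> x _; rewrite lee_fin; apply: Rintegral_ge0 => xi _;
      apply: Rintegral_ge0 => z _; rewrite uE; case: ifP => // _; rewrite addr_ge0.
  - move=> x _; apply: integral_ge0 => xi _; apply: integral_ge0 => z _.
    by rewrite lee_fin addr_ge0.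
  - exact: subset_closure.
  move=> x Ox; apply: (le_trans (ge0_fine_le _)).
    by apply: integral_ge0 => xi _; rewrite lee_fin;
      apply: Rintegral_ge0 => z _; rewrite uE; case: ifP => // _; rewrite addr_ge0.
  apply: ge0_le_integral_nomeas => //.
  - by move=> xi _; rewrite lee_fin; apply: Rintegral_ge0 => z _; rewrite uE; case: ifP => // _; rewrite addr_ge0.
  - by move=> xi _; apply: integral_ge0 => z _; rewrite lee_fin addr_ge0.
  move=> xi _; apply: (le_trans (ge0_fine_le _)).
    by apply: integral_ge0 => z _; rewrite lee_fin uE; case: ifP => // _; rewrite addr_ge0.
  apply: ge0_le_integral_nomeas => //.
  - by move=> z _; rewrite lee_fin uE; case: ifP => // _; rewrite addr_ge0.
  - by move=> z _; rewrite lee_fin uE /=; case: asboolP.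
have msphere : measurable (unit_sphere E : set (borel E)).
  exact: measurable_unit_sphere.
have mclo : measurable (closure Omega : set (borel 'rV[R]_d)).
  rewrite -[closure Omega]setCK; apply: measurableC; apply: borel_open.
  exact/closed_openC/closed_closure.
rewrite (@eq_Rintegral _ _ _ _ _ (fun=> 1)); last first.
  move=> x; rewrite inE => cx; rewrite (@eq_Rintegral _ _ _ _ _ (fun=> 1)).
    by rewrite Rintegral_cst//= probability_setT mulr1.
  move=> xi _; rewrite (@eq_Rintegral _ _ _ _ _ (fun=> 1)).
    by rewrite Rintegral_cst//= ym_nuoo_sphere// mulr1.
  by move=> z; rewrite inE => z1; rewrite (recession_ext _ ext1).
by rewrite Rintegral_cst// mul1r fineK// fin_num_measure.
Qed.

Definition representable : Prop := forall l : E2 Omega E -> R^o, linear l ->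
  young_functional l -> exists nu : young_measure Omega E,
  forall f, l f = pairing f nu.

Lemma E2_le_norm (f : E2 Omega E) p : `|f p| <= E2_norm f * unit_E2 p.
Proof.
have [g fg] := E2_ext f; have [M gM] := Vcpt_bounded Omega_bounded E_euclidean fg.1.
rewrite /unit_E2 E2_invE; last exact: Vcpt_cst.
rewrite /E2_Tinv mulr1; case: asboolP => [Op|nOp]; last by rewrite E2_vanish// normr0 mulr0.
rewrite (is_extE fg Op) normrM ger0_norm ?addr_ge0// mulrC ler_pM2r ?ltr_wpDr//.
have Op' : over_domain Omega (unit_ball (E := E)) (p.1, shrink p.2).
  by split => //=; exact: shrink_lt1.
apply: ub_le_sup; last by exists (p.1, shrink p.2) => //; rewrite fg.2.
exists M => _ [q Oq <-]; rewrite -fg.2//; apply: gM; exact: sub_cpt.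
Qed.

Lemma young_functional_bound (l : E2 Omega E -> R^o) f : linear l ->
  young_functional l -> `|l f| <= l unit_E2 * E2_norm f.
Proof.
move=> llin [lpos _].
have lB g h : l (g - h) = l g - l h.
  by have := llin (-1) h g; rewrite !scaleN1r ![- _ + _]addrC.
have lZ c g : l (c *: g) = c * l g.
  have l0 : l 0 = 0 by have := lB 0 0; rewrite !subrr.
  by have := llin c g 0; rewrite l0 !addr0.
have h p : - (E2_norm f * unit_E2 p) <= f p <= E2_norm f * unit_E2 p.
  by rewrite -ler_norml; exact: E2_le_norm.
rewrite mulrC -lZ ler_norml; apply/andP; split.
  rewrite lerNl -subr_ge0.
  have -> : - l f = l (0 - f) by rewrite lB (_ : l 0 = 0) ?sub0r//; have := lB 0 0; rewrite !subrr.
  rewrite -lB; apply: lpos => p.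
  suff : 0 <= E2_norm f * unit_E2 p - (0 - f p) by [].
  by have /andP[+ _] := h p; lra.
rewrite -subr_ge0 -lB; apply: lpos => p.
suff : 0 <= E2_norm f * unit_E2 p - f p by [].
by rewrite subr_ge0; have /andP[] := h p.
Qed.

Lemma E2_norm_ge0 (f : E2 Omega E) : 0 <= E2_norm f.
Proof.
have [g fg] := E2_ext f; have [M gM] := Vcpt_bounded Omega_bounded E_euclidean fg.1.
rewrite /E2_norm; set S := [set _ | _ in _].
have [->|/set0P[r Sr]] := eqVneq S set0; first by rewrite sup0.
apply: (@le_trans _ _ r); first by case: Sr => p _ <-.
apply: ub_le_sup => //; exists M => _ [q Oq <-].
by rewrite -fg.2//; apply: gM; exact: sub_cpt.
Qed.

(** Every condition compares finitely many evaluations, which are continuous for pointwise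
    convergence. The form with filters serves both the sequential statement and the compactness
    argument. *)
Lemma young_functional_closed (F : set_system {ptws E2 Omega E -> R^o})
    (l : {ptws E2 Omega E -> R^o}) : ProperFilter F -> F --> l ->
  F [set l : E2 Omega E -> R^o | linear l /\ young_functional l] ->
  linear (l : E2 Omega E -> R^o) /\ young_functional l.
Proof.
move=> pF Fl FY.
have ev f : (fun l : {ptws E2 Omega E -> R^o} => l f) @ F --> l f.
  by apply: cvg_trans (@proj_continuous _ (fun=> R^o) f l); exact: cvg_app.
split.
  move=> a f g.
  have c1 : (fun k : {ptws E2 Omega E -> R^o} => a *: k f + k g) @ F --> a *: l f + l g.
    by apply: cvgD; [apply: cvgZl_tmp; exact: ev|exact: ev].
  apply: (cvg_unique _ (ev (a *: f + g))) => //.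
  apply: cvg_trans c1; apply: near_eq_cvg.
  by apply: filterS FY => k [klin _]; rewrite klin.
split => f hf.
  apply: (closed_cvg (fun r : R^o => 0 <= r) (@closed_ge R 0) _ _ (ev f)).
  by apply: filterS FY => k [_ [kpos _]]; exact: kpos.
apply: (cvg_unique _ (ev f)) => //; apply: cvg_near_cst.
by apply: filterS FY => k [_ [_ kE]]; exact: kE.
Qed.

Lemma seq_closed_Y2 : representable -> seq_closed (Y2 Omega E).
Proof.
move=> rep u l uY ul.
pose v n : {ptws E2 Omega E -> R^o} := set_val (u n).
have vl : v @ \oo --> (set_val l : {ptws E2 Omega E -> R^o}).
  apply: (@cvg_comp _ _ _ u set_val _ _ _ ul); exact: initial_continuous.
have [|llin ly] := @young_functional_closed (v @ \oo) (set_val l) _ vl.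
  exists 0%N => // n _; split.
    by have := set_valP (u n); case.
  have [nu hnu] := uY n.
  have -> : (v n : E2 Omega E -> R) = fun f => pairing f nu by apply/funext.
  exact: pairing_young_functional.
have [nu hnu] := rep _ llin ly.
by exists nu.
Qed.

Lemma precompact_Y2 (Y : set (young_measure Omega E)) : representable ->
  (ereal_sup [set mass nu | nu in Y] < +oo)%E ->
  precompact [set l : Y2 Omega E | exists2 nu, Y nu & represents nu (set_val l)].
Proof.
move=> rep Ysup.
have [M hM] : exists M : R, forall nu, Y nu -> (mass nu <= M%:E)%E.
  case H : (ereal_sup _) Ysup => [M| |]// _.
    by exists M => nu Ynu; rewrite -H; apply: ereal_sup_ubound; exists nu.
  (* The supremum is [-oo], as for an empty [Y]; any real bound will do. *)
  exists 0 => nu Ynu; have : (mass nu <= ereal_sup [set mass nu | nu in Y])%E.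
    by apply: ereal_sup_ubound; exists nu.
  by rewrite H => /le_trans; apply; exact: leNye.
pose e (l : Y2 Omega E) : {ptws E2 Omega E -> R^o} := set_val (set_val l).
have ce : continuous e.
  move=> l; apply: (@continuous_comp _ _ _ set_val set_val); exact: initial_continuous.
have eP l : linear (e l : E2 Omega E -> R^o) /\ young_functional (e l).
  split; first by have := set_valP (set_val l); case.
  have [nu hnu] := set_valP l.
  have -> : (e l : E2 Omega E -> R) = fun f => pairing f nu by apply/funext.
  exact: pairing_young_functional.
(* The mass depends on the chosen [nu]; its substitute [l (1 + |z|)] depends on [l] alone and
   continuously, so this bound defines a closed set. *)
pose U : set (Y2 Omega E) := [set l | e l unit_E2 <= M].
have evc f : continuous (fun l : {ptws E2 Omega E -> R^o} => l f).
  exact: (@proj_continuous _ (fun=> R^o) f).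
have cU : closed U.
  rewrite (_ : U = (fun l => e l unit_E2) @^-1` [set r | r <= M])//.
  apply: preimage_closed; last exact: closed_le.
  by move=> l _; apply: (@continuous_comp _ _ _ e (fun k => k unit_E2));
    [exact: ce|exact: evc].
exists U; last first.
  split => // F pF FU.
  pose K0 := [set k : {ptws E2 Omega E -> R^o} |
    forall f, `[- (M * E2_norm f), M * E2_norm f]%classic (k f)].
  have cK0 : compact K0.
    apply: (@tychonoff _ (fun=> R^o)
      (fun f : E2 Omega E => `[- (M * E2_norm f), M * E2_norm f]%classic)) => f.
    exact: segment_compact.
  (* A closed set of all functions on [E2] that contains the image of [U] and, by
     [young_functional_bound], sits in the Tychonoff product [K0]. *)
  pose W := [set k : {ptws E2 Omega E -> R^o} |
    (linear (k : E2 Omega E -> R^o) /\ young_functional k) /\ k unit_E2 <= M].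
  have cW : closed W.
    move=> k clk; pose H := within W (nbhs k).
    have pH : ProperFilter H by exact: within_nbhs_proper.
    have Hk : H --> k by exact: cvg_within.
    have HW : H W by exact: withinT.
    split; first by apply: (young_functional_closed pH Hk); apply: filterS HW => ? [].
    have ev : (fun k : {ptws E2 Omega E -> R^o} => k unit_E2) @ H --> k unit_E2.
      by apply: cvg_trans (evc unit_E2 k); exact: cvg_app.
    apply: (closed_cvg (fun r : R^o => r <= M) (@closed_le R M) _ _ ev).
    by apply: filterS HW => ? [].
  have WK0 : W `<=` K0.
    move=> l [[llin ly] lM] f; rewrite /= in_itv/= -ler_norml.
    apply: le_trans (young_functional_bound f llin ly) _.
    by rewrite ler_wpM2r// E2_norm_ge0.
  have FW : (e @ F) W.
    by apply: (@filterS _ F _ U) => // l lM; split => //; exact: eP.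
  have pe : ProperFilter (e @ F) by exact: fmap_proper_filter.
  have [k [[[klin ky] kM] clk]] := subclosed_compact cW cK0 WK0 pe FW.
  have kdual : E2_dual Omega E k.
    by split => //; exists (k unit_E2) => f; exact: young_functional_bound.
  pose k1 : E2_dual Omega E := exist _ k (mem_set kdual).
  (* Representability brings the cluster point back among the Young measures. *)
  have k1Y : Y2 Omega E k1.
    by have [nu hnu] := rep _ klin ky; exists nu.
  pose k2 : Y2 Omega E := exist _ k1 (mem_set k1Y).
  exists k2; split => // A B FA.
  rewrite nbhsE => -[_ [[_ [W2 oW2 <-] <-] /= Wk2] sub].
  have [|_ [[l Al <-] Wl]] := clk (e @` A) W2 _ (open_nbhs_nbhs (conj oW2 Wk2)).
    by apply: (@filterS _ F _ A) => // l Al; exists l.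
  by exists l; split => //; exact: sub.
by move=> l [nu Ynu lnu]; rewrite /U /= /e (lnu unit_E2); apply: pairing_unit_le; exact: hM.
Qed.

End young_functional.

(** * Densities and marginals *)

Section parameter_integrals.
Context d1 d2 (T1 : measurableType d1) (T2 : measurableType d2) (R : realType).

Lemma measurable_parameter_integral (P : probability T2 R) (F : T1 * T2 -> R) :
  measurable_fun setT F ->
  measurable_fun setT (fun x => (\int[P]_u F (x, u) : measurableTypeR R)).
Proof.
move=> mF; rewrite /Rintegral.
apply: (measurableT_comp (fine_measurable measurableT)).
have mE : measurable_fun setT (EFin \o F) by exact/measurable_EFinP.
have -> : (fun x => \int[P]_u (F (x, u))%:E)%E =
  (fun x => fubini_F P (fun p => (EFin \o F)^\+ p)%E x -
            fubini_F P (fun p => (EFin \o F)^\- p)%E x)%E.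
  apply/funext => x; rewrite [LHS]integralE; congr (_ - _)%E;
    by apply: eq_integral => u _; rewrite ?funeposE ?funenegE.
apply: emeasurable_funB.
- apply: measurable_fun_fubini_tonelli_F => //; exact: measurable_funepos.
- apply: measurable_fun_fubini_tonelli_F => //; exact: measurable_funeneg.
Qed.

Lemma measurable_parameter_eintegral (P : probability T2 R) (F : T1 * T2 -> \bar R) :
  measurable_fun setT F -> (forall p, 0 <= F p)%E ->
  measurable_fun setT (fun x => \int[P]_u F (x, u))%E.
Proof. by move=> mF F0; exact: measurable_fun_fubini_tonelli_F. Qed.

Lemma Rfubini (m1 : {sigma_finite_measure set T1 -> \bar R})
    (m2 : {sigma_finite_measure set T2 -> \bar R}) (f : T1 * T2 -> R) :
  (m1 \x m2)%E.-integrable setT (EFin \o f) ->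
  m1.-integrable setT (EFin \o (fun x => \int[m2]_y f (x, y))) /\
  \int[m1]_x \int[m2]_y f (x, y) = \int[(m1 \x m2)%E]_z f z.
Proof.
move=> intf.
have intF := integrable_fubini_F intf.
have mF := measurable_int _ intF.
have mfF : measurable_fun setT (EFin \o (fun x => \int[m2]_y f (x, y))).
  by apply/measurable_EFinP; exact: measurableT_comp (fine_measurable measurableT) mF.
(* The inner integral may be infinite on a null set, where [fine] makes it 0. *)
have aeF : ae_eq m1 setT (EFin \o (fun x => \int[m2]_y f (x, y)))
    (fubini_F m2 (EFin \o f)).
  by apply: filterS (integrable_ae measurableT intF) => x h _; rewrite /= fineK//; exact: h.
split.
  apply/integrableP; split => //.
  have /integrableP[_] := intF; congr (_ < _)%E; apply: ae_eq_integral => //.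
  - exact: measurableT_comp.
  - exact: measurableT_comp.
  - by apply: filterS aeF => x h Dx /=; rewrite -(h Dx).
rewrite {1}/Rintegral (ae_eq_integral _ _ _ _ _ aeF)//.
by rewrite integral12_prod_meas1.
Qed.

End parameter_integrals.

Section randomizes_Rintegral.
Context dX dY dU (X : measurableType dX) (Y : measurableType dY)
  (U : measurableType dU) (R : realType).

Lemma randomizes_Rintegral (mu : {measure set (X * Y)%type -> \bar R})
    (m : {sigma_finite_measure set X -> \bar R}) (P : probability U R)
    (G : X * U -> Y) (f : X * Y -> R) :
  randomizes mu m P G -> mu.-integrable setT (EFin \o f) ->
  m.-integrable setT (EFin \o (fun x => \int[P]_u f (x, G (x, u)))) /\
  \int[m]_x \int[P]_u f (x, G (x, u)) = \int[mu]_p f p.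
Proof.
move=> rG intf; have [mG muE] := rG.
pose h (p : X * U) := (p.1, G p).
have mh : measurable_fun setT h by exact: measurable_fun_pair.
have mf : measurable_fun setT (EFin \o f) by exact: measurable_int intf.
have intfh : (m \x P)%E.-integrable setT (EFin \o (f \o h)).
  apply/integrableP; split; first exact: (measurableT_comp mf mh).
  have /integrableP[_] := intf; congr (_ < _)%E.
  rewrite (randomizes_integral rG)//; last exact: measurableT_comp.
  rewrite fubini_tonelli1//.
  by apply: measurableT_comp => //; exact: (measurableT_comp mf mh).
have [int1 E1] := Rfubini intfh.
split; first exact: int1.
rewrite [LHS]E1 /Rintegral; congr fine.
rewrite -[RHS](@eq_measure_integral _ _ _ _ _ (measure_push mh (m \x P)%E)); last first.
  move=> C mC _; rewrite muE// /= /measure_push0 /pushforward; apply: eq_integral => x _ /=.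
  by congr (P _); apply/seteqP; split => u; rewrite /xsection/= inE.
by rewrite [RHS](integral_pushforward mh mf).
Qed.

End randomizes_Rintegral.

Lemma integral_law d1 d2 (T1 : measurableType d1) (T2 : measurableType d2)
    (R : realType) (P : probability T1 R) (g : T1 -> T2)
    (mg : measurable_fun setT g) (f : T2 -> \bar R) : measurable_fun setT f ->
  (\int[law mg P]_z f z = \int[P]_u f (g u))%E.
Proof.
move=> mf; rewrite integralE [RHS]integralE; congr (_ - _)%E.
- rewrite [LHS](ge0_integral_pushforward mg)//; last exact: measurable_funepos.
  by rewrite preimage_setT; apply: eq_integral => u _; rewrite /= !funeposE.
- rewrite [LHS](ge0_integral_pushforward mg)//; last exact: measurable_funeneg.
  by rewrite preimage_setT; apply: eq_integral => u _; rewrite /= !funenegE.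
Qed.

Lemma Rintegral_law d1 d2 (T1 : measurableType d1) (T2 : measurableType d2)
    (R : realType) (P : probability T1 R) (g : T1 -> T2)
    (mg : measurable_fun setT g) (f : T2 -> R) : measurable_fun setT f ->
  \int[law mg P]_z f z = \int[P]_u f (g u).
Proof. by move=> mf; rewrite /Rintegral integral_law//; exact/measurable_EFinP. Qed.

Section density.
Context d (T : measurableType d) (R : realType).
Variables (mu : {finite_measure set T -> \bar R}) (w : T -> R).
Hypotheses (mw : measurable_fun setT w) (w01 : forall x, 0 <= w x <= 1).

Definition density0 (A : set T) : \bar R := (\int[mu]_(x in A) (w x)%:E)%E.

Let mwE : measurable_fun setT (EFin \o w). Proof. exact/measurable_EFinP. Qed.

Let w0 x : (0 <= (w x)%:E)%E.
Proof. by rewrite lee_fin; have /andP[] := w01 x. Qed.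

Let density00 : density0 set0 = 0%E. Proof. exact: integral_set0. Qed.

Let density0_ge0 A : (0 <= density0 A)%E.
Proof. by apply: integral_ge0 => x _. Qed.

Let density0_sigma_additive : semi_sigma_additive density0.
Proof.
move=> F mF tF mUF; rewrite /density0 ge0_integral_bigcup//.
  by apply: is_cvg_nneseries => n _ _; apply: integral_ge0 => x _.
exact: measurable_funTS.
Qed.

HB.instance Definition _ := isMeasure.Build _ _ _ density0
  density00 density0_ge0 density0_sigma_additive.

Let density0_le (A : set T) : measurable A -> (density0 A <= mu A)%E.
Proof.
move=> mA; rewrite /density0 -[leRHS]mul1e -integral_cst//.
apply: ge0_le_integral => //; first exact: measurable_funTS.
by move=> x _; rewrite lee_fin; have /andP[] := w01 x.
Qed.

Let density0_fin : fin_num_fun density0.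
Proof.
move=> A mA; rewrite ge0_fin_numE//; apply: le_lt_trans (density0_le mA) _.
by rewrite ltey_eq fin_num_measure.
Qed.

HB.instance Definition _ := Measure_isFinite.Build _ _ _ density0 density0_fin.

Definition density : {finite_measure set T -> \bar R} := density0.

(** [w] agrees almost everywhere with the Radon-Nikodym derivative, for which the change of
    variables is known. *)
Lemma density_integral (f : T -> \bar R) : measurable_fun setT f ->
  (forall x, 0 <= f x)%E ->
  (\int[density]_x f x = \int[mu]_x (f x * (w x)%:E))%E.
Proof.
move=> mf f0.
have dom : density `<< mu.
  move=> N hN A mA AN; apply/eqP; rewrite eq_le measure_ge0 andbT.
  by apply: le_trans (density0_le mA) _; rewrite hN.
rewrite -(Radon_Nikodym_SigmaFinite.change_of_variables dom)//.
have intw : mu.-integrable setT (EFin \o w).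
  apply/integrableP; split => //.
  rewrite (_ : (fun x => `|_|%E) = EFin \o w).
    by have := density0_fin measurableT; rewrite /density0 ltey_eq => ->.
  by apply/funext => x /=; rewrite ger0_norm//; have /andP[] := w01 x.
have ae : ae_eq mu setT (Radon_Nikodym_SigmaFinite.f density mu) (EFin \o w).
  apply: integral_ae_eq => //.
    exact: Radon_Nikodym_SigmaFinite.f_integrable.
  by move=> A _ mA; rewrite -Radon_Nikodym_SigmaFinite.f_integral.
apply: ae_eq_integral => //.
- apply: emeasurable_funM => //.
  by apply: measurable_int; exact: Radon_Nikodym_SigmaFinite.f_integrable.
- exact: emeasurable_funM.
- by apply: filterS ae => x h Dx; rewrite (h Dx).
Qed.

End density.

Lemma continuous_borel_real (T : ptopologicalType) (R : realType) (f : T -> R) :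
  continuous f -> measurable_fun [set: borel T] (f : borel T -> measurableTypeR R).
Proof.
move=> /continuousP cf; apply: (@measurability _ _ (borel T) (measurableTypeR R) setT f _
  (RGenOpens.measurableE R)) => _ [V [a [b ->]] <-].
by rewrite setTI; apply: borel_open; apply: cf; exact: interval_open.
Qed.

Section integral_concentrated.
Context d (T : measurableType d) (R : realType).
Local Open Scope ereal_scope.

Lemma integral_null_setC (m : {measure set T -> \bar R}) (D : set T) (f : T -> \bar R) :
  measurable D -> m (~` D) = 0 -> measurable_fun setT f ->
  \int[m]_x f x = \int[m]_(x in D) f x.
Proof.
move=> mD m0 mf; rewrite [RHS]integral_mkcond; apply: ae_eq_integral => //.
  by apply/(measurable_restrictT _ _).1 => //; exact: measurable_funTS.
exists (~` D); split; [exact: measurableC|by []|].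
move=> x /= h Dx; apply: h => _; rewrite patchE mem_set//.
Qed.

Lemma bounded_integrable (m : {finite_measure set T -> \bar R}) (D : set T)
    (f : T -> R) (M : R) : measurable D -> measurable_fun D f ->
  (forall x, D x -> `|f x| <= M)%R -> m.-integrable D (EFin \o f).
Proof.
move=> mD mf fM; apply: measurable_bounded_integrable => //.
  by rewrite ltey_eq fin_num_measure.
by exists M; split; [exact: num_real|move=> N MN x Dx; exact: le_trans (fM x Dx) (ltW MN)].
Qed.

Lemma integral_mrestr (m : {measure set T -> \bar R}) (D : set T) (mD : measurable D)
    (f : T -> \bar R) : measurable_fun setT f ->
  \int[mrestr m mD]_x f x = \int[m]_(x in D) f x.
Proof.
move=> mf; rewrite (@integral_null_setC _ D)//; last first.
  by rewrite /= /mrestr setICl measure0.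
by apply: eq_measure_integral => A mA AD; rewrite /= /mrestr (setIidl AD).
Qed.

Lemma Rintegral_null_setC (m : {measure set T -> \bar R}) (D : set T) (f : T -> R) :
  measurable D -> m (~` D) = 0 -> measurable_fun setT f ->
  (\int[m]_x f x = \int[m]_(x in D) f x)%R.
Proof.
move=> mD m0 mf; congr fine; apply: integral_null_setC => //.
exact/measurable_EFinP.
Qed.

End integral_concentrated.

Section product_measure_eq.
Context (R : realType) (T1 T2 : ptopologicalType).
Local Notation BT := (borel T1 * borel T2)%type.

Definition has_bumps (T : ptopologicalType) : Prop :=
  forall U : set T, open U -> exists h : T -> R,
    [/\ continuous h, forall z, 0 <= h z & forall z, U z <-> 0 < h z].

Lemma bump_approx (T : ptopologicalType) (U : set T) : has_bumps T -> open U ->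
  exists phi : nat -> T -> R, [/\ forall k, continuous (phi k),
    forall k x, 0 <= phi k x <= 1,
    forall x, {homo phi ^~ x : m n / (m <= n)%N >-> m <= n} &
    forall x, \forall k \near \oo, phi k x = \1_U x].
Proof.
move=> hb /hb[h [ch h0 hU]].
exists (fun k x => Num.min 1 (k%:R * h x)); split.
- move=> k x; apply: (@continuous_min _ _ (cst 1) (fun x => k%:R * h x) x).
    exact: cvg_cst.
  by apply: cvgMr; exact: ch.
- by move=> k x; rewrite le_min ler01 ge_min lexx/= mulr_ge0.
- move=> x m n mn; rewrite le_min ge_min lexx/= ge_min.
  by rewrite ler_wpM2r ?ler_nat ?orbT.
- move=> x; have [Ux|nUx] := pselect (U x).
    have hx : 0 < h x by exact/hU.
    near=> k; rewrite indicE mem_set//= min_l//.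
    rewrite -ler_pdivrMr// div1r ltW//; near: k.
    exact: nbhs_infty_gtr.
  near=> k; rewrite indicE memNset//=; have -> : h x = 0.
    by apply/eqP; rewrite eq_le h0 andbT leNgt; apply/negP => /hU.
  by rewrite mulr0 min_r.
Unshelve. all: by end_near. Qed.

Let rect : set (set BT) :=
  [set B | exists U V, [/\ open U, open V & B = U `*` V]].

Let measurable_rect (A : set BT) : measurable A -> <<s rect >> A.
Proof.
have mid : measurable_fun [set: g_sigma_algebraType rect]
    (idfun : g_sigma_algebraType rect -> BT).
  apply/measurable_fun_pairP; split.
  - apply: (@measurability _ _ _ (borel T1) setT _ (@open T1)) => //.
    move=> _ [U oU <-]; rewrite setTI; apply: sub_sigma_algebra.
    by exists U, setT; split => //; [exact: openT|apply/seteqP; split => -[]//= ? ? []].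
  - apply: (@measurability _ _ _ (borel T2) setT _ (@open T2)) => //.
    move=> _ [U oU <-]; rewrite setTI; apply: sub_sigma_algebra.
    by exists setT, U; split => //; [exact: openT|apply/seteqP; split => -[]//= ? ? []].
by move=> mA; have := mid measurableT A mA; rewrite setTI; exact.
Qed.

(** Products of truncated multiples of bumps increase to the indicator of an open rectangle, and
    open rectangles form a generating family stable under intersection. *)
Lemma finite_measure_eq_continuous (m1 m2 : {finite_measure set BT -> \bar R}) :
  has_bumps T1 -> has_bumps T2 ->
  (forall (phi : T1 -> R) (psi : T2 -> R), continuous phi -> continuous psi ->
    (forall x, 0 <= phi x <= 1) -> (forall x, 0 <= psi x <= 1) ->
    (\int[m1]_p (phi p.1 * psi p.2)%:E = \int[m2]_p (phi p.1 * psi p.2)%:E)%E) ->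
  forall A, measurable A -> m1 A = m2 A.
Proof.
move=> hb1 hb2 m12 A mA.
apply: (@g_sigma_algebra_measure_unique _ _ _ rect _ (fun=> setT)).
- move=> _ [U [V [oU oV ->]]]; apply: measurableX; exact: borel_open.
- by move=> _; exists setT, setT; rewrite setXTT; split => //; exact: openT.
- by apply/seteqP; split => // x _; exists 0%N.
- move=> _ _ [U [V [oU oV ->]]] [U' [V' [oU' oV' ->]]].
  exists (U `&` U'), (V `&` V'); split; [exact: openI|exact: openI|].
  by apply/seteqP; split => -[x y] /=; tauto.
- move=> _ [U [V [oU oV ->]]].
  have [phi [cphi phi01 phile phiE]] := bump_approx hb1 oU.
  have [psi [cpsi psi01 psile psiE]] := bump_approx hb2 oV.
  have E (m : {finite_measure set BT -> \bar R}) :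
      m (U `*` V) = limn (fun k => \int[m]_p (phi k p.1 * psi k p.2)%:E)%E.
    rewrite -monotone_convergence//.
    + rewrite -[in LHS](setIT (U `*` V)) -integral_indic//; last first.
        by apply: measurableX; exact: borel_open.
      apply: eq_integral => -[x y] _; apply/esym/cvg_lim => //.
      apply: cvg_near_cst; near=> k; congr EFin.
      rewrite (_ : phi k x = \1_U x); last by near: k; exact: phiE.
      rewrite (_ : psi k y = \1_V y); last by near: k; exact: psiE.
      by rewrite !indicE in_setX -natrM mulnb.
    + move=> k; apply/measurable_EFinP; apply: measurable_funM.
      * apply: (measurableT_comp (continuous_borel_real (cphi k))).
        exact: measurable_fst.
      * apply: (measurableT_comp (continuous_borel_real (cpsi k))).
        exact: measurable_snd.
    + move=> k p _; rewrite lee_fin; apply: mulr_ge0.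
        by have /andP[] := phi01 k p.1.
      by have /andP[] := psi01 k p.2.
    + move=> p _ m' n mn; rewrite lee_fin; apply: ler_pM.
      * by have /andP[] := phi01 m' p.1.
      * by have /andP[] := psi01 m' p.2.
      * exact: phile.
      * exact: psile.
  by rewrite [LHS]E [RHS]E; congr (limn _); apply/funext => k; exact: m12.
- by move=> k; rewrite ltey_eq fin_num_measure.
- exact: measurable_rect.
Unshelve. all: by end_near. Qed.

End product_measure_eq.

Lemma has_bumps_rV (R : realType) d : has_bumps R 'rV[R]_d.
Proof.
move=> U oU; exists (bump U); split; first exact: bump_continuous.
- exact: bump_ge0.
- by move=> z; exact: bump_gt0.
Qed.

Lemma bounded_lebesgue_rV (R : realType) d (A : set 'rV[R]_d) :
  measurable (A : set (borel 'rV[R]_d)) -> bounded_set A ->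
  (lebesgue_rV R d A < +oo)%E.
Proof.
move=> mA [M [_ /(_ (M + 1))]]; rewrite ltrDl ltr01 => /(_ isT) bA.
pose B : set (borel 'rV[R]_d) :=
  [set v : 'rV[R]_d | forall i, `[- (M + 1), M + 1]%classic (v ord0 i)].
have mB : measurable B.
  rewrite (_ : B = \bigcap_(i in [set: 'I_d])
      ((fun v : 'rV[R]_d => v ord0 i) @^-1` `[- (M + 1), M + 1])).
    apply: fin_bigcap_measurable => // i _.
    rewrite -[X in measurable X]setTI.
    by apply: measurable_coord => //; exact: measurable_itv.
  by apply/seteqP; split => v /= h i; [move=> _|]; exact: h.
apply: (@le_lt_trans _ _ (lebesgue_rV R d B)).
  apply: le_measure; rewrite ?inE// => v Av i /=.
  rewrite in_itv/= -ler_norml; apply: le_trans (bA _ Av).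
  by rewrite [leRHS]mx_normrE; apply: le_trans (le_bigmax _ _ (ord0, i)).
rewrite (@lebesgue_rV_box R d (fun=> `[- (M + 1), M + 1]%classic)) => [|i]; last first.
  exact: measurable_itv.
rewrite ltey_eq; apply/orP; left.
apply: (big_ind (fun x => x \is a fin_num)) => //.
  by move=> x y; exact: fin_numM.
move=> i _; rewrite lebesgue_measure_itv/=; case: ifP => // _.
Qed.

Section cylinder_measure.
Context d1 d2 (T1 : measurableType d1) (T2 : measurableType d2) (R : realType).
Variables (m1 : {sigma_finite_measure set T1 -> \bar R}) (m2 : probability T2 R).
Variables (O : set T1).
Hypotheses (mO : measurable O) (O_fin : (m1 O < +oo)%E).

Let mD : measurable (O `*` [set: T2]). Proof. exact: measurableX. Qed.

Let D_fin : (sigma_finite_product m1 m2 (O `*` setT) < +oo)%E.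
Proof.
rewrite /sigma_finite_product product_measure1E//.
by rewrite [X in (_ * X)%E]probability_setT mule1.
Qed.

(** The product measure cut down to [O x T2] but defined on the whole space, so as to be comparable
    with marginals of finite measures there. *)
Definition cylinder_measure : {finite_measure set (T1 * T2)%type -> \bar R} :=
  mfrestr mD D_fin.

Lemma integral_cylinder (f : T1 * T2 -> \bar R) : measurable_fun setT f ->
  (\int[cylinder_measure]_p f p = \int[(m1 \x m2)%E]_p (f \_ (O `*` setT)) p)%E.
Proof. by move=> mf; rewrite -integral_mkcond; exact: integral_mrestr. Qed.

Let measurable_patch (f : T1 * T2 -> \bar R) : measurable_fun setT f ->
  measurable_fun setT (f \_ (O `*` setT)).
Proof.
by move=> mf; apply/(measurable_restrictT _ _).1 => //; exact: measurable_funTS.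
Qed.

Lemma Rintegral_cylinder (f : T1 * T2 -> R) :
  cylinder_measure.-integrable setT (EFin \o f) ->
  \int[cylinder_measure]_p f p = \int[m1]_(x in O) \int[m2]_y f (x, y).
Proof.
move=> intf; have mf : measurable_fun setT (EFin \o f) by exact: measurable_int intf.
have intD : (m1 \x m2)%E.-integrable setT (EFin \o (f \_ (O `*` setT))).
  rewrite -restrict_EFin; apply/integrableP; split; first exact: measurable_patch.
  have mfa : measurable_fun setT (fun p => `|(EFin \o f) p|)%E.
    exact: measurableT_comp.
  have /integrableP[_] := intf; apply: le_lt_trans.
  rewrite le_eqVlt; apply/orP; left; apply/eqP/esym.
  apply: (etrans (integral_cylinder mfa)).
  by apply: eq_integral => p _; rewrite !patchE; case: ifP => //; rewrite abse0.
rewrite [RHS]Rintegral_mkcond.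
transitivity (\int[(m1 \x m2)%E]_p (f \_ (O `*` setT)) p).
  rewrite /Rintegral; apply: (congr1 fine); apply: (etrans (integral_cylinder mf)).
  by apply: eq_integral => p _; rewrite restrict_EFin.
apply: (etrans (esym (Rfubini intD).2)).
apply: eq_Rintegral => x _; rewrite patchE.
case: ifPn => xO.
  apply: eq_Rintegral => y _; rewrite patchE mem_set//; split => //; exact: set_mem.
rewrite /Rintegral integral0_eq// => y _; rewrite patchE memNset// => -[/= Ox _].
by move: xO; rewrite mem_set.
Qed.

End cylinder_measure.

Lemma density_Rintegral d (T : measurableType d) (R : realType)
    (mu : {finite_measure set T -> \bar R}) (w : T -> R) (mw : measurable_fun setT w)
    (w01 : forall x, 0 <= w x <= 1) (f : T -> R) : measurable_fun setT f ->
  \int[density mu mw w01]_x f x = \int[mu]_x (f x * w x).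
Proof.
move=> mf; have mfE : measurable_fun setT (EFin \o f) by exact/measurable_EFinP.
congr fine; rewrite integralE [RHS]integralE; congr (_ - _)%E.
- rewrite density_integral//; last exact: measurable_funepos.
  apply: eq_integral => x _; rewrite !funeposE /= EFinM maxeMl ?mul0e//.
  by rewrite lee_fin; have /andP[] := w01 x.
- rewrite density_integral//; last exact: measurable_funeneg.
  apply: eq_integral => x _; rewrite !funenegE /= -mulNr EFinM maxeMl ?mul0e//.
  by rewrite lee_fin; have /andP[] := w01 x.
Qed.

Section disintegrate_density.
Context dX dY (X : measurableType dX) (Y : measurableType dY) (R : realType).
Variables (mu : {finite_measure set (X * Y)%type -> \bar R}) (w : X * Y -> R).
Hypotheses (mw : measurable_fun setT w) (w01 : forall p, 0 <= w p <= 1).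
Variables (b : Y -> Y) (mb : measurable_fun setT b).
Variable m : {finite_measure set X -> \bar R}.
Hypothesis mE : forall A, measurable A ->
  m A = finite_push measurable_fst (density mu mw w01) A.

(* [h] fixes the first component, so the image of the density under [h] still has
   marginal [m]. *)
Let h (p : X * Y) := (p.1, b p.2).

Let mh : measurable_fun setT h.
Proof. by apply: measurable_fun_pair => //; exact: measurableT_comp mb measurable_snd. Qed.

(** The bound is asked of [f(x, b y) w(x, y)] and not of [f], since integrands grow linearly and
    become bounded only after the transformation [T]. *)
Lemma disintegrate_density : randomizable Y R ->
  exists dU (U : measurableType dU) (P : probability U R) (G : X * U -> Y),
  [/\ measurable_fun setT G,
    forall f : X * Y -> \bar R, measurable_fun setT f -> (forall p, 0 <= f p)%E ->
      (\int[m]_x \int[P]_u f (x, G (x, u)) = \int[mu]_p (f (p.1, b p.2) * (w p)%:E))%E &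
    forall (f : X * Y -> R) (M : R), measurable_fun setT f ->
      (forall p, `|f (p.1, b p.2) * w p| <= M) ->
      m.-integrable setT (EFin \o (fun x => \int[P]_u f (x, G (x, u)))) /\
      \int[m]_x \int[P]_u f (x, G (x, u)) = \int[mu]_p (f (p.1, b p.2) * w p)].
Proof.
pose mut := finite_push mh (density mu mw w01).
move=> /(_ _ X mut)[dU [U [P [G [mG GE]]]]]; exists dU, U, P, G.
have rG : randomizes mut m P G.
  split => // C mC; rewrite GE//; apply: eq_measure_integral => A mA _.
  by rewrite [RHS]mE.
have I (f : X * Y -> \bar R) : measurable_fun setT f -> (forall p, 0 <= f p)%E ->
    (\int[mut]_p f p = \int[mu]_p (f (p.1, b p.2) * (w p)%:E))%E.
  move=> mf f0; rewrite [LHS](ge0_integral_pushforward mh)//.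
  rewrite preimage_setT; apply: (@density_integral _ _ _ mu w mw w01 (f \o h)).
    exact: measurableT_comp.
  by move=> p; exact: f0.
split => //.
- by move=> f mf f0; rewrite -(randomizes_integral rG)// I.
- move=> f M mf fM.
  have mfh : measurable_fun setT (f \o h) by exact: measurableT_comp.
  have intf : mut.-integrable setT (EFin \o f).
    apply/integrableP; split; first exact/measurable_EFinP.
    rewrite I//; last by apply: measurableT_comp => //; exact/measurable_EFinP.
    have /integrableP[_] : mu.-integrable setT (EFin \o (fun p => f (h p) * w p)).
      apply: (@bounded_integrable _ _ _ mu setT _ M measurableT _ (fun p _ => fM p)).
      exact: (measurable_funM mfh mw).
    congr (_ < _)%E; apply: eq_integral => p _ /=.
    by rewrite normrM [X in _ * X]ger0_norm//; have /andP[] := w01 p.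
  have [i1 ->] := randomizes_Rintegral rG intf; split => //.
  rewrite -(density_Rintegral _ _ _ mfh); congr fine.
  rewrite [LHS](integral_pushforward mh)//; first exact/measurable_EFinP.
  apply/integrableP; split; first exact/measurable_EFinP.
  have /integrableP[_] := intf; apply: le_lt_trans.
  rewrite le_eqVlt; apply/orP; left; apply/eqP/esym.
  rewrite [LHS](ge0_integral_pushforward mh)//; apply: measurableT_comp => //.
  exact/measurable_EFinP.
Qed.

End disintegrate_density.

Lemma density_null d (T : measurableType d) (R : realType)
    (mu : {finite_measure set T -> \bar R}) (w : T -> R) (mw : measurable_fun setT w)
    (w01 : forall x, 0 <= w x <= 1) (A : set T) : measurable A ->
  density mu mw w01 A = 0%E -> mu (A `&` [set x | 0 < w x]) = 0%E.
Proof.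
move=> mA dA.
have mwA : measurable_fun A (EFin \o w) by apply/measurable_EFinP; exact: measurable_funTS.
have : (\int[mu]_(x in A) `|(EFin \o w) x| = 0)%E.
  rewrite -[RHS]dA; apply: eq_integral => x _ /=; rewrite ger0_norm//.
  by have /andP[] := w01 x.
move=> /(ae_eq_integral_abs mu mA mwA)[N [mN N0 AN]].
have mB : measurable (A `&` [set x | 0 < w x]).
  rewrite (_ : [set _ | _] = w @^-1` `]0, +oo[).
    by apply: measurableI => //; rewrite -[X in measurable X]setTI; exact: (mw measurableT).
  by apply/seteqP; split => x /=; rewrite in_itv/= andbT.
apply/eqP; rewrite eq_le measure_ge0 andbT -N0; apply: le_measure; rewrite ?inE//.
move=> x [Ax /= wx]; apply: AN => /= /(_ Ax)[w0].
by rewrite w0 ltxx in wx.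
Qed.

Lemma cylinder_measure0 d1 d2 (T1 : measurableType d1) (T2 : measurableType d2)
    (R : realType) (m1 : {sigma_finite_measure set T1 -> \bar R}) (m2 : probability T2 R)
    (O : set T1) (mO : measurable O) (O_fin : (m1 O < +oo)%E) (A : set (T1 * T2)) :
  (forall p, A p -> ~ O p.1) -> cylinder_measure m2 mO O_fin A = 0%E.
Proof.
move=> AO; have -> : cylinder_measure m2 mO O_fin A =
  (m1 \x m2)%E (A `&` (O `*` setT)) by [].
rewrite (_ : _ `&` _ = set0) ?measure0//.
by apply/seteqP; split => // p [Ap [Op _]]; exact: AO Ap Op.
Qed.

(** * Young measures from positive functionals *)

Section disintegration.
Variables (R : realType) (d : nat) (Omega : set 'rV[R]_d) (E : normedModType R).
Hypothesis Omega_open : open Omega.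
Hypothesis Omega_bounded : bounded_set Omega.
Hypothesis E_euclidean : euclidean E.
Local Notation X := ('rV[R]_d * torus R d * E)%type.
Local Notation BXi := (borel 'rV[R]_d * borel (torus R d))%type.
Local Notation BX := (borel 'rV[R]_d * borel (torus R d) * borel E)%type.
Local Notation K := (@cpt R d Omega E).
Local Notation leb := (lebesgue_rV R d).
Local Notation tor := (torus_measure R d).

Variables (l : E2 Omega E -> R^o) (mu : {finite_measure set BX -> \bar R}).
Hypothesis l_young : young_functional l.
Hypothesis mu_cpt : mu (~` (K : set BX)) = 0%E.
Hypothesis lE : forall (f : E2 Omega E) g, is_ext Omega f g ->
  l f = \int[mu]_(p in (K : set BX)) g p.

Let mOmega : measurable (Omega : set (borel 'rV[R]_d)).
Proof. exact: borel_open. Qed.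

(** The factor [1 - |z|] of [T], cut off at 0 so as to lie in [[0, 1]] outside the ball as well. *)
Definition weight (p : X) : R := Num.max (1 - `|p.2|) 0.

Lemma weight01 p : 0 <= weight p <= 1.
Proof. by rewrite /weight le_max lexx orbT ge_max ler01 andbT lerBlDr lerDl/=. Qed.

Lemma measurable_norm_snd :
  measurable_fun [set: BX] ((fun p : X => `|p.2|) : BX -> measurableTypeR R).
Proof.
apply: (measurableT_comp (continuous_borel_real _)); last exact: measurable_snd.
exact: norm_continuous.
Qed.

Lemma measurable_weight :
  measurable_fun [set: BX] (weight : BX -> measurableTypeR R).
Proof.
apply: measurable_maxr => //.
by apply: measurable_funB => //; exact: measurable_norm_snd.
Qed.

Definition tor_prob : probability (borel (torus R d)) R := tor.

Definition domain_measure : {finite_measure set BXi -> \bar R} :=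
  @cylinder_measure _ _ _ _ R leb tor_prob _ mOmega
    (bounded_lebesgue_rV mOmega Omega_bounded).

Definition ball_marginal : {finite_measure set BXi -> \bar R} :=
  finite_push measurable_fst (density mu measurable_weight weight01).

(** Test with [phi(x) psi(xi)]: the integral of [phi psi weight] against [mu] is the value of [l] at
    the integrand equal to [phi psi] on [Omega], which the second property of [l] computes. *)
Lemma ball_marginalE A : measurable A -> ball_marginal A = domain_measure A.
Proof.
move=> mA; suff H : forall (phi : 'rV[R]_d -> R) (psi : torus R d -> R),
    continuous phi -> continuous psi ->
    (forall x, 0 <= phi x <= 1) -> (forall x, 0 <= psi x <= 1) ->
    (\int[ball_marginal]_p (phi p.1 * psi p.2)%:E =
     \int[domain_measure]_p (phi p.1 * psi p.2)%:E)%E.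
  (* The two sides only differ by the canonical instances involved, on which the
     kernel is much faster than unification. *)
  exact_no_check (@finite_measure_eq_continuous R 'rV[R]_d (torus R d)
    ball_marginal domain_measure (@has_bumps_rV R d) (@torus_bump R d) H A mA).
move=> {A mA} phi psi cphi cpsi phi01 psi01.
pose F (p : 'rV[R]_d * torus R d) : R := phi p.1 * psi p.2.
have F01 p : 0 <= F p <= 1.
  have /andP[a0 a1] := phi01 p.1; have /andP[b0 b1] := psi01 p.2.
  by rewrite mulr_ge0//= mulr_ile1.
have mF : measurable_fun [set: BXi] (F : BXi -> measurableTypeR R).
  apply: measurable_funM.
    by apply: (measurableT_comp (continuous_borel_real cphi)); exact: measurable_fst.
  by apply: (measurableT_comp (continuous_borel_real cpsi)); exact: measurable_snd.
pose g (p : X) := F p.1 * weight p.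
have cg : continuous g.
  move=> p; apply: cvgM.
    apply: cvgM; apply: continuous_comp.
    - by apply: continuous_comp; exact: cvg_fst.
    - exact: cphi.
    - by apply: continuous_comp; [exact: cvg_fst|exact: cvg_snd].
    - exact: cpsi.
  apply: (@continuous_max _ _ (fun p : X => 1 - `|p.2|) (cst 0)); last exact: cvg_cst.
  apply: cvgB; first exact: cvg_cst.
  by apply: cvg_norm; exact: cvg_snd.
have Vg : Vcpt Omega g by exact: Vcpt_continuous.
have mg : measurable_fun [set: BX] (g : BX -> measurableTypeR R).
  apply: measurable_funM; last exact: measurable_weight.
  by apply: (measurableT_comp mF); exact: measurable_fst.
have L : (\int[ball_marginal]_p (F p)%:E = \int[mu]_p (g p)%:E)%E.
  rewrite [LHS](ge0_integral_pushforward measurable_fst)//; last 2 first.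
  - exact/measurable_EFinP.
  - by move=> p _; rewrite lee_fin; have /andP[] := F01 p.
  rewrite preimage_setT density_integral//.
  - by apply/measurable_EFinP; apply: (measurableT_comp mF); exact: measurable_fst.
  - by move=> p; rewrite lee_fin; have /andP[] := F01 p.1.
have intF (m : {finite_measure set BXi -> \bar R}) : m.-integrable setT (EFin \o F).
  apply: (@bounded_integrable _ _ _ m setT F 1 measurableT mF) => p _.
  by have /andP[F0 F1] := F01 p; rewrite ger0_norm.
have int1 (m : {finite_measure set BXi -> \bar R}) :
    (\int[m]_p (F p)%:E)%E \is a fin_num.
  exact: (integrable_fin_num measurableT (intF m)).
suff : fine (\int[ball_marginal]_p (F p)%:E) = fine (\int[domain_measure]_p (F p)%:E).
  by move=> h; rewrite -[LHS](fineK (int1 _)) -[RHS](fineK (int1 _)) h.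
rewrite L; apply: etrans; last by apply: esym; exact: (Rintegral_cylinder (intF domain_measure)).
transitivity (l (E2_inv Omega g)).
  rewrite (lE (E2_inv_is_ext Vg)); apply: Rintegral_null_setC => //.
  exact: measurable_cpt.
have fE p : E2_inv Omega g p = if `[< Omega p.1.1 >] then F p.1 else 0.
  rewrite E2_invE// /E2_Tinv; case: asboolP => // _.
  rewrite /g /weight/= norm1_shrink max_l ?invr_ge0 ?addr_ge0//.
  by rewrite mulrCA divff ?mulr1// gt_eqF// ltr_pwDl.
rewrite (l_young.2 (E2_inv Omega g)); last by move=> x xi z; rewrite !fE.
apply: eq_Rintegral => x xO; apply: eq_Rintegral => xi _.
by rewrite fE asboolT//; exact: set_mem xO.
Qed.

End disintegration.

(** * The part of the measure in the open ball *)

Section ball_part.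
Variables (R : realType) (d : nat) (Omega : set 'rV[R]_d) (E : normedModType R).
Hypothesis Omega_open : open Omega.
Hypothesis Omega_bounded : bounded_set Omega.
Hypothesis E_euclidean : euclidean E.
Local Notation X := ('rV[R]_d * torus R d * E)%type.
Local Notation BXi := (borel 'rV[R]_d * borel (torus R d))%type.
Local Notation BX := (borel 'rV[R]_d * borel (torus R d) * borel E)%type.
Local Notation K := (@cpt R d Omega E).
Local Notation leb := (lebesgue_rV R d).
Local Notation tor := (torus_measure R d).

(** The value outside the ball is immaterial, because [weight] vanishes there. *)
Definition blow0 (z : E) : E := if `|z| < 1 then blow z else 0.

Lemma measurable_blow0 : measurable_fun [set: borel E] (blow0 : borel E -> borel E).
Proof.
apply: (@measurability _ _ (borel E) (borel E) setT blow0 (@open E)) => //.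
move=> _ [V oV <-]; rewrite setTI.
have oB : open [set z : E | `|z| < 1].
  rewrite (_ : [set _ | _] = Num.norm @^-1` [set r | r < 1])//.
  by apply: open_comp; [move=> z _; exact: norm_continuous|exact: open_lt].
have oW : open [set z : E | `|z| < 1 /\ V (blow z)].
  rewrite openE => z [z1 Vz]; rewrite /interior.
  near=> y; split; first by near: y; exact: (open_nbhs_nbhs (conj oB z1)).
  near: y; have : blow y @[y --> z] --> blow z.
    apply: cvgZ; last exact: cvg_id.
    apply: cvgV; first by rewrite gt_eqF// subr_gt0.
    by apply: cvgB; [exact: cvg_cst|exact: norm_continuous].
  by apply; exact: open_nbhs_nbhs.
have [V0|V0] := pselect (V 0).
  rewrite (_ : _ @^-1` _ = [set z : E | `|z| < 1 /\ V (blow z)] `|` ~` [set z : E | `|z| < 1]).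
    apply: (@measurableU _ (borel E)); first exact: borel_open.
    by apply: (@measurableC _ (borel E)); exact: borel_open.
  apply/seteqP; split => z /=; rewrite /blow0.
    by case: ifPn => [z1 Vz|z1 _]; [left|right; exact/negP].
  by move=> [[-> //]|/negP/negbTE ->].
rewrite (_ : _ @^-1` _ = [set z : E | `|z| < 1 /\ V (blow z)]); first exact: borel_open.
by apply/seteqP; split => z /=; rewrite /blow0; case: ifPn => // [z1 []//|_ [] //].
Unshelve. all: by end_near. Qed.

Lemma measurable_E2 (f : E2 Omega E) :
  measurable_fun [set: BX] ((f : X -> R) : BX -> measurableTypeR R).
Proof.
have oD : open (over_domain Omega [set: E]).
  rewrite (_ : over_domain _ _ = (fun p : X => p.1.1) @^-1` Omega).
    apply: open_comp => // p _; apply: continuous_comp; exact: cvg_fst.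
  by apply/seteqP; split => -[[x xi] z] //= [[]].
have mD : measurable (over_domain Omega [set: E] : set BX) by exact: measurable_open_BX.
have mf : measurable_fun (over_domain Omega [set: E] : set BX)
    ((f : X -> R) : BX -> measurableTypeR R).
  have [cf _ _] : E2_set Omega f by have := valP f; rewrite inE.
  apply: within_continuous_measurable => //.
  - exact: countably_based_rV.
  - exact: countably_based_torus.
  - exact: euclidean_countably_based.
rewrite (_ : (f : X -> R) = (f : X -> R) \_ (over_domain Omega [set: E])).
  by have := (measurable_restrictT _ mD).1 mf.
apply/funext => p; rewrite patchE; case: ifPn => // pD.
apply: E2_vanish => Op; move: pD; rewrite mem_set//; case: p Op => -[x xi] z Ox.
Qed.

Lemma ball_transform (f : E2 Omega E) g p : is_ext Omega f g ->
  f (p.1, blow0 p.2) * weight p =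
  if `[< Omega p.1.1 /\ `|p.2| < 1 >] then g p else 0.
Proof.
move=> fg; rewrite /weight /blow0.
case: asboolP => [[Op p1]|]; last first.
  have [Op|nOp _] := pselect (Omega p.1.1); last by rewrite E2_vanish ?mul0r.
  have [p1 h|p1 _] := ltP `|p.2| 1; first by case: h.
  by rewrite max_r ?mulr0// subr_le0.
rewrite p1 max_l ?subr_ge0 ?ltW// (is_extE fg)//= blowK// norm1_blow//.
by rewrite mulrAC mulVf ?mul1r -?surjective_pairing// gt_eqF// subr_gt0.
Qed.

Variables (l : E2 Omega E -> R^o) (mu : {finite_measure set BX -> \bar R}).
Hypothesis l_young : young_functional l.
Hypothesis mu_cpt : mu (~` (K : set BX)) = 0%E.
Hypothesis lE : forall (f : E2 Omega E) g, is_ext Omega f g ->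
  l f = \int[mu]_(p in (K : set BX)) g p.

Let dom := domain_measure Omega_open Omega_bounded.

(** The marginal of [weight * mu] is carried by [Omega], and [weight] is positive in the open ball.
    A mass there over the boundary of [Omega] would fit in neither term of the pairing. *)
Lemma boundary_ball_null :
  mu [set p : X | ~ Omega p.1.1 /\ `|p.2| < 1] = 0%E.
Proof.
pose A : set BXi := ~` (Omega : set (borel 'rV[R]_d)) `*` setT.
have mA : measurable A.
  by apply: measurableX => //; apply: measurableC; exact: borel_open.
have mA' : measurable (fst @^-1` A : set BX).
  by rewrite -[X in measurable X]setTI; exact: measurable_fst.
have dA : density mu (@measurable_weight R d E) (@weight01 R d E) (fst @^-1` A) = 0%E.
  have := ball_marginalE Omega_open Omega_bounded E_euclidean l_young mu_cpt lE mA.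
  move=> h; apply: (etrans h); apply: cylinder_measure0.
  by move=> p [].
rewrite -[RHS](density_null mA' dA); congr (mu _).
apply/seteqP; split => -[[x xi] z] /=; rewrite /weight lt_max ltxx orbF subr_gt0.
  by move=> [nO z1]; split.
by move=> [[]].
Qed.

Lemma ball_disintegration : exists dU (U : measurableType dU) (P : probability U R)
    (G : BXi * U -> borel E),
  [/\ measurable_fun setT G,
    (\int[dom]_t \int[P]_u `|(G (t, u) : E)|%:E < +oo)%E &
    forall (f : E2 Omega E) g, is_ext Omega f g ->
      \int[leb]_(x in Omega) \int[tor]_xi \int[P]_u f (x, xi, G ((x, xi), u)) =
      \int[mu]_p (if `[< Omega p.1.1 /\ `|p.2| < 1 >] then g p else 0)].
Proof.
have mE A (mA : measurable A) := esym (ball_marginalE Omega_open Omega_bounded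
  E_euclidean l_young mu_cpt lE mA).
have [dU [U [P [G [mG Ge0 GR]]]]] := disintegrate_density measurable_blow0 mE
  (euclidean_randomizable E_euclidean).
exists dU, U, P, G; split => //.
- have mN : measurable_fun [set: BX] (fun p : X => `|p.2|%:E : \bar R).
    by apply/measurable_EFinP; exact: measurable_norm_snd.
  have := Ge0 _ mN (fun p => normr_ge0 p.2).
  (* For [|z| < 1], the norm of [blow z] times [1 - |z|] is [|z|], so the first moment is at most
     the total mass of [mu]. *)
  move=> h; apply: (@le_lt_trans _ _ (\int[mu]_p (1%:E : \bar R))%E); last first.
    by rewrite integral_cst// mul1e ltey_eq fin_num_measure.
  apply: (le_trans (y := \int[mu]_p (`|blow0 p.2|%:E * (weight p)%:E))%E).
    by rewrite le_eqVlt; apply/orP; left; apply/eqP; exact: h.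
  apply: ge0_le_integral_nomeas.
  + move=> p _; rewrite -EFinM lee_fin; apply: mulr_ge0 => //.
    by have /andP[] := weight01 p.
  + by move=> p _; rewrite lee_fin.
  + by [].
  + move=> p _; rewrite -EFinM lee_fin /blow0 /weight.
    case: ltP => p1; last by rewrite normr0 mul0r.
    rewrite max_l ?subr_ge0 ?ltW// /blow normrZ.
    rewrite ger0_norm ?invr_ge0 ?subr_ge0 ?ltW//.
    by rewrite mulrAC mulVf ?mul1r ?ltW// gt_eqF// subr_gt0.
- move=> f g fg.
  have [M gM] := Vcpt_bounded Omega_bounded E_euclidean fg.1.
  have bd p : `|f (p.1, blow0 p.2) * weight p| <= Num.max M 0.
    rewrite (ball_transform _ fg); case: asboolP => [[Op p1]|_].
      rewrite le_max gM//; apply: sub_cpt; split => //; by split.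
    by rewrite normr0 le_max lexx orbT.
  have [int1 e1] := GR _ _ (measurable_E2 f) bd.
  have := Rintegral_cylinder int1 => e2.
  apply: (etrans (esym e2)); apply: (etrans e1).
  by apply: eq_Rintegral => p _; rewrite (ball_transform _ fg).
Qed.

(** [g] is controlled on the compact set only; the cut-off is bounded and measurable everywhere, as
    the disintegration requires. *)
Definition ext0 (g : X -> R) : X -> R := g \_ K.

Lemma measurable_ext0 g : Vcpt Omega g ->
  measurable_fun [set: BX] (ext0 g : BX -> measurableTypeR R).
Proof.
move=> Vg.
exact: (measurable_restrictT _ (measurable_cpt _ E_euclidean)).1 (measurable_Vcpt E_euclidean Vg).
Qed.

(** The compact set consists of the open ball over [Omega], the sphere over the closure, and the
    null set of [boundary_ball_null]. *)
Lemma sphere_split (f : E2 Omega E) g : is_ext Omega f g ->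
  l f = \int[mu]_p (if `[< Omega p.1.1 /\ `|p.2| < 1 >] then g p else 0) +
        \int[mu]_p (ext0 g p * \1_[set p : X | `|p.2| = 1] p).
Proof.
move=> fg.
have [M gM] := Vcpt_bounded Omega_bounded E_euclidean fg.1.
have ext0M p : `|ext0 g p| <= Num.max M 0.
  rewrite /ext0 patchE; case: ifPn => pK; last by rewrite normr0 le_max lexx orbT.
  by rewrite le_max gM//; exact: set_mem pK.
pose F1 (p : X) : R := if `[< Omega p.1.1 /\ `|p.2| < 1 >] then g p else 0.
pose F2 (p : X) : R := ext0 g p * \1_[set p : X | `|p.2| = 1] p.
have mF1 : measurable_fun [set: BX] (F1 : BX -> measurableTypeR R).
  rewrite (_ : F1 = fun p => f (p.1, blow0 p.2) * weight p); last first.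
    by apply/funext => p; rewrite (ball_transform _ fg).
  apply: measurable_funM; last exact: measurable_weight.
  apply: (measurableT_comp (measurable_E2 f)).
  apply: measurable_fun_pair; first exact: measurable_fst.
  exact: measurableT_comp measurable_blow0 measurable_snd.
have mS : measurable ([set p : X | `|p.2| = 1] : set BX).
  rewrite (_ : [set _ | _] = snd @^-1` unit_sphere E)//.
  rewrite -[X in measurable X]setTI; apply: measurable_snd => //.
  exact: measurable_unit_sphere.
have mF2 : measurable_fun [set: BX] (F2 : BX -> measurableTypeR R).
  apply: measurable_funM; first exact: measurable_ext0 fg.1.
  exact: measurable_indic.
have iF1 : mu.-integrable setT (EFin \o F1).
  apply: (@bounded_integrable _ _ _ mu setT F1 (Num.max M 0) measurableT mF1) => p _.
  rewrite /F1; case: asboolP => [[Op p1]|_]; last by rewrite normr0 le_max lexx orbT.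
  by rewrite le_max gM//; apply: sub_cpt; split => //; split.
have iF2 : mu.-integrable setT (EFin \o F2).
  apply: (@bounded_integrable _ _ _ mu setT F2 (Num.max M 0) measurableT mF2) => p _.
  rewrite /F2 normrM; apply: le_trans (ext0M p).
  by rewrite ler_piMr// indicE; case: (_ \in _); rewrite ?normr1 ?normr0.
rewrite -(RintegralD measurableT iF1 iF2) (lE fg) Rintegral_mkcond.
apply: (congr1 fine); apply: ae_eq_integral.
- exact: measurableT.
- by apply/measurable_EFinP; exact: measurable_ext0 fg.1.
- by apply/measurable_EFinP; exact: measurable_funD.
exists [set p : X | ~ Omega p.1.1 /\ `|p.2| < 1]; split.
- apply: measurableI.
    rewrite (_ : (fun p => _) = (fst \o fst) @^-1` (~` (Omega : set (borel 'rV[R]_d))))//.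
    rewrite -[X in measurable X]setTI.
    apply: (measurableT_comp measurable_fst measurable_fst) => //.
    by apply: measurableC; exact: borel_open.
  rewrite (_ : (fun p => _) = (fun p : X => `|p.2|) @^-1` `]-oo, 1[).
    by rewrite -[X in measurable X]setTI; exact: measurable_norm_snd.
  by apply/seteqP; split => p /=; rewrite in_itv.
- exact: boundary_ball_null.
move=> p; apply: contra_notP => /= /not_andP h _.
congr EFin; rewrite /F1 /F2 /ext0 patchE indicE.
case: ifPn => pK; last first.
  rewrite mul0r addr0; case: asboolP => // -[Op p1]; exfalso.
  by apply/negP: pK; rewrite negbK; apply/mem_set; apply: sub_cpt; split => //; split.
have := set_mem pK; rewrite cptE => -[_ /=]; rewrite le_eqVlt => /orP[/eqP p1|p1].
  by rewrite mem_set//= mulr1 asboolF ?add0r// p1 ltxx => -[].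
rewrite memNset/=; last by move=> p1'; rewrite p1' ltxx in p1.
rewrite mulr0 addr0 asboolT//; split => //.
by case: h => // /contrapT.
Qed.

End ball_part.

(** * Disintegration of the sphere part *)

Section disintegrate_twice.
Context d1 d2 dY (T1 : measurableType d1) (T2 : measurableType d2)
  (Y : measurableType dY) (R : realType).
Variables (mu : {finite_measure set (T1 * T2 * Y)%type -> \bar R}).
Variables (S : set Y) (r : Y -> Y) (D : set T1).
Hypotheses (mS : measurable S) (mr : measurable_fun setT r).
Hypothesis rS : forall y, S y -> r y = y.
Hypotheses (mD : measurable D) (muD : mu [set p | ~ D p.1.1] = 0%E).

Let w (p : T1 * T2 * Y) : R := \1_[set p | S p.2] p.

Let mw : measurable_fun setT w.
Proof.
apply: measurable_indic; rewrite (_ : [set _ | _] = snd @^-1` S)//.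
by rewrite -[X in measurable X]setTI; exact: measurable_snd.
Qed.

Let w01 p : 0 <= w p <= 1.
Proof. by rewrite /w indicE; case: (_ \in _); rewrite ?lexx ?ler01. Qed.

(** Restrict [mu] to [S], disintegrate [y] given both other variables, then the second variable
    given the first. The retraction [r] leaves the integrals unchanged and, when its values are in
    [S], puts the kernel in [S] at every point and not only almost everywhere. *)
Lemma disintegrate_twice : randomizable T2 R -> randomizable Y R ->
  exists (lambda : {finite_measure set T1 -> \bar R})
    dU (U : measurableType dU) (P : probability U R) (G : T1 * U -> T2)
    dV (V : measurableType dV) (Q : probability V R) (H : T1 * T2 * V -> Y),
  [/\ lambda (~` D) = 0%E, measurable_fun setT G, measurable_fun setT H &
    forall (f : T1 * T2 * Y -> R) (M : R), measurable_fun setT f ->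
      (forall p, `|f p| <= M) ->
      \int[lambda]_(x in D) \int[P]_u \int[Q]_v
        f ((x, G (x, u)), r (H ((x, G (x, u)), v))) =
      \int[mu]_p (f p * \1_[set p | S p.2] p)].
Proof.
move=> rT2 rY.
pose sigma := finite_push measurable_fst (density mu mw w01).
have mE A (mA : measurable A) : sigma A = finite_push measurable_fst (density mu mw w01) A by [].
have mid : measurable_fun [set: Y] idfun by exact: measurable_id.
have [dV [V [Q [H [mH _ HR]]]]] := disintegrate_density mid mE rY.
have [dU [U [P [G rG]]]] := rT2 _ T1 sigma.
have lambdaD : finite_push measurable_fst sigma (~` D) = 0%E.
  rewrite /= /finite_push0 /= /measure_push0 /pushforward /=.
  rewrite /finite_push0 /= /measure_push0 /pushforward /=.
  apply/eqP; rewrite eq_le; apply/andP; split; last exact: measure_ge0.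
  rewrite -muD /density0; set A := fst @^-1` _.
  have mA : measurable A.
    rewrite /A -[X in measurable X]setTI; apply: measurable_fst => //.
    rewrite -[X in measurable X]setTI; apply: measurable_fst => //.
    exact: measurableC.
  rewrite -[leRHS]mul1e -(integral_cst mu mA 1); apply: ge0_le_integral_nomeas => //.
  + by move=> p _; rewrite lee_fin; have /andP[] := w01 p.
  + by move=> p _; rewrite lee_fin; have /andP[] := w01 p.
exists (finite_push measurable_fst sigma), dU, U, P, G, dV, V, Q, H; split => //.
  by case: rG.
move=> f M mf fM.
pose f' (p : T1 * T2 * Y) : R := f (p.1, r p.2).
have mf' : measurable_fun setT f'.
  apply: (measurableT_comp mf); apply: measurable_fun_pair; first exact: measurable_fst.
  exact: measurableT_comp mr measurable_snd.
have f'M p : `|f' (p.1, idfun p.2) * w p| <= M.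
  rewrite normrM; apply: le_trans (fM (p.1, r p.2)).
  by rewrite ler_piMr// ger0_norm; have /andP[] := w01 p.
have [i1 e1] := HR _ _ mf' f'M.
have [i2 e2] := randomizes_Rintegral rG i1.
rewrite -Rintegral_null_setC; last 3 first.
- exact: mD.
- exact: lambdaD.
- by apply/measurable_EFinP; exact: measurable_int i2.
apply: (etrans e2); apply: (etrans e1).
apply: eq_Rintegral => p _; rewrite /f' /w /= indicE.
case: (boolP (p \in _)) => pS; last by rewrite !mulr0.
by rewrite rS -?surjective_pairing//; exact: (set_mem pS).
Qed.

End disintegrate_twice.

Lemma ae_measurableW d d' (T : measurableType d) (U : measurableType d') (R : realType)
    (mu : set T -> \bar R) (D : set T) (f : T -> U) :
  mu set0 = 0%E -> measurable_fun D f -> ae_measurable mu D f.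
Proof.
move=> mu0 mf; exists f => //; exists set0; split => //.
by move=> x /= h; exfalso; exact: h.
Qed.

Lemma measurable_within_borel (T : ptopologicalType) (R : realType) (S : set T)
    (h : T -> R) : measurable (S : set (borel T)) -> {within S, continuous h} ->
  measurable_fun [set: borel T] (h \_ S : borel T -> measurableTypeR R).
Proof.
move=> mS /continuousP ch.
suff mh : measurable_fun (S : set (borel T)) (h : borel T -> measurableTypeR R).
  by have := (measurable_restrictT _ mS).1 mh.
apply: (@measurability _ _ (borel T) (measurableTypeR R) S h _
  (RGenOpens.measurableE R)) => _ [_ [a [b ->]] <-].
have oab : open (`]a, b[%classic : set R) by exact: interval_open.
have /open_subspaceP[V oV VS] := ch _ oab.
by rewrite setIC -VS; apply: measurableI => //; exact: borel_open.
Qed.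

Lemma weak_star_measurable_law d dU (T : measurableType d) (U : measurableType dU)
    (R : realType) (K : ptopologicalType) (S : set K) (mu : set T -> \bar R)
    (D : set T) (P : probability U R) (G : T * U -> borel K)
    (mGt : forall t, measurable_fun setT (fun u => G (t, u))) :
  mu set0 = 0%E -> measurable_fun setT G -> measurable (S : set (borel K)) ->
  weak_star_measurable S mu D (fun t => law (mGt t) P).
Proof.
move=> mu0 mG mS h [ch _]; apply: ae_measurableW => //; apply: measurable_funTS.
have mh := measurable_within_borel mS ch.
rewrite (_ : (fun t => _) = (fun t => \int[P]_u (h \_ S) (G (t, u)))).
  exact: (measurable_parameter_integral P (measurableT_comp mh mG)).
by apply/funext => t; rewrite Rintegral_mkcond; exact: Rintegral_law.
Qed.

Lemma measurable_retract d (Y : measurableType d) (S : set Y) (e : Y) :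
  measurable S -> measurable_fun setT (fun y => if `[< S y >] then y else e).
Proof.
move=> mS _ B mB; rewrite setTI.
rewrite (_ : _ @^-1` B = (S `&` B) `|` (~` S `&` [set _ | B e])).
  apply: measurableU; first exact: measurableI.
  apply: measurableI; first exact: measurableC.
  have [Be|Be] := pselect (B e).
    by rewrite (_ : [set _ | _] = setT)//; apply/seteqP; split.
  by rewrite (_ : [set _ | _] = set0)//; apply/seteqP; split.
apply/seteqP; split => y /=.
  by case: asboolP => Sy By; [left|right].
by case: asboolP => Sy; tauto.
Qed.

(** Transfers the first moment of [nu], known over [Omega], to the closure over which [ym_nu_L1]
    asks for it. *)
Lemma cylinder_closure_integrable d1 d2 (T1 : measurableType d1)
    (T2 : measurableType d2) (R : realType)
    (m1 : {sigma_finite_measure set T1 -> \bar R}) (m2 : probability T2 R)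
    (O C : set T1) (mO : measurable O) (O_fin : (m1 O < +oo)%E)
    (f : T1 * T2 -> \bar R) :
  measurable C -> O `<=` C -> m1 (C `\` O) = 0%E ->
  measurable_fun setT f -> (forall p, 0 <= f p)%E ->
  (\int[cylinder_measure m2 mO O_fin]_p f p < +oo)%E ->
  (m1 \x m2)%E.-integrable (C `*` setT) f.
Proof.
move=> mC OC CO mf f0 fin; apply/integrableP; split; first exact: measurable_funTS.
have mN : measurable ((C `\` O) `*` [set: T2]).
  by apply: measurableX => //; exact: measurableD.
have N0 : (m1 \x m2)%E ((C `\` O) `*` [set: T2]) = 0%E.
  rewrite product_measure1E//; last exact: measurableD.
  by rewrite [X in (X * _)%E]CO mul0e.
have mCT : measurable (C `*` [set: T2]) by exact: measurableX.
apply: le_lt_trans fin; rewrite le_eqVlt; apply/orP; left; apply/eqP.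
apply: etrans (esym (integral_cylinder m2 mO O_fin mf)).
rewrite -integral_mkcond.
rewrite (ge0_negligible_integral mN mCT _ _ N0)//; last first.
  by apply: measurableT_comp => //; exact: measurable_funTS.
rewrite (_ : _ `\` _ = O `*` setT).
  by apply: eq_integral => p _; rewrite gee0_abs.
apply/seteqP; split => -[x y] /=.
  move=> [[Cx _] h]; split => //; apply: contrapT => nOx; apply: h; split => //.
by move=> [Ox _]; split; [split => //; exact: OC|move=> [[]]].
Qed.

(** * Assembly of the Young measure *)

Section representation.
Variables (R : realType) (d : nat) (Omega : set 'rV[R]_d) (E : normedModType R).
Hypothesis Omega_open : open Omega.
Hypothesis Omega_bounded : bounded_set Omega.
Hypothesis Omega_boundary : lebesgue_rV R d (boundary Omega) = 0%E.
Hypothesis E_euclidean : euclidean E.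
Local Notation X := ('rV[R]_d * torus R d * E)%type.
Local Notation BXi := (borel 'rV[R]_d * borel (torus R d))%type.
Local Notation BX := (borel 'rV[R]_d * borel (torus R d) * borel E)%type.
Local Notation K := (@cpt R d Omega E).

(** A probability carried by the unit sphere shows that the sphere is non-empty. If the closure of
    [Omega] is empty, any [e] will do. *)
Lemma sphere_point : young_measure Omega E ->
  exists e : E, forall x, closure Omega x -> `|e| = 1.
Proof.
move=> nu0; have [[x Ox]|h] := pselect (exists x, closure Omega x); last first.
  by exists 0 => x Ox; exfalso; apply: h; exists x.
have : ym_nuoo nu0 (x, point) (unit_sphere E) = 1%E by exact: ym_nuoo_sphere.
have [[e e1] _|h] := pselect (exists e, unit_sphere E e); first by exists e.
rewrite (_ : unit_sphere E = set0) ?measure0.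
  by move/eqP; rewrite eq_sym onee_eq0.
by apply/seteqP; split => // e e1; apply: h; exists e.
Qed.

Lemma representable_Y2 : young_measure Omega E -> representable Omega E.
Proof.
move=> /sphere_point[e0 e0P] l llin ly.
have [mu [mu0 lE]] :=
  positive_functional_measure Omega_bounded E_euclidean llin ly.1.
have [dU [U [P [G [mG Gfin GE]]]]] :=
  ball_disintegration Omega_open Omega_bounded E_euclidean ly mu0 lE.
have mC : measurable (closure Omega : set (borel 'rV[R]_d)).
  rewrite -(setCK (closure Omega)); apply: measurableC; apply: borel_open.
  by apply: closed_openC; exact: closed_closure.
have mS : measurable (unit_sphere E : set (borel E)) by exact: measurable_unit_sphere.
(* Sending the points off the sphere to [e0] makes [nuoo] a probability on the sphere at every point
   over the closure of [Omega]. *)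
have mr := @measurable_retract _ (borel E) (unit_sphere E) e0 mS.
set r := (fun y : E => _) in mr.
have rS y : unit_sphere E y -> r y = y by move=> y1; rewrite /r asboolT.
have muC : mu [set p : X | ~ closure Omega p.1.1] = 0%E.
  apply/eqP; rewrite eq_le measure_ge0 andbT -mu0; apply: le_measure.
  - rewrite inE; have mD : measurable
        (((fst \o fst) @^-1` ~` (closure Omega : set (borel 'rV[R]_d))) : set BX).
      rewrite -[X in measurable X]setTI.
      apply: (measurableT_comp measurable_fst measurable_fst) => //.
      exact: measurableC.
    exact: mD.
  - by rewrite inE; apply: measurableC; exact: measurable_cpt.
  - by move=> p /= nO; rewrite /= cptE => -[[]].
have [lambda [dU1 [U1 [P1 [G1 [dV [V [Q [H [lambdaC mG1 mH HE]]]]]]]]]] :=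
  disintegrate_twice mS mr rS mC muC (@torus_randomizable R d) (euclidean_randomizable E_euclidean).
have mGt t : measurable_fun setT (fun u => G (t, u)).
  exact: measurableT_comp mG (measurable_pair1 t).
have mG1t x : measurable_fun setT (fun u => G1 (x, u)).
  exact: measurableT_comp mG1 (measurable_pair1 x).
pose H' p : borel E := r (H p).
have mH' : measurable_fun setT H' by exact: (measurableT_comp mr mH).
have mHt t : measurable_fun setT (fun v => H' (t, v)).
  exact: measurableT_comp mH' (measurable_pair1 t).
pose nu t : probability (borel E) R := law (mGt t) P.
pose rho x : probability (borel (torus R d)) R := law (mG1t x) P1.
pose nuoo t : probability (borel E) R := law (mHt t) Q.
have H'S x xi v : closure Omega x -> unit_sphere E (H' ((x, xi), v)).
  by move=> Ox; rewrite /H' /r; case: asboolP => // _; exact: e0P Ox.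
have nu_mes : weak_star_measurable setT (lebesgue_rV R d \x torus_measure R d)%E
    (closure Omega `*` setT) nu.
  by apply: weak_star_measurable_law => //; exact: measure0.
have nu_L1 : L1 (lebesgue_rV R d \x torus_measure R d)%E
    (closure Omega `*` setT) (fun p => \int[nu p]_z `|z|%:E)%E.
  have mN : measurable_fun [set: borel E] (fun z : E => `|z|%:E : \bar R).
    apply/measurable_EFinP; apply: continuous_borel_real; exact: norm_continuous.
  have -> : (fun p => \int[nu p]_z `|z|%:E)%E = (fun p => \int[P]_u `|(G (p, u) : E)|%:E)%E.
    by apply/funext => p; exact: (integral_law P (mGt p) mN).
  exists (fun p => \int[P]_u `|(G (p, u) : E)|%:E)%E; last first.
    exact: aeW.
  have mNG := measurable_parameter_eintegral P (measurableT_comp mN mG)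
    (fun p => normr_ge0 (G p : E)).
  have CO : lebesgue_rV R d (closure Omega `\` Omega) = 0%E.
    by rewrite -[RHS]Omega_boundary /boundary (interior_id _).1.
  have I0 p : (0 <= \int[P]_u `|(G (p, u) : E)|%:E)%E.
    by apply: integral_ge0 => u _; rewrite lee_fin.
  exact: (cylinder_closure_integrable mC (@subset_closure _ Omega) CO mNG I0 Gfin).
have rho_mes : weak_star_measurable setT lambda (closure Omega) rho.
  by apply: weak_star_measurable_law => //; exact: measure0.
have nuoo_sph p : closure Omega p.1 -> nuoo p (unit_sphere E) = 1%E.
  case: p => x xi /= Ox; rewrite -(@probability_setT _ _ _ Q).
  rewrite /law0 /= /finite_push0 /= /measure_push0 /pushforward; congr (Q _).
  by apply/seteqP; split => // v _; exact: H'S.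
have nuoo_mes : weak_star_measurable (unit_sphere E)
    (semidirect_product lambda rho) (closure Omega `*` setT) nuoo.
  apply: weak_star_measurable_law => //.
  by apply: integral0_eq => x _; rewrite xsection0 measure0.
exists (YoungMeasure nu_mes nu_L1 lambdaC rho_mes nuoo_sph nuoo_mes) => f.
have [g fg] := E2_ext f.
rewrite (sphere_split Omega_open Omega_bounded E_euclidean ly mu0 lE fg) /pairing /=.
congr (_ + _).
  rewrite -(GE _ _ fg); apply: eq_Rintegral => x _; apply: eq_Rintegral => xi _.
  apply: esym; apply: Rintegral_law.
  have mf := measurable_E2 Omega_open E_euclidean f.
  exact: (measurableT_comp mf (measurable_pair1 ((x, xi) : BXi))).
have [M gM] := Vcpt_bounded Omega_bounded E_euclidean fg.1.
have ext0M p : `|ext0 Omega g p| <= Num.max M 0.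
  rewrite /ext0 patchE; case: ifPn => pK; last by rewrite normr0 le_max lexx orbT.
  by rewrite le_max gM//; exact: set_mem pK.
have mext := measurable_ext0 E_euclidean fg.1.
rewrite -(HE _ _ mext ext0M); apply: eq_Rintegral => x xC.
have Ox : closure Omega x by exact: set_mem xC.
(* On the sphere the recession function is the boundary value of [g], and [H'] takes its values
   there. *)
have inner xi : \int[nuoo (x, xi)]_(z in unit_sphere E) recession f x xi z =
    \int[Q]_v ext0 Omega g ((x, xi), H' ((x, xi), v)).
  have mx := measurableT_comp mext (measurable_pair1 ((x, xi) : BXi)).
  have mxS : measurable_fun [set: borel E]
      ((fun z : E => ext0 Omega g ((x, xi), z)) \_ (unit_sphere E) : borel E -> measurableTypeR R).
    by apply: (measurable_restrictT _ mS).1; exact: measurable_funTS.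
  transitivity (\int[nuoo (x, xi)]_(z in unit_sphere E) ext0 Omega g ((x, xi), z)).
    apply: eq_Rintegral => z zS; have z1 : `|z| = 1 by exact: set_mem zS.
    rewrite (recession_ext _ fg)//; rewrite /ext0 patchE mem_set// cptE.
    by split; [split|rewrite /= z1].
  rewrite Rintegral_mkcond; apply: (etrans (Rintegral_law Q (mHt (x, xi)) mxS)).
  by apply: eq_Rintegral => v _; rewrite patchE mem_set//; exact: H'S.
have mpsi : measurable_fun [set: BXi]
    ((fun t => \int[Q]_v ext0 Omega g (t, H' (t, v))) : BXi -> measurableTypeR R).
  apply: (@measurable_parameter_integral _ _ BXi V R Q (fun p => ext0 Omega g (p.1, H' p))).
  by apply: (measurableT_comp mext); apply: measurable_fun_pair => //; exact: measurable_fst.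
apply: esym; transitivity (\int[rho x]_xi \int[Q]_v ext0 Omega g ((x, xi), H' ((x, xi), v))).
  by apply: eq_Rintegral => xi _; exact: inner.
exact: (Rintegral_law P1 (mG1t x) (measurableT_comp mpsi (measurable_pair1 x))).
Qed.

End representation.

Theorem proposition3p6 (R : realType) (d : nat) (Omega : set 'rV[R]_d)
    (E : normedModType R)
    (Omega_open : open Omega)
    (Omega_bounded : bounded_set Omega)
    (Omega_boundary : lebesgue_rV R d (boundary Omega) = 0%E)
    (E_euclidean : euclidean E) :
  seq_closed (Y2 Omega E) /\
  forall Y : set (young_measure Omega E),
    (ereal_sup [set mass nu | nu in Y] < +oo)%E ->
    precompact
      [set l : Y2 Omega E | exists2 nu, Y nu & represents nu (set_val l)].
Proof.
have rep := representable_Y2 Omega_open Omega_bounded Omega_boundary E_euclidean.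
split.
  (* The first term of the sequence supplies the Young measure that representability asks for. *)
  move=> u l uY ul; have [nu0 _] := uY 0%N.
  exact: (seq_closed_Y2 (rep nu0)) uY ul.
move=> Y Yfin; have [[nu0 _]|h] := pselect (exists nu : young_measure Omega E, True).
  exact: (precompact_Y2 Omega_bounded E_euclidean (rep nu0)) Yfin.
(* With no Young measure at all, the set in question is empty. *)
apply: (@precompact_subset _ _ set0); last by rewrite precompactE closure0; exact: compact0.
by move=> l [nu _ _]; apply: h; exists nu.
Qed.
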